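(* Let an $SO(3)$-structure be given, with invariant forms $\sigma$, $\eta_0,\eta_1,\eta_2$, $\hat\gamma$. For an invariant $k$-form $\alpha$, the exterior derivative $d\alpha$ at a point depends on the intrinsic torsion $\tau\in T^*\otimes\mathfrak{so}(3)^\perp$ through an $SO(3)$-equivariant linear map $l_\alpha$; say that $d\alpha$ determines the module $(T^*\otimes\mathfrak{so}(3)^\perp)/\ker l_\alpha$. Then: (1) $d\sigma$ determines a module isomorphic to $3\mathbb R\oplus 2V\oplus 2S^2_0(V)$, and as $SO(3)\times SL(2,\mathbb R)$-module to $B^3\oplus A^2\otimes B^1\oplus A^4\otimes B^1$; (2) each $d\eta_i$ ($i=0,1,2$) determines a module isomorphic to $\mathbb R\oplus 2V\oplus S^2_0(V)$, and these three are in direct sum (i.e. the rank of $\tau\mapsto(l_{\eta_0}\tau,l_{\eta_1}\tau,l_{\eta_2}\tau)$ equals the sum of the ranks of the $l_{\eta_i}$); (3) $d\hat\gamma$ determines a module isomorphic to $\mathbb R\oplus 3V\oplus S^2_0(V)$; (4) the $d\eta_i$ and $d\hat\gamma$ altogether determine (i.e. the intrinsic torsion space modulo the common kernel of $l_{\eta_0},l_{\eta_1},l_{\eta_2},l_{\hat\gamma}$ is) the $SO(3)\times SL(2,\mathbb R)$-module $B^3\oplus A^2\otimes B^1\oplus A^2\otimes B^3\oplus A^4\otimes B^3$. In particular, the only intrinsic torsion component not determined by the exterior derivatives of invariant forms is the $14$-dimensional module $A^6\otimes B^1$.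
   Context: Let $e^1,\dots,e^6$ be the standard basis of $(\mathbb R^6)^*$, $e^{ij}=e^i\wedge e^j$ etc. Let $\sigma=e^{12}+e^{34}+e^{56}$, $\eta^\theta=(\cos\theta\, e^1+\sin\theta\, e^2)\wedge(\cos\theta\, e^3+\sin\theta\, e^4)\wedge(\cos\theta\, e^5+\sin\theta\, e^6)$, $\eta_0=\eta^0,\eta_1=\eta^{2\pi/3},\eta_2=\eta^{-2\pi/3}$. The common stabilizer in $GL(6,\mathbb R)$ of these forms is a copy of $SO(3)\subset SO(6)$ acting on $T=\mathbb R^6\cong V\oplus V$ ($V$ the 3-dimensional irreducible representation); its centralizer is $GL(2,\mathbb R)$, acting identically on each plane $\mathrm{span}(e^{2i-1},e^{2i})$. An $SO(3)$-structure on a 6-manifold is a reduction of the frame bundle to this $SO(3)$, equivalently forms $(\sigma,\eta_0,\eta_1,\eta_2)$ pointwise of this model form. Put $\gamma=\tfrac43(\eta_0+\eta_1+\eta_2)$; it defines an almost complex structure $J$ (the one for which $\gamma+i\hat\gamma$ is of type $(3,0)$) and $\hat\gamma=J\gamma$ is the unique 3-form with $\gamma+i\hat\gamma$ decomposable and compatible with the orientation. The intrinsic torsion is the projection of the torsion of any connection on the reduction to the cokernel of the alternating map $T^*\otimes\mathfrak{so}(3)\to\Lambda^2T^*\otimes T$, identified with $T^*\otimes\mathfrak{so}(3)^\perp$. $S^2_0(V)$ is the 5-dimensional irreducible $SO(3)$-representation. $A^p$, $B^q$ denote the $(p+1)$-dimensional irreducible representations of $SO(3)$ and of $SL(2,\mathbb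 R)$.
   Formalization: In (1) the module determined by dσ is stated as 4R ⊕ 2V ⊕ 2S²_0(V) instead of 3R ⊕ 2V ⊕ 2S²_0(V), since B³ is 4-dimensional with trivial SO(3)-action and dσ takes all values in the 20-dimensional Λ³T*. *)

(* Defs.v *)
(* Concrete linear-algebra model of the SO(3)-structure
   setting of the paper: all spaces are coordinate spaces 'rV_#|X| indexed by
   a finite type X, linear maps are matrices acting on row vectors (v *m M),
   and group actions are RIGHT actions by pull-back. *)
From HB Require Import structures.
From mathcomp Require Import all_boot all_order all_algebra perm.
From mathcomp Require Import reals.

Set Implicit Arguments.
Unset Strict Implicit.
Unset Printing Implicit Defensive.

Import Order.TTheory GRing.Theory Num.Theory.

Section SO3Structure.
Variable R : realType.
Local Open Scope ring_scope.

Definition mkmx (X Y : finType) (f : X -> Y -> R) : 'M[R]_(#|X|, #|Y|) :=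
  \matrix_(i, j) f (enum_val i) (enum_val j).

Definition emx (X Y : finType) (M : 'M[R]_(#|X|, #|Y|)) (x : X) (y : Y) : R :=
  M (enum_rank x) (enum_rank y).

(* the covector e^n, n in 1..6 (1-indexed as in the paper) *)
Definition ep (n : nat) : 'I_6 -> R := fun j => (j.+1 == n)%:R.

(* k-forms are represented by their values on k-tuples of basis vectors:
   al [:: j1; ..; jk] = al(e_j1, .., e_jk) *)
Definition wedge2 (f g : 'I_6 -> R) : seq 'I_6 -> R :=
  fun s => match s with [:: a; b] => f a * g b - f b * g a | _ => 0 end.

Definition wedge3 (f g h : 'I_6 -> R) : seq 'I_6 -> R :=
  fun s => match s with
  | [:: a; b; c] =>
      \det (\matrix_(p < 3, q < 3) (nth f [:: f; g; h] p) (nth a [:: a; b; c] q))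
  | _ => 0 end.

Definition sigma : seq 'I_6 -> R :=
  fun s => wedge2 (ep 1) (ep 2) s + wedge2 (ep 3) (ep 4) s + wedge2 (ep 5) (ep 6) s.

(* cos th e^(2i-1) + sin th e^(2i), with c = cos th, s = sin th *)
Definition ucs (c s : R) (i : nat) : 'I_6 -> R :=
  fun j => c * ep (2 * i - 1) j + s * ep (2 * i) j.

Definition eta_cs (c s : R) : seq 'I_6 -> R :=
  wedge3 (ucs c s 1) (ucs c s 2) (ucs c s 3).

(* eta_0 = eta^0, eta_1 = eta^(2pi/3), eta_2 = eta^(-2pi/3);
   cos(2pi/3) = -1/2, sin(+-2pi/3) = +-sqrt3/2 *)
Definition eta0 := eta_cs 1 0.
Definition eta1 := eta_cs (- (1 / 2)) (Num.sqrt 3 / 2).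
Definition eta2 := eta_cs (- (1 / 2)) (- (Num.sqrt 3 / 2)).
Definition eta_ (i : 'I_3) : seq 'I_6 -> R :=
  match val i with 0 => eta0 | 1 => eta1 | _ => eta2 end.

(* gamma = 4/3 (eta_0 + eta_1 + eta_2) = e^135 - e^146 - e^236 - e^245
         = Re((e^1 + i e^2) ^ (e^3 + i e^4) ^ (e^5 + i e^6)) *)
Definition gamma : seq 'I_6 -> R :=
  fun s => 4 / 3 * (eta0 s + eta1 s + eta2 s).

(* gamma_hat = J gamma = Im((e^1 + i e^2) ^ (e^3 + i e^4) ^ (e^5 + i e^6))
             = e^136 + e^145 + e^235 - e^246 *)
Definition gamma_hat : seq 'I_6 -> R :=
  fun s => wedge3 (ep 1) (ep 3) (ep 6) s + wedge3 (ep 1) (ep 4) (ep 5) s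
         + wedge3 (ep 2) (ep 3) (ep 5) s - wedge3 (ep 2) (ep 4) (ep 6) s.

Definition SO3 (A : 'M[R]_3) : Prop := A *m A^T = 1%:M /\ \det A = 1.
Definition SL2 (B : 'M[R]_2) : Prop := \det B = 1.

(* T = V (x) R^2 with e_(2i-1) = v_i (x) f_1, e_(2i) = v_i (x) f_2:
   (A, B) acts on T by the 6x6 matrix A (x) B; A in SO(3) gives the stabilizer
   SO(3) of (sigma, eta_0, eta_1, eta_2), B in GL(2) its centralizer acting
   identically on each plane span(e_(2i-1), e_(2i)). *)
Definition g6 (A : 'M[R]_3) (B : 'M[R]_2) : 'M[R]_6 :=
  \matrix_(x, y) (A (inord (x %/ 2)) (inord (y %/ 2)) * B (inord (x %% 2)) (inord (y %% 2))).

Definition inSO3 (A : 'M[R]_3) (B : 'M[R]_2) : Prop := SO3 A /\ B = 1%:M.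
Definition inSO3SL2 (A : 'M[R]_3) (B : 'M[R]_2) : Prop := SO3 A /\ SL2 B.

(* t : T^* (x) T^* (x) T, t (a, b, c) = e^c (Tor(e_a, e_b)) *)
Definition Xt : finType := ('I_6 * 'I_6 * 'I_6)%type.

(* pull-back action (g^* Tor)(X, Y) = g^-1 Tor(g X, g Y)  (right action) *)
Definition tor_rho (g : 'M[R]_6) : 'M[R]_#|Xt| :=
  mkmx (fun x y : Xt => g x.1.1 y.1.1 * g x.1.2 y.1.2 * invmx g y.2 x.2).

Definition rhoT (A : 'M[R]_3) (B : 'M[R]_2) : 'M[R]_#|Xt| := tor_rho (g6 A B).

(* the torsion space Lambda^2 T^* (x) T: tensors antisymmetric in (a, b) *)
Definition TorS : 'M[R]_#|Xt| :=
  kermx (mkmx (fun x y : Xt => (x == y)%:R + (x == ((y.1.2, y.1.1), y.2))%:R)).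

(* image of the alternating map delta : T^* (x) so(3) -> Lambda^2 T^* (x) T,
   delta(a)(Y, Z) = a(Y) Z - a(Z) Y; so(3) is spanned by the A (x) 1 with
   A = E_ij - E_ji. Row (d, i, j) is delta(e^d (x) ((E_ij - E_ji) (x) 1)). *)
Definition Yd : finType := ('I_6 * 'I_3 * 'I_3)%type.
Definition imdelta : 'M[R]_(#|Yd|, #|Xt|) :=
  mkmx (fun (y : Yd) (x : Xt) =>
    let X := g6 (delta_mx y.1.2 y.2 - delta_mx y.2 y.1.2) 1%:M in
    (x.1.1 == y.1.1)%:R * X x.2 x.1.2 - (x.1.2 == y.1.1)%:R * X x.2 x.1.1).

Definition rest (k : nat) (J : k.-tuple 'I_6) (p q : 'I_k) : seq 'I_6 :=
  [seq tnth J r | r <- enum 'I_k & (r != p) && (r != q)].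

(* l_al : torsion Tor |-> d al, for an invariant k-form al (so nabla al = 0
   for a connection on the reduction):
   d al (X_0..X_k) = - \sum_(p<q) (-1)^(p+q) al(Tor(X_p, X_q), X_0..^p..^q..X_k).
   The result is a (k+1)-form, in coordinates indexed by (k+1)-tuples. *)
Definition Lmat (k : nat) (al : seq 'I_6 -> R) : 'M[R]_(#|Xt|, #|{: (k.+1).-tuple 'I_6}|) :=
  mkmx (fun (x : Xt) (J : (k.+1).-tuple 'I_6) =>
    - \sum_(p < k.+1) \sum_(q < k.+1 | (p < q)%N)
        (-1) ^+ (p + q)%N * ((tnth J p == x.1.1) && (tnth J q == x.1.2))%:R
        * al (x.2 :: rest J p q)).

(* a representation: an invariant subspace rsub (row space) of the coordinate
   space indexed by ridx, with the right action (A, B) |-> ract A B *)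
Record rmod := RMod {
  ridx : finType;
  rsub : 'M[R]_#|ridx|;
  ract : 'M[R]_3 -> 'M[R]_2 -> 'M[R]_#|ridx| }.

Definition sumf (X1 X2 : finType) (f1 : X1 -> X1 -> R) (f2 : X2 -> X2 -> R)
  (x y : (X1 + X2)%type) : R :=
  match x, y with
  | inl a, inl b => f1 a b
  | inr a, inr b => f2 a b
  | _, _ => 0 end.

Definition msum (M1 M2 : rmod) : rmod :=
  @RMod (ridx M1 + ridx M2)%type
    (mkmx (sumf (emx (rsub M1)) (emx (rsub M2))))
    (fun A B => mkmx (sumf (emx (ract M1 A B)) (emx (ract M2 A B)))).

Definition mtens (M1 M2 : rmod) : rmod :=
  @RMod (ridx M1 * ridx M2)%type
    (mkmx (fun x y : (ridx M1 * ridx M2)%type =>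
             emx (rsub M1) x.1 y.1 * emx (rsub M2) x.2 y.2))
    (fun A B => mkmx (fun x y : (ridx M1 * ridx M2)%type =>
             emx (ract M1 A B) x.1 y.1 * emx (ract M2 A B) x.2 y.2)).

Definition tpow (n k : nat) (M : 'M[R]_n) : 'M[R]_#|{: k.-tuple 'I_n}| :=
  mkmx (fun I J : k.-tuple 'I_n => \prod_(r < k) M (tnth I r) (tnth J r)).

Definition permt (n k : nat) (s : 'S_k) (I : k.-tuple 'I_n) : k.-tuple 'I_n :=
  [tuple tnth I (s r) | r < k].

(* symmetrizer: its row space is the space of symmetric k-tensors *)
Definition symmx (n k : nat) : 'M[R]_#|{: k.-tuple 'I_n}| :=
  mkmx (fun I J : k.-tuple 'I_n => \sum_(s : 'S_k) (permt s I == J)%:R).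

Definition contr (n k : nat) : 'M[R]_(#|{: (k.+2).-tuple 'I_n}|, #|{: k.-tuple 'I_n}|) :=
  mkmx (fun (I : (k.+2).-tuple 'I_n) (J : k.-tuple 'I_n) =>
    (match val I with a :: b :: t => (a == b) && (t == val J) | _ => false end)%:R).

Definition harm (n j : nat) : 'M[R]_#|{: j.-tuple 'I_n}| :=
  match j return 'M[R]_#|{: j.-tuple 'I_n}| with
  | k.+2 => (symmx n k.+2 :&: kermx (contr n k))%MS
  | j' => symmx n j'
  end.

(* A^p (p even): the (p+1)-dimensional irreducible SO(3)-module,
   realized as symmetric traceless (p/2)-tensors on V = R^3; SL(2) acts trivially.
   A^0 = R, A^2 = V, A^4 = S^2_0(V). *)
Definition Amod (p : nat) : rmod :=
  @RMod ((p./2).-tuple 'I_3 : finType) (harm 3 p./2) (fun A _ => tpow p./2 A).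

(* B^q: the (q+1)-dimensional irreducible SL(2,R)-module S^q(R^2);
   SO(3) acts trivially. *)
Definition Bmod (q : nat) : rmod :=
  @RMod (q.-tuple 'I_2 : finType) (symmx 2 q) (fun _ B => tpow q B).

(* qiso D N rho inG M : the quotient D / (D :&: N) of the (rho, inG)-module D
   is isomorphic to M, i.e. there is a linear map phi, equivariant on D for all
   group elements satisfying inG, mapping D onto the subspace of M, whose kernel
   on D is exactly N. *)
Definition qiso (X : finType) (d r : nat) (D : 'M[R]_(d, #|X|)) (N : 'M[R]_(r, #|X|))
  (rho : 'M[R]_3 -> 'M[R]_2 -> 'M[R]_#|X|) (inG : 'M[R]_3 -> 'M[R]_2 -> Prop)
  (M : rmod) : Prop :=
  exists phi : 'M[R]_(#|X|, #|ridx M|),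
    (D *m phi == rsub M)%MS /\
    (forall v : 'rV[R]_#|X|, (v <= D)%MS -> (v *m phi == 0) = (v <= N)%MS) /\
    (forall A B, inG A B -> forall v : 'rV[R]_#|X|, (v <= D)%MS ->
        v *m rho A B *m phi = v *m phi *m ract M A B).

End SO3Structure.

(* Main.v *)
(* Write T = V (x) W with V = R^3, W = R^2.  A torsion tensor is an element of
   V^(x)3 (x) W^(x)3, and every module of the theorem is reached by an explicit map
   t |-> sum P(a,b,c; I) q(p,q,r; J) t, where P is a polynomial in the invariant tensors
   delta, epsilon of SO(3) and q one in the invariant tensors of SL(2) (or an arbitrary
   tensor on W when only SO(3) acts).  Three facts about such a map phi remain, each an
   identity between explicit matrices over Z[sqrt 3], decided by computation:
   - phi takes values in the right module, since phi composed with the (scaled) projector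
     onto it is a multiple of phi;
   - phi is onto: by Schur's lemma phi^T phi is a multiple of that projector, and the maps
     to different summands are orthogonal;
   - phi has the same kernel as d alpha, because |d alpha|^2, as a quadratic form on the
     torsion space, is a positive combination of the |phi_i|^2 (Schur's lemma again).
   For the last claim the squared norms of all the phi_i together with the image of
   T^* (x) so(3) resolve the identity of the torsion space. *)
From Stdlib Require Import ZArith Lia.
Require Import Defs.
From HB Require Import structures.
From mathcomp Require Import all_boot all_order all_algebra perm.
From mathcomp Require Import reals ssrZ ring lra.

Set Implicit Arguments.
Unset Strict Implicit.
Unset Printing Implicit Defensive.

Import Order.TTheory GRing.Theory Num.Theory.
Local Open Scope ring_scope.

Delimit Scope Z_scope with coq_Z.

(** SL(2,R) is not compact, so transposes need a word: the standard inner products are restrictions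
    of Hermitian ones invariant under SO(3) x SU(2), where SU(2) is the compact form of SL(2,C), and
    Schur's lemma applies to the complexified modules, which stay irreducible. It only predicts
    identities; these are then checked on the 90 coordinates with a < b. The intrinsic torsion has
    dimension 90 - 18 = 72 and splits as B^3 + 2 A^2 (x) B^1 + A^4 (x) B^1 + A^2 (x) B^3 + A^4 (x)
    B^3 + A^6 (x) B^1. Only A^2 (x) B^1 is repeated, and d sigma and the derivatives of the 3-forms
    see two different copies of it. When SO(3) alone acts, modules repeat, and explicit tensors on W
    have to separate the copies. For the three eta_i these tensors are not mutually orthogonal: the
    transposes are replaced there by dual tensors, which also yield the direct sum. *)

Section IntegerEmbedding.
Variable R : realType.

Definition zr (z : Z) : R := (int_of_Z z)%:~R.

Lemma zrD a b : zr (Z.add a b) = zr a + zr b.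
Proof. by rewrite -intrD -rmorphD. Qed.

Lemma zrM a b : zr (Z.mul a b) = zr a * zr b.
Proof. by rewrite -intrM -rmorphM. Qed.

Lemma zrN a : zr (Z.opp a) = - zr a.
Proof. by rewrite -intrN -rmorphN. Qed.

Lemma zrB a b : zr (Z.sub a b) = zr a - zr b.
Proof. by rewrite zrD zrN. Qed.

Lemma zr0 : zr Z0 = 0.
Proof. by []. Qed.

Lemma zr_pos p : zr (Z.pos p) = (Pos.to_nat p)%:R.
Proof. by rewrite /zr /= pmulrn. Qed.

Lemma zr_gt0 z : Z.ltb 0 z -> 0 < zr z.
Proof. by case: z => // p _; rewrite zr_pos ltr0n; apply/ssrnat.ltP/Pos2Nat.is_pos. Qed.

End IntegerEmbedding.

(* (a, b) stands for a + b sqrt 3. *)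
Definition K : Type := (Z * Z)%type.
Definition kadd (x y : K) : K := (Z.add x.1 y.1, Z.add x.2 y.2).
Definition kopp (x : K) : K := (Z.opp x.1, Z.opp x.2).
Definition ksub (x y : K) : K := kadd x (kopp y).
Definition kmul (x y : K) : K :=
  (Z.add (Z.mul x.1 y.1) (Z.mul 3 (Z.mul x.2 y.2)),
   Z.add (Z.mul x.1 y.2) (Z.mul x.2 y.1)).
Definition kscale (z : Z) (x : K) : K := (Z.mul z x.1, Z.mul z x.2).
Definition kint (z : Z) : K := (z, Z0).
Definition keq (x y : K) : bool := Z.eqb x.1 y.1 && Z.eqb x.2 y.2.
(** The tables are sparse, so products whose first factor vanishes are skipped. *)
Definition kdot (u v : seq K) : K :=
  foldr (fun p acc => if keq p.1 (kint 0) then acc else kadd (kmul p.1 p.2) acc)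
        (kint 0) (zip u v).

(** * The embedding of Z[sqrt 3] into the reals *)

Section SqrtThree.
Variable R : realType.

Definition kr (x : K) : R := zr R x.1 + zr R x.2 * Num.sqrt 3.

Lemma sqrt3M : Num.sqrt 3 * Num.sqrt 3 = 3 :> R.
Proof. by rewrite -expr2 sqr_sqrtr. Qed.

Lemma kr_pair a b : kr (a, b) = zr R a + zr R b * Num.sqrt 3.
Proof. by []. Qed.

Lemma krD x y : kr (kadd x y) = kr x + kr y.
Proof. by rewrite /kr /kadd /= !zrD; ring. Qed.

Lemma krN x : kr (kopp x) = - kr x.
Proof. by rewrite /kr /kopp /= !zrN; ring. Qed.

Lemma krB x y : kr (ksub x y) = kr x - kr y.
Proof. by rewrite krD krN. Qed.

Lemma krM x y : kr (kmul x y) = kr x * kr y.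
Proof.
case: x y => [a b] [c d].
have -> : kmul (a, b) (c, d) = (Z.add (Z.mul a c) (Z.mul 3 (Z.mul b d)),
                                Z.add (Z.mul a d) (Z.mul b c)) by [].
rewrite !kr_pair !zrD !zrM zr_pos.
(* The coefficient 3 of [kmul] is read backwards as the square of sqrt 3; what remains is an
   identity of commutative rings. *)
by have := sqrt3M; set r := Num.sqrt _ => r2; rewrite -[_%:R]r2; ring.
Qed.

Lemma kr_scale z x : kr (kscale z x) = zr R z * kr x.
Proof. by rewrite /kr /kscale /= !zrM; ring. Qed.

Lemma kr_int z : kr (kint z) = zr R z.
Proof. by rewrite /kr /= zr0 mul0r addr0. Qed.

Lemma keqP x y : reflect (x = y) (keq x y).
Proof.
case: x y => [a b] [c d]; rewrite /keq /=.
by apply: (iffP andP) => [[/Z.eqb_spec -> /Z.eqb_spec ->]|[-> ->]] //;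
  split; apply/Z.eqb_spec.
Qed.

Lemma kr_dot (T : Type) (f g : T -> K) (s : seq T) :
  kr (kdot [seq f i | i <- s] [seq g i | i <- s]) = \sum_(i <- s) kr (f i) * kr (g i).
Proof.
elim: s => [|i s IH]; first by rewrite big_nil kr_int.
rewrite big_cons -IH /kdot /=; case: (keqP (f i)) => [->|_].
  by rewrite kr_int mul0r add0r.
by rewrite krD krM.
Qed.

End SqrtThree.

(** * Matrices indexed by finite types *)

Section FiniteTypeMatrices.
Variable R : realType.
Implicit Types X Y Z : finType.

Lemma emx_mkmx X Y (f : X -> Y -> R) x y : emx (mkmx f) x y = f x y.
Proof. by rewrite /emx mxE !enum_rankK. Qed.

Lemma mkmx_emx X Y (M : 'M[R]_(#|X|, #|Y|)) : mkmx (emx M) = M.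
Proof. by apply/matrixP => i j; rewrite mxE /emx !enum_valK. Qed.

Lemma eq_mkmx X Y (f g : X -> Y -> R) : (forall x y, f x y = g x y) -> mkmx f = mkmx g.
Proof. by move=> fg; apply/matrixP => i j; rewrite !mxE. Qed.

Lemma sum_enum_val X (F : X -> R) : \sum_(i < #|X|) F (enum_val i) = \sum_x F x.
Proof. by rewrite [RHS](reindex_onto enum_val enum_rank) => [|x _];
  [apply: eq_bigl => i; rewrite enum_valK eqxx | rewrite enum_rankK]. Qed.

Lemma mkmxM X Y Z (f : X -> Y -> R) (g : Y -> Z -> R) :
  mkmx f *m mkmx g = mkmx (fun x z => \sum_y f x y * g y z).
Proof.
apply/matrixP => i k; rewrite !mxE -[RHS]sum_enum_val.
by apply: eq_bigr => j _; rewrite !mxE.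
Qed.

Lemma mkmxZ X Y (c : R) (f : X -> Y -> R) : c *: mkmx f = mkmx (fun x y => c * f x y).
Proof. by apply/matrixP => i j; rewrite !mxE. Qed.

Definition vx X (v : 'rV[R]_#|X|) (x : X) : R := v 0 (enum_rank x).

Lemma vx_mulmx X Y (v : 'rV[R]_#|X|) (f : X -> Y -> R) y :
  vx (v *m mkmx f) y = \sum_x vx v x * f x y.
Proof.
rewrite /vx mxE -[RHS]sum_enum_val; apply: eq_bigr => i _.
by rewrite !mxE enum_rankK enum_valK.
Qed.

Lemma vxP X (v w : 'rV[R]_#|X|) : (forall x, vx v x = vx w x) -> v = w.
Proof. by move=> vw; apply/rowP => i; rewrite -(enum_valK i); apply: vw. Qed.

End FiniteTypeMatrices.

(* Multi-indices are coded by lists of natural numbers. *)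
Fixpoint codes (n k : nat) : seq (seq nat) :=
  if k is k'.+1 then [seq i :: s | i <- iota 0 n, s <- codes n k'] else [:: [::]].

Section Codes.
Variable R : realType.

Definition vals n k (I : k.-tuple 'I_n) : seq nat := map val I.

Lemma size_vals n k (I : k.-tuple 'I_n) : size (vals I) = k.
Proof. by rewrite size_map size_tuple. Qed.

Lemma vals_inj n k : injective (@vals n k).
Proof. by move=> I J /(inj_map val_inj)/val_inj. Qed.

Lemma nth_vals n k (I : k.-tuple 'I_n) (r : 'I_k) : nth 0%N (vals I) r = tnth I r.
Proof.
by rewrite /vals (nth_map (tnth_default I r)) ?size_tuple.
Qed.

Lemma vals_codes n k (I : k.-tuple 'I_n) : vals I \in codes n k.
Proof.
elim: k I => [|k IH] I; first by rewrite tuple0.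
case/tupleP: I => i I; apply/allpairsP; exists (val i, vals I); split => //=.
by rewrite mem_iota add0n ltn_ord.
Qed.

Lemma sum_ord_nat n (F : nat -> R) : \sum_(i < n) F i = \sum_(i <- iota 0 n) F i.
Proof. by rewrite -(big_mkord xpredT F) /index_iota subn0. Qed.

Lemma sum_tupleS n k (F : seq nat -> R) :
  \sum_(I : (k.+1).-tuple 'I_n) F (vals I)
  = \sum_(i < n) \sum_(I : k.-tuple 'I_n) F (val i :: vals I).
Proof.
rewrite pair_bigA /=.
rewrite (reindex (fun p : 'I_n * k.-tuple 'I_n => cons_tuple p.1 p.2)) /=; last first.
  exists (fun I : k.+1.-tuple 'I_n => (thead I, behead_tuple I)) => [[i I]|I] _ /=.
    by rewrite theadE; congr pair; apply: val_inj.
  by case/tupleP: I => i I; apply: val_inj.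
by apply: eq_bigr.
Qed.

Lemma sum_vals n k (F : seq nat -> R) :
  \sum_(I : k.-tuple 'I_n) F (vals I) = \sum_(s <- codes n k) F s.
Proof.
elim: k F => [|k IH] F.
  rewrite big_seq1 (big_pred1 [tuple]) // => I.
  by apply/esym/eqP; rewrite (tuple0 I).
rewrite sum_tupleS /= big_allpairs_dep -sum_ord_nat.
by apply: eq_bigr => i _; rewrite (IH (fun s => F (val i :: s))).
Qed.

End Codes.

(** * Torsion tensors as antisymmetric functions on triples *)

Definition triple : Type := (nat * nat * nat)%type.
Definition swap (x : triple) : triple := (x.1.2, x.1.1, x.2).
Definition pairs6 : seq (nat * nat) :=
  [seq p <- [seq (a, b) | a <- iota 0 6, b <- iota 0 6] | (p.1 < p.2)%N].
Definition triples : seq triple := [seq (p, c) | p <- pairs6, c <- iota 0 6].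

Section Torsion.
Variable R : realType.

Definition xcode (x : Xt) : triple := (val x.1.1, val x.1.2, val x.2).

Definition tens (v : 'rV[R]_#|Xt|) (x : triple) : R :=
  vx v (inord x.1.1, inord x.1.2, inord x.2).

Lemma tens_xcode v (x : Xt) : tens v (xcode x) = vx v x.
Proof. by case: x => [[a b] c]; rewrite /tens /= !inord_val. Qed.

Lemma sum_Xt (F : triple -> R) :
  \sum_(x : Xt) F (xcode x) = \sum_(a < 6) \sum_(b < 6) \sum_(c < 6) F (val a, val b, val c).
Proof.
rewrite pair_bigA /= pair_bigA /=.
by apply: eq_bigr => -[[a b] c].
Qed.

Lemma TorSP (v : 'rV[R]_#|Xt|) :
  reflect (forall x, tens v (swap x) = - tens v x) (v <= TorS R)%MS.
Proof.
have eqv (y : Xt) : vx (v *m mkmx (fun x z : Xt =>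
    (x == z)%:R + (x == ((z.1.2, z.1.1), z.2))%:R)) y
    = tens v (xcode y) + tens v (swap (xcode y)).
  rewrite vx_mulmx (eq_bigr (fun x => (if x == y then vx v x else 0)
      + (if x == ((y.1.2, y.1.1), y.2) then vx v x else 0))); last first.
    by move=> x _; rewrite mulrDr !mulr_natr !mulrb.
  rewrite big_split /= -!big_mkcond !big_pred1_eq tens_xcode; congr (_ + _).
  by rewrite -tens_xcode.
apply: (iffP (sub_kermxP)) => [v0 [[a b] c]|vA].
  have := eqv (inord a, inord b, inord c); rewrite v0 /vx mxE => /esym/eqP.
  by rewrite addrC addr_eq0 => /eqP; rewrite /tens /= !inord_val.
by apply/vxP => y; rewrite eqv vA subrr /vx mxE.
Qed.

Lemma sum_pairs6 (h : nat -> nat -> R) :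
  (forall a b, h b a = h a b) -> (forall a, h a a = 0) ->
  \sum_(a < 6) \sum_(b < 6) h a b = (\sum_(p <- pairs6) h p.1 p.2) *+ 2.
Proof.
move=> hC h0.
have E (g : nat -> R) : \sum_(b < 6) g b
    = g 0%N + (g 1%N + (g 2%N + (g 3%N + (g 4%N + (g 5%N + 0))))).
  by rewrite sum_ord_nat /= !big_cons big_nil.
rewrite (eq_bigr (fun a : 'I_6 => (fun a => h a 0%N + (h a 1%N + (h a 2%N + (h a 3%N
  + (h a 4%N + (h a 5%N + 0)))))) (val a))); last by move=> a _; rewrite E.
rewrite (E (fun a => h a 0%N + (h a 1%N + (h a 2%N + (h a 3%N
  + (h a 4%N + (h a 5%N + 0))))))) /pairs6 /= !big_cons big_nil /= !h0.
rewrite (hC 0%N 1%N) (hC 0%N 2%N) (hC 0%N 3%N) (hC 0%N 4%N) (hC 0%N 5%N).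
rewrite (hC 1%N 2%N) (hC 1%N 3%N) (hC 1%N 4%N) (hC 1%N 5%N).
rewrite (hC 2%N 3%N) (hC 2%N 4%N) (hC 2%N 5%N) (hC 3%N 4%N) (hC 3%N 5%N) (hC 4%N 5%N).
ring.
Qed.

(** Summing [h] over all ordered pairs counts each a < b twice, because [h] is symmetric with zero
    diagonal; by antisymmetry of [t] it also gives twice the left side. This halves the size of
    every later table: 216 coordinates become 90. *)
Lemma sum_triples (t k : triple -> R) : (forall x, t (swap x) = - t x) ->
  \sum_(x : Xt) t (xcode x) * k (xcode x) = \sum_(x <- triples) t x * (k x - k (swap x)).
Proof.
move=> tA; pose h a b := \sum_(c < 6) t (a, b, val c) * (k (a, b, val c) - k (b, a, val c)).
have hC a b : h b a = h a b.
  apply: eq_bigr => c _; have := tA (a, b, val c); rewrite /swap /= => ->; ring.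
have h0 a : h a a = 0 by rewrite /h big1 // => c _; rewrite subrr mulr0.
have := sum_pairs6 hC h0.
have -> : \sum_(p <- pairs6) h p.1 p.2 = \sum_(x <- triples) t x * (k x - k (swap x)).
  rewrite /triples big_allpairs_dep; apply: eq_bigr => -[a b] _ /=.
  by rewrite /h (sum_ord_nat 6 (fun c => t (a, b, c) * (k (a, b, c) - k (b, a, c)))).
pose f a b := \sum_(c < 6) t (a, b, val c) * k (a, b, val c).
have -> : \sum_(x : Xt) t (xcode x) * k (xcode x) = \sum_(a < 6) \sum_(b < 6) f a b.
  exact: (sum_Xt (fun x => t x * k x)).
have hE a b : h a b = f a b + f b a.
  rewrite /h /f -big_split /=; apply: eq_bigr => c _.
  have := tA (a, b, val c); rewrite /swap /= => ->; ring.
have -> : \sum_(a < 6) \sum_(b < 6) h a b = (\sum_(a < 6) \sum_(b < 6) f a b) *+ 2.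
  rewrite mulr2n [X in _ = _ + X]exchange_big -big_split /=.
  by apply: eq_bigr => a _; rewrite -big_split /=; apply: eq_bigr => b _.
by move/eqP; rewrite eqrMn2r => /eqP.
Qed.

End Torsion.

(** * Certificates decided by computation *)

Definition code : Type := (seq nat * seq nat)%type.
Definition kernel : Type := triple -> code -> K.
(* On tensors antisymmetric in (a, b) a kernel acts through its antisymmetrization,
   restricted to the triples with a < b. *)
Definition anti (k : kernel) : kernel := fun x y => ksub (k x y) (k (swap x) y).

Definition image_check (xs : seq triple) (ys : seq code) (P : code -> code -> K) (c : Z) (k : kernel) : bool :=
  let cols := [seq [seq P y' y | y' <- ys] | y <- ys] in
  all (fun row => all (fun p => keq (kdot row p.1) (kscale c p.2)) (zip cols row))
      [seq [seq anti k x y | y <- ys] | x <- xs].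

Definition ktable (xs : seq triple) (ys : seq code) (k : kernel) : seq (code * seq K) :=
  [seq (y, [seq anti k x y | x <- xs]) | y <- ys].

Definition pairing_check (P : code -> code -> K) (t1 t2 : seq (code * seq K)) : bool :=
  all (fun p => all (fun q => keq (kdot p.2 q.2) (P p.1 q.1)) t2) t1.

(** Coefficientwise vanishing of the quadratic form that sums w z(t)^2. The weights are absorbed
    into one of the two tables, so each coefficient is a single dot product. *)
Definition sos_check (xs : seq triple) (zs : seq (Z * (triple -> K))) : bool :=
  let tab := [seq [seq z.2 x | z <- zs] | x <- xs] in
  let wtab := [seq [seq kscale z.1 (z.2 x) | z <- zs] | x <- xs] in
  all (fun r => all (fun r' => keq (kdot r r') (kint 0)) tab) wtab.

Definition complete_check (xs : seq triple) (zs : seq (Z * (triple -> K)))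
    (us : seq ((triple -> K) * (triple -> K))) (c : Z) : bool :=
  let tab := [seq (x, ([seq z.2 x | z <- zs], [seq u.2 x | u <- us])) | x <- xs] in
  let wtab := [seq (x, ([seq kscale z.1 (z.2 x) | z <- zs], [seq u.1 x | u <- us])) | x <- xs] in
  all (fun r => all (fun r' => keq (kadd (kdot r.2.1 r'.2.1) (kdot r.2.2 r'.2.2))
                                   (if r.1 == r'.1 then kint c else kint 0)) tab) wtab.

Section Checks.
Variable R : realType.
Variable xs : seq triple.
Local Notation kr := (kr R).

Definition lform (t : triple -> R) (z : triple -> K) : R := \sum_(x <- xs) t x * kr (z x).

Lemma image_checkP ys P c k : image_check xs ys P c k -> forall y t, y \in ys ->
  \sum_(y' <- ys) lform t (anti k ^~ y') * kr (P y' y) = zr R c * lform t (anti k ^~ y).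
Proof.
rewrite /image_check all_map => /allP chk y t ys_y.
rewrite /lform mulr_sumr (eq_bigr (fun y' => \sum_(x <- xs)
    t x * (kr (anti k x y') * kr (P y' y)))); last first.
  by move=> y' _; rewrite mulr_suml; apply: eq_bigr => x _; rewrite mulrA.
rewrite exchange_big /= !big_seq; apply: eq_bigr => x /chk /=.
rewrite zip_map all_map => /allP /(_ _ ys_y) /= /keqP e.
by rewrite -mulr_sumr -kr_dot e kr_scale mulrCA.
Qed.

Lemma pairing_checkP P ys1 k1 ys2 k2 : pairing_check P (ktable xs ys1 k1) (ktable xs ys2 k2) ->
  forall y y', y \in ys1 -> y' \in ys2 ->
  \sum_(x <- xs) kr (anti k1 x y) * kr (anti k2 x y') = kr (P y y').
Proof.
rewrite /pairing_check all_map => /allP chk y y' /chk /=.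
by rewrite all_map => /allP h /h /= /keqP e; rewrite -kr_dot e.
Qed.

Lemma sos_checkP zs : sos_check xs zs -> forall t,
  \sum_(z <- zs) zr R z.1 * lform t z.2 ^+ 2 = 0.
Proof.
rewrite /sos_check all_map => /allP chk t.
have sq (z : Z * (triple -> K)) : zr R z.1 * lform t z.2 ^+ 2
    = \sum_(x <- xs) \sum_(x' <- xs)
        (t x * t x') * (kr (kscale z.1 (z.2 x)) * kr (z.2 x')).
  rewrite expr2 {1}/lform mulr_suml mulr_sumr; apply: eq_bigr => x _.
  rewrite /lform mulr_sumr mulr_sumr; apply: eq_bigr => x' _.
  by rewrite kr_scale; ring.
rewrite (eq_bigr _ (fun z _ => sq z)) exchange_big /= big_seq big1 // => x xin.
rewrite exchange_big /= big_seq big1 // => x' x'in.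
rewrite -mulr_sumr -kr_dot.
have := chk x xin; rewrite /= all_map => /allP /(_ x' x'in) /= /keqP ->.
by rewrite kr_int mulr0.
Qed.

(** The check resolves c times the identity into a z-part and a u-part; where all z-forms vanish
    only the u-part survives, and it expresses t through the vectors [u.1]. *)
Lemma complete_checkP zs us c : uniq xs -> complete_check xs zs us c -> forall t,
  (forall z, List.In z zs -> lform t z.2 = 0) ->
  forall x, x \in xs -> zr R c * t x = \sum_(u <- us) lform t u.2 * kr (u.1 x).
Proof.
move=> uxs; rewrite /complete_check all_map => /allP chk t z0 x xin.
have e x' : x' \in xs -> \sum_(z <- zs) kr (kscale z.1 (z.2 x)) * kr (z.2 x')
    + \sum_(u <- us) kr (u.1 x) * kr (u.2 x') = if x == x' then zr R c else 0.
  move=> x'in; have := chk x xin; rewrite /= all_map => /allP /(_ x' x'in) /= /keqP e.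
  by rewrite -!kr_dot -krD e; case: ifP => _; rewrite kr_int.
have -> : zr R c * t x = \sum_(x' <- xs) t x' * (if x == x' then zr R c else 0).
  rewrite (bigD1_seq x) //= eqxx mulrC big1 ?addr0 // => x' /negPf x'x.
  by rewrite eq_sym x'x mulr0.
rewrite (eq_big_seq (fun x' => \sum_(z <- zs) kr (kscale z.1 (z.2 x)) * (t x' * kr (z.2 x'))
    + \sum_(u <- us) t x' * kr (u.2 x') * kr (u.1 x))); last first.
  move=> x' x'in; rewrite -e // mulrDr !mulr_sumr; congr (_ + _); apply: eq_bigr => ? _; ring.
rewrite big_split /= exchange_big /= [X in X + _](_ : _ = 0) ?add0r.
  by rewrite exchange_big /=; apply: eq_bigr => u _; rewrite -mulr_suml.
elim: zs z0 {chk e} => [|z zs IH] z0; first by rewrite big_nil.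
rewrite big_cons IH ?addr0 => [|z' z'in]; last by apply: z0; right.
by rewrite -mulr_sumr -/(lform t z.2) z0 ?mulr0 //; left.
Qed.

(* A weighted sum of squares of the forms in [zs] equals one of the forms in
   [ws], so both families have the same common zeros. *)
Lemma sos_zeros zs ws t :
  sos_check xs (zs ++ [seq (Z.opp w.1, w.2) | w <- ws]) ->
  all (fun z => Z.ltb 0 z.1) zs -> all (fun z => Z.ltb 0 z.1) ws ->
  (forall z, List.In z zs -> lform t z.2 = 0) <-> (forall w, List.In w ws -> lform t w.2 = 0).
Proof.
(* Positivity of the weights enters here: in an ordered field a vanishing sum of nonnegative terms
   has only zero terms. *)
have zeros us : all (fun z => Z.ltb 0 z.1) us ->
    (forall z, List.In z us -> lform t z.2 = 0)
    <-> \sum_(z <- us) zr R z.1 * lform t z.2 ^+ 2 = 0.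
  elim: us => [|u us IH] /=; first by rewrite big_nil.
  case/andP=> u0 us0; rewrite big_cons; split.
    move=> h; rewrite h; last by left.
    rewrite expr0n mulr0 add0r; apply/IH => // z zin; apply: h; by right.
  have nn (vs : seq (Z * (triple -> K))) : all (fun z => Z.ltb 0 z.1) vs ->
      0 <= \sum_(z <- vs) zr R z.1 * lform t z.2 ^+ 2.
    elim: vs => [|v vs IHv] /=; first by rewrite big_nil.
    case/andP=> v0 /IHv vs0; rewrite big_cons addr_ge0 // mulr_ge0 ?sqr_ge0 //.
    exact/ltW/zr_gt0.
  move/eqP; rewrite paddr_eq0 ?nn //; last by rewrite mulr_ge0 ?sqr_ge0 ?ltW ?zr_gt0.
  case/andP=> /eqP e1 /eqP e2 z [<-|zin].
    move/eqP: e1; rewrite mulf_eq0 sqrf_eq0 => /orP[/eqP e|/eqP //].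
    by move: (zr_gt0 R u0); rewrite e ltxx.
  by move/IH: e2; apply.
move=> /sos_checkP /(_ t); rewrite big_cat big_map /= => /eqP.
rewrite [X in _ + X](eq_bigr (fun w => - (zr R w.1 * lform t w.2 ^+ 2))); last first.
  by move=> w _ /=; rewrite zrN mulNr.
rewrite sumrN subr_eq0 => /eqP e zs0 ws0.
by split=> [/zeros|/zeros] h; apply/zeros => //; [rewrite -e|rewrite e]; apply: h.
Qed.

End Checks.

(** * Invariant kernels *)


Definition dl (i j : nat) : Z := if i == j then 1%coq_Z else 0%coq_Z.
Definition e2 (i j : nat) : Z :=
  match i, j with 0%N, 1%N => 1%coq_Z | 1%N, 0%N => (-1)%coq_Z | _, _ => 0%coq_Z end.
Definition e3 (i j k : nat) : Z :=
  match i, j, k with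
  | 0%N, 1%N, 2%N | 1%N, 2%N, 0%N | 2%N, 0%N, 1%N => 1%coq_Z
  | 0%N, 2%N, 1%N | 2%N, 1%N, 0%N | 1%N, 0%N, 2%N => (-1)%coq_Z
  | _, _, _ => 0%coq_Z end.

(* P a b c I and q p q' r J are the coefficients of maps from V^(x)3 and W^(x)3; an index
   x < 6 splits into its V-part x %/ 2 and its W-part x %% 2.  The third index of a torsion
   tensor is contravariant, hence e2 r k below lowers it. *)
Definition vfun : Type := nat -> nat -> nat -> seq nat -> Z.
Definition wfun : Type := nat -> nat -> nat -> seq nat -> K.

Definition Pe : vfun := fun a b c _ => e3 a b c.
Definition Pu : vfun := fun a b c I => (dl a b * dl c (nth 0%N I 0))%coq_Z.
Definition Pv : vfun := fun a b c I => (dl b c * dl a (nth 0%N I 0))%coq_Z.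
(* Symmetric traceless parts of epsilon(b,c,i) delta(a,j) and of delta(a,i) delta(b,j) delta(c,k). *)
Definition P2 : vfun := fun a b c I =>
  let i := nth 0%N I 0 in let j := nth 0%N I 1 in
  (3%coq_Z * (e3 b c i * dl a j + e3 b c j * dl a i) - 2%coq_Z * (dl i j * e3 a b c))%coq_Z.
Definition P3term (a b c i j k : nat) : Z :=
  (5%coq_Z * (dl a i * (dl b j * dl c k))
   - dl i j * (dl a b * dl c k + dl a c * dl b k + dl b c * dl a k))%coq_Z.
Definition P3 : vfun := fun a b c I =>
  let i := nth 0%N I 0 in let j := nth 0%N I 1 in let k := nth 0%N I 2 in
  (P3term a b c i j k + P3term a b c i k j + P3term a b c j i k
   + P3term a b c j k i + P3term a b c k i j + P3term a b c k j i)%coq_Z.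

Definition symterm (p q r i j k : nat) : Z := (dl p i * (dl q j * e2 r k))%coq_Z.
Definition symz (f : nat -> nat -> nat -> Z) (I : seq nat) : Z :=
  let i := nth 0%N I 0 in let j := nth 0%N I 1 in let k := nth 0%N I 2 in
  (f i j k + f i k j + f j i k + f j k i + f k i j + f k j i)%coq_Z.
Definition qs : wfun := fun p q r y => kint (symz (symterm p q r) y).
Definition qa : wfun := fun p q r y => kint (dl p r * dl q (nth 0%N y 0))%coq_Z.
Definition qb : wfun := fun p q r y => kint (dl q r * dl p (nth 0%N y 0))%coq_Z.
Definition qe : wfun := fun p q r y => ksub (qa p q r y) (kscale 2%coq_Z (qb p q r y)).
Definition fixw (q : wfun) (y : seq nat) : wfun := fun a b c _ => q a b c y.

Definition tensk (P : vfun) (q : wfun) : kernel := fun x y =>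
  (kscale (P (x.1.1 %/ 2) (x.1.2 %/ 2) (x.2 %/ 2) y.1)
          (q (x.1.1 %% 2) (x.1.2 %% 2) (x.2 %% 2) y.2))%N.
Definition addk (k k' : kernel) : kernel := fun x y => kadd (k x y) (k' x y).

Definition kB3 := tensk Pe qs.
(** One of the two copies of A^2 (x) B^1, the one seen by d sigma; [kea] is the one seen by the
    derivatives of the 3-forms. They are independent but not orthogonal. *)
Definition ksa := addk (tensk Pu qa) (tensk Pv qb).
Definition kA4B1 := tensk P2 qa.
Definition kea := tensk Pv qe.
Definition kA2B3 := tensk Pv qs.
Definition kA4B3 := tensk P2 qs.
Definition kA6B1 := tensk P3 qa.

(* Projectors onto the symmetric traceless tensors on V of rank 0, 1, 2, 3 and onto the
   symmetric 3-tensors on W, multiplied by 1, 1, 6, 30 and 6. *)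
Definition pA0 (I J : seq nat) : Z := 1%coq_Z.
Definition pA1 (I J : seq nat) : Z := dl (nth 0%N I 0) (nth 0%N J 0).
Definition pA2 (I J : seq nat) : Z :=
  let a := nth 0%N I 0 in let b := nth 0%N I 1 in
  let i := nth 0%N J 0 in let j := nth 0%N J 1 in
  (3%coq_Z * (dl a i * dl b j + dl a j * dl b i) - 2%coq_Z * (dl a b * dl i j))%coq_Z.
Definition pA3 (I J : seq nat) : Z := P3 (nth 0%N I 0) (nth 0%N I 1) (nth 0%N I 2) J.
Definition pB3 (I J : seq nat) : Z :=
  symz (fun i j k => dl (nth 0%N I 0) i * (dl (nth 0%N I 1) j * dl (nth 0%N I 2) k))%coq_Z J.
Definition pten (p q : seq nat -> seq nat -> Z) (c : Z) : code -> code -> K :=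
  fun y z => kint (c * (p y.1 z.1 * q y.2 z.2))%coq_Z.
Definition pzero : code -> code -> K := fun _ _ => kint 0%coq_Z.

Definition ycodes (j q : nat) : seq code := [seq (s, t) | s <- codes 3 j, t <- codes 2 q].

(** The minus sign in front of the torsion formula makes the coefficients (-1)^(p+q+1), hence +, -,
    + for the pairs (0,1), (0,2), (1,2). Indices of forms live in the first half of the code; the
    second half is empty. *)
Definition L2 (al : seq nat -> K) : kernel := fun x J =>
  let: (a, b, c) := x in
  if J.1 is [:: i; j; k] then
    kadd (if (i == a) && (j == b) then al [:: c; k] else kint 0%coq_Z)
   (kadd (if (i == a) && (k == b) then kopp (al [:: c; j]) else kint 0%coq_Z)
         (if (j == a) && (k == b) then al [:: c; i] else kint 0%coq_Z))
  else kint 0%coq_Z.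

Definition L3 (al : seq nat -> K) : kernel := fun x J =>
  let: (a, b, c) := x in
  if J.1 is [:: i; j; k; l] then
    kadd (if (i == a) && (j == b) then al [:: c; k; l] else kint 0%coq_Z)
   (kadd (if (i == a) && (k == b) then kopp (al [:: c; j; l]) else kint 0%coq_Z)
   (kadd (if (i == a) && (l == b) then al [:: c; j; k] else kint 0%coq_Z)
   (kadd (if (j == a) && (k == b) then al [:: c; i; l] else kint 0%coq_Z)
   (kadd (if (j == a) && (l == b) then kopp (al [:: c; i; k]) else kint 0%coq_Z)
         (if (k == a) && (l == b) then al [:: c; i; j] else kint 0%coq_Z)))))
  else kint 0%coq_Z.

Definition epk (n j : nat) : K := kint (dl j.+1 n).
Definition ucsk (c s : K) (i j : nat) : K :=
  kadd (kmul c (epk (2 * i - 1) j)) (kmul s (epk (2 * i) j)).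
Definition wedge3k (f g h : nat -> K) (s : seq nat) : K :=
  if s is [:: a; b; c] then
    kadd (kmul (f a) (ksub (kmul (g b) (h c)) (kmul (g c) (h b))))
   (kadd (kmul (f b) (ksub (kmul (g c) (h a)) (kmul (g a) (h c))))
         (kmul (f c) (ksub (kmul (g a) (h b)) (kmul (g b) (h a)))))
  else kint 0%coq_Z.
Definition sigmak (s : seq nat) : K :=
  if s is [:: a; b] then
    kint (dl a 0 * dl b 1 - dl b 0 * dl a 1 + (dl a 2 * dl b 3 - dl b 2 * dl a 3)
          + (dl a 4 * dl b 5 - dl b 4 * dl a 5))%coq_Z
  else kint 0%coq_Z.
Definition etak (c s : K) : seq nat -> K := wedge3k (ucsk c s 1) (ucsk c s 2) (ucsk c s 3).
Definition addf (f g : seq nat -> K) : seq nat -> K := fun s => kadd (f s) (g s).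
Definition subf (f g : seq nat -> K) : seq nat -> K := fun s => ksub (f s) (g s).
Definition epk3 (i j k : nat) : seq nat -> K := wedge3k (epk i) (epk j) (epk k).
(* eta_cs c s is the sum of the c^(3-k) s^k E_k. *)
Definition E_ (k : nat) : seq nat -> K :=
  match k with
  | 0%N => epk3 1 3 5
  | 1%N => addf (addf (epk3 1 3 6) (epk3 1 4 5)) (epk3 2 3 5)
  | 2%N => addf (addf (epk3 1 4 6) (epk3 2 3 6)) (epk3 2 4 5)
  | _ => epk3 2 4 6 end.
Definition gammak : seq nat -> K := subf (E_ 1) (E_ 3).

Definition increasing (k : nat) : seq code :=
  [seq (s, [::]) | s <- [seq s <- codes 6 k | sorted ltn s]].

(** The entries contain functions, which have no decidable equality; membership in such lists is
    therefore expressed by [List.In]. *)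
Definition forms (w : Z) (ys : seq code) (k : kernel) : seq (Z * (triple -> K)) :=
  [seq (w, anti k ^~ y) | y <- ys].

(** * Intertwining property *)

Section Intertwiners.
Variable R : realType.
Local Notation zr := (zr R).
Local Notation kr := (kr R).

Definition mxn n (A : 'M[R]_n.+1) (i j : nat) : R := A (inord i) (inord j).

Definition prodn n (A : 'M[R]_n.+1) (s t : seq nat) : R :=
  \prod_(p <- zip s t) mxn A p.1 p.2.

Lemma prodn_cons n (A : 'M[R]_n.+1) i s j t :
  prodn A (i :: s) (j :: t) = mxn A i j * prodn A s t.
Proof. by rewrite /prodn /= big_cons. Qed.

Lemma prodn_nil n (A : 'M[R]_n.+1) : prodn A [::] [::] = 1.
Proof. by rewrite /prodn big_nil. Qed.

Lemma emx_tpow n k (A : 'M[R]_n.+1) (I J : k.-tuple 'I_n.+1) :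
  emx (tpow k A) I J = prodn A (vals I) (vals J).
Proof.
rewrite emx_mkmx; elim: k I J => [|k IH] I J.
  by rewrite big_ord0 (tuple0 I) (tuple0 J) prodn_nil.
case/tupleP: I => i I; case/tupleP: J => j J.
rewrite big_ord_recl /vals /= prodn_cons /mxn !inord_val -IH.
by congr (_ * _); apply: eq_bigr => r _; rewrite !tnthS.
Qed.

Lemma zr_dl i j : zr (dl i j) = (i == j)%:R.
Proof. by rewrite /dl; case: eqP => _. Qed.

Lemma sum_dl (s : seq nat) (F : nat -> R) i : uniq s -> i \in s ->
  \sum_(k <- s) F k * zr (dl k i) = F i.
Proof.
move=> us si; rewrite (bigD1_seq i) //= zr_dl eqxx mulr1 big1 ?addr0 // => k /negPf ki.
by rewrite zr_dl ki mulr0.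
Qed.

Lemma dlC i j : dl i j = dl j i.
Proof. by rewrite /dl eq_sym. Qed.

Lemma sum_dl' (s : seq nat) (F : nat -> R) i : uniq s -> i \in s ->
  \sum_(k <- s) F k * zr (dl i k) = F i.
Proof. by move=> us si; rewrite -(sum_dl F us si); apply: eq_bigr => k _; rewrite dlC. Qed.

Lemma sum_dl3 (F : nat -> R) i : i \in iota 0 3 ->
  \sum_(k <- iota 0 3) F k * zr (dl k i) = F i.
Proof. exact: sum_dl. Qed.

Lemma sum_dl3' (F : nat -> R) i : i \in iota 0 3 ->
  \sum_(k <- iota 0 3) F k * zr (dl i k) = F i.
Proof. exact: sum_dl'. Qed.

Lemma sum_iota3 (F : nat -> R) : \sum_(k <- iota 0 3) F k = F 0%N + F 1%N + F 2%N.
Proof. by rewrite /= !big_cons big_nil; ring. Qed.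

Lemma sum_iota2 (F : nat -> R) : \sum_(k <- iota 0 2) F k = F 0%N + F 1%N.
Proof. by rewrite /= !big_cons big_nil; ring. Qed.

Lemma det3 (M : 'M[R]_3) : \det M =
  mxn M 0 0 * (mxn M 1 1 * mxn M 2 2 - mxn M 1 2 * mxn M 2 1)
  + mxn M 0 1 * (mxn M 1 2 * mxn M 2 0 - mxn M 1 0 * mxn M 2 2)
  + mxn M 0 2 * (mxn M 1 0 * mxn M 2 1 - mxn M 1 1 * mxn M 2 0).
Proof.
have fE m (N : 'M[R]_m.+1) i j : N i j = mxn N (val i) (val j).
  by rewrite /mxn !inord_val.
have E2 (N : 'M[R]_2) : \det N = mxn N 0 0 * mxn N 1 1 - mxn N 0 1 * mxn N 1 0.
  rewrite (expand_det_row _ ord0) !big_ord_recl big_ord0 /cofactor !det_mx11 !mxE !fE /=.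
  by rewrite /bump /= expr0 expr1; ring.
rewrite (expand_det_row _ ord0) !big_ord_recl big_ord0 /cofactor !E2.
rewrite /mxn !mxE !fE /= /bump /= !inordK //=.
by rewrite expr0 expr1 sqrrN expr1n; ring.
Qed.

Section Contraction.
Variables (s : seq nat) (a_ : nat -> nat -> R).

Definition rs2 (g : nat -> nat -> R) (i j : nat) : R :=
  \sum_(i' <- s) \sum_(j' <- s) g i' j' * (a_ i' i * a_ j' j).

Lemma rs2D f g i j : rs2 (fun i j => f i j + g i j) i j = rs2 f i j + rs2 g i j.
Proof.
rewrite /rs2 -big_split; apply: eq_bigr => i' _; rewrite -big_split.
by apply: eq_bigr => j' _; rewrite mulrDl.
Qed.

Lemma rs2Z k f i j : rs2 (fun i j => k * f i j) i j = k * rs2 f i j.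
Proof. by rewrite /rs2; do 2 (rewrite mulr_sumr; apply: eq_bigr => ? _); ring. Qed.

Lemma rs2_sep f g i j : rs2 (fun i j => f i * g j) i j
  = (\sum_(i' <- s) f i' * a_ i' i) * (\sum_(j' <- s) g j' * a_ j' j).
Proof.
rewrite mulr_suml; apply: eq_bigr => i' _; rewrite mulr_sumr.
by apply: eq_bigr => j' _; ring.
Qed.

(** The action on the output indices: each index of g is contracted with the row index of the
    matrix, as in [prodn]. *)
Definition rs3 (g : nat -> nat -> nat -> R) (i j k : nat) : R :=
  \sum_(i' <- s) \sum_(j' <- s) \sum_(k' <- s)
    g i' j' k' * (a_ i' i * (a_ j' j * a_ k' k)).

Lemma rs3D f g i j k :
  rs3 (fun i j k => f i j k + g i j k) i j k = rs3 f i j k + rs3 g i j k.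
Proof.
rewrite /rs3 -big_split; apply: eq_bigr => i' _; rewrite -big_split; apply: eq_bigr => j' _.
by rewrite -big_split; apply: eq_bigr => k' _; rewrite mulrDl.
Qed.

Lemma rs3_sep f g i j k : rs3 (fun i j k => f i j * g k) i j k
  = rs2 f i j * (\sum_(k' <- s) g k' * a_ k' k).
Proof.
rewrite /rs2 mulr_suml; apply: eq_bigr => i' _; rewrite mulr_suml; apply: eq_bigr => j' _.
by rewrite mulr_sumr; apply: eq_bigr => k' _; ring.
Qed.

Lemma rs3_swap12 f i j k : rs3 (fun i j k => f j i k) i j k = rs3 f j i k.
Proof.
rewrite /rs3 exchange_big; apply: eq_bigr => j' _; apply: eq_bigr => i' _.
by apply: eq_bigr => k' _; ring.
Qed.

Lemma rs3_swap23 f i j k : rs3 (fun i j k => f i k j) i j k = rs3 f i k j.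
Proof.
rewrite /rs3; apply: eq_bigr => i' _; rewrite exchange_big.
by apply: eq_bigr => k' _; apply: eq_bigr => j' _; ring.
Qed.

End Contraction.

Lemma codesS n k J : J \in codes n k.+1 ->
  exists i J', [/\ J = i :: J', i \in iota 0 n & J' \in codes n k].
Proof. by case/allpairsP=> -[i J'] [/= i3 J3 ->]; exists i, J'. Qed.

Lemma sum_codesS n k (F : seq nat -> R) :
  \sum_(s <- codes n k.+1) F s = \sum_(i <- iota 0 n) \sum_(s <- codes n k) F (i :: s).
Proof. by rewrite /= big_allpairs_dep. Qed.

Lemma sum_codes0 n (F : seq nat -> R) : \sum_(s <- codes n 0) F s = F [::].
Proof. by rewrite big_seq1. Qed.

Section Orthogonal.
Variable A : 'M[R]_3.
Hypothesis A_SO3 : SO3 A.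
Local Notation a_ := (mxn A).
Local Notation rs2 := (rs2 (iota 0 3) a_).
Local Notation rs3 := (rs3 (iota 0 3) a_).

Lemma rows_orth a b : a \in iota 0 3 -> b \in iota 0 3 ->
  \sum_(k <- iota 0 3) a_ a k * a_ b k = zr (dl a b).
Proof.
rewrite !mem_iota !add0n /= => a3 b3; case: A_SO3 => /matrixP /(_ (inord a) (inord b)) + _.
rewrite !mxE -val_eqE /= !inordK // zr_dl => <-.
rewrite -(sum_ord_nat 3 (fun k => a_ a k * a_ b k)).
by apply: eq_bigr => k _; rewrite mxE /mxn inord_val.
Qed.

Lemma cols_orth i j : i \in iota 0 3 -> j \in iota 0 3 ->
  \sum_(k <- iota 0 3) a_ k i * a_ k j = zr (dl i j).
Proof.
rewrite !mem_iota !add0n /= => i3 j3; case: A_SO3 => /mulmx1C /matrixP /(_ (inord i) (inord j)) + _.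
rewrite !mxE -val_eqE /= !inordK // zr_dl => <-.
rewrite -(sum_ord_nat 3 (fun k => a_ k i * a_ k j)).
by apply: eq_bigr => k _; rewrite mxE /mxn inord_val.
Qed.

(** The action on the three V-indices of a torsion tensor. The last one is contravariant, but the
    inverse of A is its transpose, so it transforms like the other two. *)
Definition av (f : nat -> nat -> nat -> R) (a b c : nat) : R :=
  \sum_(a' <- iota 0 3) \sum_(b' <- iota 0 3) \sum_(c' <- iota 0 3)
    a_ a a' * a_ b b' * a_ c c' * f a' b' c'.

Lemma eq_av f g a b c : (forall a b c, f a b c = g a b c) -> av f a b c = av g a b c.
Proof. by move=> fg; do 3 (apply: eq_bigr => ? _); rewrite fg. Qed.

Lemma avD f g a b c : av (fun a b c => f a b c + g a b c) a b c = av f a b c + av g a b c.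
Proof.
rewrite /av -big_split; apply: eq_bigr => a' _; rewrite -big_split; apply: eq_bigr => b' _.
by rewrite -big_split; apply: eq_bigr => c' _; rewrite mulrDr.
Qed.

Lemma avZ k f a b c : av (fun a b c => k * f a b c) a b c = k * av f a b c.
Proof. by rewrite /av; do 3 (rewrite mulr_sumr; apply: eq_bigr => ? _); ring. Qed.

Lemma av_e3 a b c : a \in iota 0 3 -> b \in iota 0 3 -> c \in iota 0 3 ->
  av (fun a b c => zr (e3 a b c)) a b c = zr (e3 a b c).
Proof.
have [_ dA] := A_SO3; rewrite det3 in dA.
have z1 : zr 1%coq_Z = 1 by [].
have zm1 : zr (-1)%coq_Z = -1 by [].
rewrite !inE => /or3P[]/eqP-> /or3P[]/eqP-> /or3P[]/eqP->;
  (* With a repeated index both sides vanish identically; for the six permutations the left side is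
     the signed determinant, so the right side is multiplied by det A = 1. *)
  rewrite /av !sum_iota3 /e3 ?zr0 ?z1 ?zm1; first [ring | rewrite -[RHS]mulr1 -[X in _ = _ * X]dA; ring].
Qed.

Lemma av_sep12 f g a b c : av (fun a b c => f a b * g c) a b c
  = (\sum_(a' <- iota 0 3) \sum_(b' <- iota 0 3) a_ a a' * a_ b b' * f a' b')
    * (\sum_(c' <- iota 0 3) a_ c c' * g c').
Proof.
rewrite mulr_suml; apply: eq_bigr => a' _; rewrite mulr_suml; apply: eq_bigr => b' _.
by rewrite mulr_sumr; apply: eq_bigr => c' _; ring.
Qed.

Lemma av_swap12 f a b c : av (fun a b c => f b a c) a b c = av f b a c.
Proof.
rewrite /av exchange_big; apply: eq_bigr => b' _; apply: eq_bigr => a' _.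
by apply: eq_bigr => c' _; ring.
Qed.

Lemma av_swap23 f a b c : av (fun a b c => f a c b) a b c = av f a c b.
Proof.
rewrite /av; apply: eq_bigr => a' _; rewrite exchange_big.
by apply: eq_bigr => c' _; apply: eq_bigr => b' _; ring.
Qed.

Lemma av_dl_dl a b c k : a \in iota 0 3 -> b \in iota 0 3 -> k \in iota 0 3 ->
  av (fun a b c => zr (dl a b) * zr (dl c k)) a b c = zr (dl a b) * a_ c k.
Proof.
move=> a3 b3 k3; rewrite (av_sep12 (fun a b => zr (dl a b)) (fun c => zr (dl c k))).
rewrite (sum_dl (a_ c)) // -rows_orth //; congr (_ * _); rewrite !big_seq.
apply: eq_bigr => a' a'3; exact: (sum_dl' (fun b' => a_ a a' * a_ b b')).
Qed.

Lemma av_cycle f a b c : av (fun a b c => f b c a) a b c = av f b c a.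
Proof. by rewrite (av_swap12 (fun a b c => f a c b)) av_swap23. Qed.

Lemma av_dl3 a b c i j k : i \in iota 0 3 -> j \in iota 0 3 -> k \in iota 0 3 ->
  av (fun a b c => zr (dl a i) * zr (dl b j) * zr (dl c k)) a b c
  = a_ a i * a_ b j * a_ c k.
Proof.
move=> i3 j3 k3; rewrite (av_sep12 (fun a b => zr (dl a i) * zr (dl b j)) (fun c => zr (dl c k))).
rewrite (sum_dl (a_ c)) //; congr (_ * _).
rewrite -(sum_dl3 (fun a' => a_ a a' * a_ b j) i3); apply: eq_bigr => a' _.
rewrite -(sum_dl3 (fun b' => a_ a a' * a_ b b') j3) mulr_suml.
by apply: eq_bigr => b' _; ring.
Qed.

(** The 2 x 2 minors of a rotation are its own entries. Contracting the remaining index with A gives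
    the invariance of epsilon; orthogonality of the columns then moves that A to the other side. *)
Lemma av2_e3 b c i : b \in iota 0 3 -> c \in iota 0 3 -> i \in iota 0 3 ->
  \sum_(b' <- iota 0 3) \sum_(c' <- iota 0 3) a_ b b' * a_ c c' * zr (e3 b' c' i)
  = \sum_(l <- iota 0 3) zr (e3 b c l) * a_ l i.
Proof.
move=> b3 c3 i3.
pose X i := \sum_(b' <- iota 0 3) \sum_(c' <- iota 0 3) a_ b b' * a_ c c' * zr (e3 b' c' i).
have XA l : l \in iota 0 3 -> \sum_(i' <- iota 0 3) X i' * a_ l i' = zr (e3 b c l).
  move=> l3; rewrite -av_e3 //.
  have -> : \sum_(i' <- iota 0 3) X i' * a_ l i' = \sum_(i' <- iota 0 3)
      \sum_(b' <- iota 0 3) \sum_(c' <- iota 0 3) a_ b b' * a_ c c' * a_ l i' * zr (e3 b' c' i').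
    apply: eq_bigr => i' _; rewrite /X mulr_suml; apply: eq_bigr => b' _.
    by rewrite mulr_suml; apply: eq_bigr => c' _; ring.
  by rewrite exchange_big; apply: eq_bigr => b' _; rewrite exchange_big.
rewrite -/(X i) -(sum_dl3 X i3).
rewrite (eq_big_seq (fun i' => \sum_(l <- iota 0 3) X i' * a_ l i' * a_ l i)); last first.
  by move=> i' i'3; rewrite -cols_orth // mulr_sumr; apply: eq_bigr => l _; ring.
rewrite exchange_big; apply: eq_big_seq => l l3.
by rewrite -XA // mulr_suml.
Qed.

Lemma av_e3_dl a b c i j : b \in iota 0 3 -> c \in iota 0 3 ->
  i \in iota 0 3 -> j \in iota 0 3 ->
  av (fun a b c => zr (e3 b c i) * zr (dl a j)) a b c
  = (\sum_(l <- iota 0 3) zr (e3 b c l) * a_ l i) * a_ a j.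
Proof.
move=> b3 c3 i3 j3; rewrite (av_cycle (fun a b c => zr (e3 a b i) * zr (dl c j))).
by rewrite (av_sep12 (fun a b => zr (e3 a b i)) (fun c => zr (dl c j))) av2_e3 // (sum_dl (a_ a)).
Qed.

Lemma rs2_dl i j : i \in iota 0 3 -> j \in iota 0 3 ->
  rs2 (fun i j => zr (dl i j)) i j = zr (dl i j).
Proof.
move=> i3 j3; rewrite -cols_orth //; apply: eq_big_seq => i' i'3.
rewrite -(sum_dl3' (fun j' => a_ i' i * a_ j' j) i'3).
by apply: eq_bigr => j' _; ring.
Qed.

Lemma sum_dl_l a i : a \in iota 0 3 -> \sum_(i' <- iota 0 3) zr (dl a i') * a_ i' i = a_ a i.
Proof.
by move=> a3; rewrite -(sum_dl3' (a_^~ i) a3); apply: eq_bigr => k _; rewrite mulrC.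
Qed.

Definition intw3 (j : nat) (P : vfun) : Prop :=
  forall a b c J, a \in iota 0 3 -> b \in iota 0 3 -> c \in iota 0 3 -> J \in codes 3 j ->
  av (fun a b c => zr (P a b c J)) a b c = \sum_(I <- codes 3 j) zr (P a b c I) * prodn A I J.

Lemma intw_Pe : intw3 0 Pe.
Proof.
move=> a b c J a3 b3 c3; rewrite inE => /eqP ->.
by rewrite sum_codes0 prodn_nil mulr1 /Pe av_e3.
Qed.

Lemma intw_Pu : intw3 1 Pu.
Proof.
move=> a b c J a3 b3 c3 /codesS[i [J' [-> i3]]]; rewrite inE => /eqP ->.
rewrite (eq_av (g := fun a b c => zr (dl a b) * zr (dl c i))); last by move=> *; rewrite -zrM.
rewrite av_dl_dl // sum_codesS -(sum_dl_l i c3) mulr_sumr; apply: eq_bigr => k _.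
by rewrite sum_codes0 prodn_cons prodn_nil /Pu zrM /=; ring.
Qed.

Lemma intw_Pv : intw3 1 Pv.
Proof.
move=> a b c J a3 b3 c3 /codesS[i [J' [-> i3]]]; rewrite inE => /eqP ->.
rewrite (eq_av (g := fun a b c => zr (dl b c) * zr (dl a i))); last by move=> *; rewrite -zrM.
rewrite (av_cycle (fun a b c => zr (dl a b) * zr (dl c i))).
rewrite av_dl_dl // sum_codesS -(sum_dl_l i a3) mulr_sumr; apply: eq_bigr => k _.
by rewrite sum_codes0 prodn_cons prodn_nil /Pv zrM /=; ring.
Qed.

Lemma intw_P2 : intw3 2 P2.
Proof.
move=> a b c J a3 b3 c3 /codesS[i [J1 [-> i3 /codesS[j [J' [-> j3]]]]]].
rewrite inE => /eqP -> {J J1 J'}.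
have -> : \sum_(I <- codes 3 2) zr (P2 a b c I) * prodn A I [:: i; j]
   = rs2 (fun i j => zr 3%coq_Z * (zr (e3 b c i) * zr (dl a j))
       + zr 3%coq_Z * (zr (dl a i) * zr (e3 b c j))
       + (- (zr 2%coq_Z * zr (e3 a b c))) * zr (dl i j)) i j.
  rewrite sum_codesS; apply: eq_bigr => i' _; rewrite sum_codesS; apply: eq_bigr => j' _.
  rewrite sum_codes0 !prodn_cons prodn_nil mulr1 [P2 _ _ _ _]/(Z.sub _ _).
  by rewrite zrB !(zrM, zrD); ring.
rewrite !(rs2D, rs2Z) rs2_dl // !(rs2_sep _ a_ (fun i => zr (e3 b c i)), rs2_sep _ a_ (fun i => zr (dl a i))).
rewrite !sum_dl_l //.
rewrite (eq_av (g := fun a b c => zr 3%coq_Z * (zr (e3 b c i) * zr (dl a j))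
    + zr 3%coq_Z * (zr (e3 b c j) * zr (dl a i))
    + (- (zr 2%coq_Z * zr (dl i j))) * zr (e3 a b c))); last first.
  by move=> a' b' c'; rewrite [P2 _ _ _ _]/(Z.sub _ _) zrB !(zrM, zrD); ring.
by rewrite !(avD, avZ) !av_e3_dl // av_e3 //; ring.
Qed.

Lemma av_P3term a b c i j k : a \in iota 0 3 -> b \in iota 0 3 -> c \in iota 0 3 ->
  i \in iota 0 3 -> j \in iota 0 3 -> k \in iota 0 3 ->
  av (fun a b c => zr (P3term a b c i j k)) a b c
  = rs3 (fun i j k => zr (P3term a b c i j k)) i j k.
Proof.
move=> a3 b3 c3 i3 j3 k3.
rewrite (eq_av (g := fun a b c => zr 5%coq_Z * (zr (dl a i) * zr (dl b j) * zr (dl c k))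
   + (- zr (dl i j)) * (zr (dl a b) * zr (dl c k))
   + (- zr (dl i j)) * (zr (dl a c) * zr (dl b k))
   + (- zr (dl i j)) * (zr (dl b c) * zr (dl a k)))); last first.
  by move=> *; rewrite /P3term zrB !(zrM, zrD); ring.
have -> : rs3 (fun i j k => zr (P3term a b c i j k)) i j k
  = rs3 (fun i j k => (zr 5%coq_Z * (zr (dl a i) * zr (dl b j))) * zr (dl c k)
    + zr (dl i j) * (- zr (dl a b) * zr (dl c k) + - zr (dl a c) * zr (dl b k)
       + - zr (dl b c) * zr (dl a k))) i j k.
  do 3 (apply: eq_bigr => ? _); congr (_ * _).
  by rewrite /P3term zrB !(zrM, zrD); ring.
rewrite rs3D !(avD, avZ) av_dl3 // av_dl_dl //.
rewrite (av_swap23 (fun a b c => zr (dl a b) * zr (dl c k))) av_dl_dl //.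
rewrite (av_cycle (fun a b c => zr (dl a b) * zr (dl c k))) av_dl_dl //.
rewrite (rs3_sep _ a_ (fun i j => zr 5%coq_Z * (zr (dl a i) * zr (dl b j))) (fun k => zr (dl c k))).
rewrite rs2Z (rs2_sep _ a_ (fun i => zr (dl a i)) (fun j => zr (dl b j))) !sum_dl_l //.
rewrite (rs3_sep _ a_ (fun i j => zr (dl i j))) rs2_dl //.
have -> : \sum_(k' <- iota 0 3) (- zr (dl a b) * zr (dl c k') + - zr (dl a c) * zr (dl b k')
    + - zr (dl b c) * zr (dl a k')) * a_ k' k
  = - zr (dl a b) * a_ c k + - zr (dl a c) * a_ b k + - zr (dl b c) * a_ a k.
  rewrite -(sum_dl_l k a3) -(sum_dl_l k b3) -(sum_dl_l k c3) !mulr_sumr -!big_split.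
  by apply: eq_bigr => k' _ /=; ring.
ring.
Qed.

Lemma intw_P3 : intw3 3 P3.
Proof.
move=> a b c J a3 b3 c3 /codesS[i [J1 [-> i3 /codesS[j [J2 [-> j3 /codesS[k [J' [-> k3]]]]]]]]].
rewrite inE => /eqP -> {J J1 J2 J'}.
pose T a b c i j k := zr (P3term a b c i j k).
have P3E a' b' c' x y z : zr (P3 a' b' c' [:: x; y; z]) = T a' b' c' x y z + T a' b' c' x z y
    + T a' b' c' y x z + T a' b' c' y z x + T a' b' c' z x y + T a' b' c' z y x.
  by rewrite /T -!zrD.
have -> : \sum_(I <- codes 3 3) zr (P3 a b c I) * prodn A I [:: i; j; k]
   = rs3 (fun i j k => T a b c i j k + T a b c i k j
    + T a b c j i k + T a b c j k i + T a b c k i j + T a b c k j i) i j k.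
  rewrite sum_codesS; apply: eq_bigr => i' _; rewrite sum_codesS; apply: eq_bigr => j' _.
  rewrite sum_codesS; apply: eq_bigr => k' _.
  by rewrite sum_codes0 !prodn_cons prodn_nil mulr1 P3E.
(* All six terms are [T a b c] with permuted arguments; renaming the summation indices moves the
   permutation onto i, j, k, where it matches the left side term by term. *)
rewrite !rs3D (rs3_swap23 _ a_ (T a b c)) (rs3_swap12 _ a_ (T a b c)).
rewrite (rs3_swap12 _ a_ (fun i j k => T a b c i k j)) (rs3_swap23 _ a_ (T a b c) j i k).
rewrite (rs3_swap23 _ a_ (fun i j k => T a b c j i k)) (rs3_swap12 _ a_ (T a b c) i k j).
rewrite (rs3_swap12 _ a_ (fun i j k => T a b c k i j)) (rs3_swap23 _ a_ (fun i j k => T a b c j i k)).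
rewrite (rs3_swap12 _ a_ (T a b c) j k i).
rewrite (eq_av _ _ _ (fun a' b' c' => P3E a' b' c' i j k)) !avD.
by rewrite /T !av_P3term.
Qed.

End Orthogonal.
End Intertwiners.

(** * Intertwiners on W for SL(2) *)

Section SpecialLinear.
Variable R : realType.
Variable B : 'M[R]_2.
Hypothesis B_SL2 : SL2 B.
Local Notation zr := (zr R).
Local Notation kr := (kr R).
Local Notation b_ := (mxn B).
Local Notation bi := (mxn (invmx B)).

Lemma SL2_unit : B \in unitmx.
Proof. by rewrite unitmxE B_SL2 unitr1. Qed.

Lemma mul_inv_entries p r : p \in iota 0 2 -> r \in iota 0 2 ->
  \sum_(k <- iota 0 2) b_ p k * bi k r = zr (dl p r).
Proof.
rewrite !mem_iota !add0n /= => p2 r2.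
have /matrixP /(_ (inord p) (inord r)) := mulmxV SL2_unit.
rewrite !mxE -val_eqE /= !inordK // zr_dl => <-.
rewrite -(sum_ord_nat 2 (fun k => b_ p k * bi k r)).
by apply: eq_bigr => k _; rewrite /mxn inord_val.
Qed.

Lemma det2_eq1 : b_ 0 0 * b_ 1 1 - b_ 0 1 * b_ 1 0 = 1.
Proof.
rewrite -[RHS]B_SL2 (expand_det_row _ ord0) !big_ord_recl big_ord0 /cofactor !det_mx11 !mxE.
have fE i j : B i j = b_ (val i) (val j) by rewrite /mxn !inord_val.
by rewrite !fE /= /bump /= expr0 expr1; ring.
Qed.

Lemma inv_entries : [/\ bi 0 0 = b_ 1 1, bi 0 1 = - b_ 0 1, bi 1 0 = - b_ 1 0 & bi 1 1 = b_ 0 0].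
Proof.
have e p r : p \in iota 0 2 -> r \in iota 0 2 -> b_ p 0 * bi 0 r + b_ p 1 * bi 1 r = zr (dl p r).
  by move=> p2 r2; rewrite -mul_inv_entries // sum_iota2.
have e00 : b_ 0 0 * bi 0 0 + b_ 0 1 * bi 1 0 = 1 by rewrite e.
have e01 : b_ 0 0 * bi 0 1 + b_ 0 1 * bi 1 1 = 0 by rewrite e.
have e10 : b_ 1 0 * bi 0 0 + b_ 1 1 * bi 1 0 = 0 by rewrite e.
have e11 : b_ 1 0 * bi 0 1 + b_ 1 1 * bi 1 1 = 1 by rewrite e.
have d := det2_eq1; split.
- have -> : bi 0 0 = b_ 1 1 * 1 - b_ 0 1 * 0 by rewrite -e00 -e10 -[LHS]mulr1 -d; ring.
  ring.
- have -> : bi 0 1 = b_ 1 1 * 0 - b_ 0 1 * 1 by rewrite -e01 -e11 -[LHS]mulr1 -d; ring.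
  ring.
- have -> : bi 1 0 = b_ 0 0 * 0 - b_ 1 0 * 1 by rewrite -e10 -e00 -[LHS]mulr1 -d; ring.
  ring.
- have -> : bi 1 1 = b_ 0 0 * 1 - b_ 1 0 * 0 by rewrite -e11 -e01 -[LHS]mulr1 -d; ring.
  ring.
Qed.

(** The area form identifies W with its dual as SL(2)-modules: for det B = 1 the inverse is the
    adjugate, which is the conjugate of the transpose of B by [e2]. *)
Lemma inv_e2 r k : r \in iota 0 2 -> k \in iota 0 2 ->
  \sum_(r' <- iota 0 2) bi r' r * zr (e2 r' k) = \sum_(l <- iota 0 2) zr (e2 r l) * b_ l k.
Proof.
have [i00 i01 i10 i11] := inv_entries.
have z1 : zr 1%coq_Z = 1 by [].
have zm1 : zr (-1)%coq_Z = -1 by [].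
rewrite !inE => /orP[]/eqP-> /orP[]/eqP->; rewrite !sum_iota2 /e2 ?zr0 ?z1 ?zm1 ?i00 ?i01 ?i10 ?i11; ring.
Qed.

Definition aw (f : nat -> nat -> nat -> R) (p q r : nat) : R :=
  \sum_(p' <- iota 0 2) \sum_(q' <- iota 0 2) \sum_(r' <- iota 0 2)
    b_ p p' * b_ q q' * bi r' r * f p' q' r'.

Lemma eq_aw f g p q r : (forall a b c, f a b c = g a b c) -> aw f p q r = aw g p q r.
Proof. by move=> fg; do 3 (apply: eq_bigr => ? _); rewrite fg. Qed.

Lemma awD f g a b c : aw (fun a b c => f a b c + g a b c) a b c = aw f a b c + aw g a b c.
Proof.
rewrite /aw -big_split; apply: eq_bigr => a' _; rewrite -big_split; apply: eq_bigr => b' _.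
by rewrite -big_split; apply: eq_bigr => c' _; rewrite mulrDr.
Qed.

Lemma awZ k f a b c : aw (fun a b c => k * f a b c) a b c = k * aw f a b c.
Proof. by rewrite /aw; do 3 (rewrite mulr_sumr; apply: eq_bigr => ? _); ring. Qed.

Lemma sum_dl2 (F : nat -> R) i : i \in iota 0 2 ->
  \sum_(k <- iota 0 2) F k * zr (dl k i) = F i.
Proof. exact: sum_dl. Qed.

Lemma sum_dl2_l a i : a \in iota 0 2 -> \sum_(i' <- iota 0 2) zr (dl a i') * b_ i' i = b_ a i.
Proof.
move=> a2; rewrite -(sum_dl2 (b_^~ i) a2); apply: eq_bigr => k _.
by rewrite mulrC dlC.
Qed.

Definition intw2 (n : nat) (q : wfun) : Prop :=
  forall a b c J, a \in iota 0 2 -> b \in iota 0 2 -> c \in iota 0 2 -> J \in codes 2 n ->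
  aw (fun a b c => kr (q a b c J)) a b c = \sum_(I <- codes 2 n) kr (q a b c I) * prodn B I J.

Lemma intw_qa : intw2 1 qa.
Proof.
move=> p q r J p2 q2 r2 /codesS[y [J' [-> y2]]]; rewrite inE => /eqP ->.
rewrite (eq_aw (g := fun p q r => zr (dl p r) * zr (dl q y))); last first.
  by move=> *; rewrite /qa kr_int zrM.
have -> : aw (fun p q r => zr (dl p r) * zr (dl q y)) p q r = zr (dl p r) * b_ q y.
  rewrite -(sum_dl2 (b_ q) y2) -mul_inv_entries // mulr_suml; apply: eq_big_seq => p' p'2.
  rewrite mulr_sumr; apply: eq_bigr => q' _.
  rewrite -(sum_dl2 (fun r' => b_ p p' * bi r' r) p'2) mulr_suml.
  by apply: eq_bigr => r' _; rewrite dlC; ring.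
rewrite sum_codesS -(sum_dl2_l y q2) mulr_sumr; apply: eq_bigr => k _.
by rewrite sum_codes0 prodn_cons prodn_nil /qa kr_int zrM /=; ring.
Qed.

(** The indices p and q are both covariant, so this is the identity for [qa] with their roles
    exchanged. *)
Lemma intw_qb : intw2 1 qb.
Proof.
move=> p q r J p2 q2 r2 J1; have := intw_qa q2 p2 r2 J1.
rewrite /aw exchange_big /= => e.
rewrite -[RHS]e; apply: eq_bigr => p' _; apply: eq_bigr => q' _; apply: eq_bigr => r' _.
by rewrite /qa /qb; ring.
Qed.

Lemma intw_qe : intw2 1 qe.
Proof.
move=> p q r J p2 q2 r2 J1.
have qeE p' q' r' I : kr (qe p' q' r' I) = kr (qa p' q' r' I) + (- zr 2%coq_Z) * kr (qb p' q' r' I).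
  by rewrite /qe krB kr_scale mulNr.
rewrite (eq_aw _ _ _ (fun p' q' r' => qeE p' q' r' J)) awD awZ intw_qa // intw_qb //.
rewrite mulr_sumr -big_split; apply: eq_bigr => I _ /=.
by rewrite qeE; ring.
Qed.

Lemma aw_symterm p q r i j k : p \in iota 0 2 -> q \in iota 0 2 -> r \in iota 0 2 ->
  i \in iota 0 2 -> j \in iota 0 2 -> k \in iota 0 2 ->
  aw (fun p q r => zr (symterm p q r i j k)) p q r
  = rs3 (iota 0 2) b_ (fun i j k => zr (symterm p q r i j k)) i j k.
Proof.
move=> p2 q2 r2 i2 j2 k2.
have -> : rs3 (iota 0 2) b_ (fun i j k => zr (symterm p q r i j k)) i j k
  = rs3 (iota 0 2) b_ (fun i j k => zr (dl p i) * zr (dl q j) * zr (e2 r k)) i j k.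
  by do 3 (apply: eq_bigr => ? _); congr (_ * _); rewrite /symterm !zrM mulrA.
rewrite (rs3_sep _ b_ (fun i j => zr (dl p i) * zr (dl q j)) (fun k => zr (e2 r k))).
rewrite (rs2_sep _ b_ (fun i => zr (dl p i)) (fun j => zr (dl q j))) !sum_dl2_l //.
rewrite -inv_e2 // -(sum_dl2 (b_ p) i2) !mulr_suml; apply: eq_bigr => p' _.
rewrite -(sum_dl2 (b_ q) j2) [X in _ = X * _]mulr_sumr mulr_suml; apply: eq_bigr => q' _.
by rewrite mulr_sumr; apply: eq_bigr => r' _; rewrite /symterm !zrM; ring.
Qed.

Lemma intw_qs : intw2 3 qs.
Proof.
move=> a b c J a2 b2 c2 /codesS[i [J1 [-> i2 /codesS[j [J2 [-> j2 /codesS[k [J' [-> k2]]]]]]]]].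
rewrite inE => /eqP -> {J J1 J2 J'}.
pose T a b c i j k := zr (symterm a b c i j k).
have qsE a' b' c' x y z : kr (qs a' b' c' [:: x; y; z]) = T a' b' c' x y z + T a' b' c' x z y
    + T a' b' c' y x z + T a' b' c' y z x + T a' b' c' z x y + T a' b' c' z y x.
  by rewrite kr_int /T -!zrD.
have -> : \sum_(I <- codes 2 3) kr (qs a b c I) * prodn B I [:: i; j; k]
   = rs3 (iota 0 2) b_ (fun i j k => T a b c i j k + T a b c i k j
    + T a b c j i k + T a b c j k i + T a b c k i j + T a b c k j i) i j k.
  rewrite sum_codesS; apply: eq_bigr => i' _; rewrite sum_codesS; apply: eq_bigr => j' _.
  rewrite sum_codesS; apply: eq_bigr => k' _.
  by rewrite sum_codes0 !prodn_cons prodn_nil mulr1 qsE.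
rewrite !rs3D (rs3_swap23 _ b_ (T a b c)) (rs3_swap12 _ b_ (T a b c)).
rewrite (rs3_swap12 _ b_ (fun i j k => T a b c i k j)) (rs3_swap23 _ b_ (T a b c) j i k).
rewrite (rs3_swap23 _ b_ (fun i j k => T a b c j i k)) (rs3_swap12 _ b_ (T a b c) i k j).
rewrite (rs3_swap12 _ b_ (fun i j k => T a b c k i j)) (rs3_swap23 _ b_ (fun i j k => T a b c j i k)).
rewrite (rs3_swap12 _ b_ (T a b c) j k i).
rewrite (eq_aw _ _ _ (fun a' b' c' => qsE a' b' c' i j k)) !awD.
by rewrite /T !aw_symterm.
Qed.

End SpecialLinear.

(** With the identity acting on W every tensor intertwines. The output index is frozen at y, and the
    target has no W-index left. *)
Lemma intw_fixw (R : realType) (q : wfun) (y : seq nat) : intw2 (1%:M : 'M[R]_2) 0 (fixw q y).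
Proof.
move=> a b c J a2 b2 c2; rewrite inE => /eqP ->; rewrite sum_codes0 prodn_nil mulr1.
have e i j : i \in iota 0 2 -> j \in iota 0 2 -> mxn (1%:M : 'M[R]_2) i j = zr R (dl i j).
  rewrite !mem_iota !add0n /mxn mxE zr_dl => /= i2 j2.
  by rewrite -val_eqE /= !inordK.
rewrite /aw invmx1 /fixw.
rewrite -[RHS](sum_dl2 (fun a => kr R (q a b c y)) a2); apply: eq_big_seq => a' a'2.
rewrite -(sum_dl2 (fun b => kr R (q a' b c y)) b2) mulr_suml; apply: eq_big_seq => b' b'2.
rewrite -(sum_dl2 (fun c => kr R (q a' b' c y)) c2) mulr_suml mulr_suml; apply: eq_big_seq => c' c'2.
rewrite !e // (dlC a) (dlC b); ring.
Qed.

(** * Equivariance of kernels on V (x) W *)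

Section Equivariance.
Local Notation hi x := (x %/ 2)%N.
Local Notation lo x := (x %% 2)%N.
Variable R : realType.
Local Notation zr := (zr R).
Local Notation kr := (kr R).

Lemma sum_ord6 (H : nat -> nat -> R) : \sum_(y < 6) H (hi y) (lo y)
  = \sum_(i <- iota 0 3) \sum_(p <- iota 0 2) H i p.
Proof.
rewrite (sum_ord_nat 6 (fun y => H (hi y) (lo y))) !sum_iota3 !sum_iota2.
by rewrite /= !big_cons big_nil /=; ring.
Qed.

Lemma sum_Xt_split (f g : nat -> nat -> nat -> R) :
  \sum_(x : Xt) (f (hi x.1.1) (hi x.1.2) (hi x.2)
                 * g (lo x.1.1) (lo x.1.2) (lo x.2))
  = (\sum_(i <- iota 0 3) \sum_(j <- iota 0 3) \sum_(k <- iota 0 3) f i j k)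
    * (\sum_(p <- iota 0 2) \sum_(q <- iota 0 2) \sum_(r <- iota 0 2) g p q r).
Proof.
rewrite (sum_Xt (fun x => f (hi x.1.1) (hi x.1.2) (hi x.2)
                 * g (lo x.1.1) (lo x.1.2) (lo x.2))) /=.
rewrite (sum_ord6 (fun i p => \sum_(b < 6) \sum_(c < 6)
   (f i (hi b) (hi c) * g p (lo b) (lo c)))).
rewrite mulr_suml; apply: eq_bigr => i _; rewrite mulr_sumr; apply: eq_bigr => p _.
rewrite (sum_ord6 (fun j q => \sum_(c < 6) (f i j (hi c) * g p q (lo c)))).
rewrite mulr_suml; apply: eq_bigr => j _; rewrite mulr_sumr; apply: eq_bigr => q _.
rewrite (sum_ord6 (fun k r => f i j k * g p q r)).
by rewrite mulr_suml; apply: eq_bigr => k _; rewrite mulr_sumr.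
Qed.

Lemma g6M (A A' : 'M[R]_3) (B B' : 'M[R]_2) : g6 A B *m g6 A' B' = g6 (A *m A') (B *m B').
Proof.
apply/matrixP => x z; rewrite !mxE.
under eq_bigr do rewrite !mxE.
rewrite (sum_ord6 (fun i p => mxn A (hi x) i * mxn B (lo x) p
          * (mxn A' i (hi z) * mxn B' p (lo z)))).
rewrite -(sum_ord_nat 3 (fun i => \sum_(p <- iota 0 2) mxn A (hi x) i * mxn B (lo x) p
          * (mxn A' i (hi z) * mxn B' p (lo z)))).
rewrite mulr_suml; apply: eq_bigr => i _; rewrite mulr_sumr.
rewrite -(sum_ord_nat 2 (fun p => mxn A (hi x) i * mxn B (lo x) p
          * (mxn A' i (hi z) * mxn B' p (lo z)))).
by apply: eq_bigr => p _; rewrite /mxn !inord_val; ring.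
Qed.

Lemma g6_1 : g6 (1%:M : 'M[R]_3) 1%:M = 1%:M.
Proof.
apply/matrixP => x y; rewrite !mxE -!val_eqE /= !inordK ?ltn_mod //;
  try by rewrite ltn_divLR.
have -> : (x == y :> nat) = (hi x == hi y) && (lo x == lo y).
  apply/eqP/andP => [-> //|[/eqP e1 /eqP e2]].
  by rewrite (divn_eq x 2) (divn_eq y 2) e1 e2.
by rewrite -natrM mulnb.
Qed.

Lemma invmx_g6 (A : 'M[R]_3) (B : 'M[R]_2) : SO3 A -> B \in unitmx ->
  invmx (g6 A B) = g6 A^T (invmx B).
Proof.
move=> [AT _] uB; have e : g6 A B *m g6 A^T (invmx B) = 1%:M by rewrite g6M AT mulmxV // g6_1.
have [u _] := mulmx1_unit e.
by rewrite -[LHS]mulmx1 -e mulmxA mulVmx // mul1mx.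
Qed.

Definition projmx (M : rmod R) (cd : ridx M -> code) (p q : seq nat -> seq nat -> Z) :
    'M[R]_#|ridx M| :=
  mkmx (fun y y' => zr (p (cd y).1 (cd y').1) * zr (q (cd y).2 (cd y').2)).

(** What a single summand A^p, B^q or A^p (x) B^q must provide to be handled through codes: its
    coordinates run through [ycodes], its action is a product of matrix entries over V and W, and
    its subspace is the row space of a multiple of a projector, which is the form in which the
    certificates can test it. *)
Definition is_leaf (M : rmod R) (cd : ridx M -> code) (j n : nat) (p q : seq nat -> seq nat -> Z) :=
  [/\ forall F : code -> R, \sum_y F (cd y) = \sum_(s <- ycodes j n) F s,
      forall y, cd y \in ycodes j n,
      forall A B y' y, emx (ract M A B) y' y = prodn A (cd y').1 (cd y).1 * prodn B (cd y').2 (cd y).2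
    & (rsub M == projmx cd p q)%MS].

Definition phimx (M : rmod R) (cd : ridx M -> code) (k : kernel) : 'M[R]_(#|Xt|, #|ridx M|) :=
  mkmx (fun x y => kr (k (xcode x) (cd y))).

Lemma sum_ycodes j n (F : code -> R) :
  \sum_(s <- ycodes j n) F s = \sum_(s <- codes 3 j) \sum_(t <- codes 2 n) F (s, t).
Proof. by rewrite /ycodes big_allpairs_dep. Qed.

Lemma rhoT_entry (A : 'M[R]_3) (B : 'M[R]_2) (x y : Xt) : SO3 A -> SL2 B ->
  emx (rhoT A B) x y =
   ((mxn A (hi x.1.1) (hi y.1.1) * mxn A (hi x.1.2) (hi y.1.2) * mxn A (hi x.2) (hi y.2))
   * (mxn B (lo x.1.1) (lo y.1.1) * mxn B (lo x.1.2) (lo y.1.2)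
      * mxn (invmx B) (lo y.2) (lo x.2))).
Proof.
move=> A3 B2; rewrite emx_mkmx invmx_g6 ?SL2_unit // !mxE /mxn; ring.
Qed.

Lemma tensk_equivariant M cd j n p q P w A B : @is_leaf M cd j n p q ->
  SO3 A -> SL2 B -> intw3 A j P -> intw2 B n w ->
  rhoT A B *m phimx cd (tensk P w) = phimx cd (tensk P w) *m ract M A B.
Proof.
move=> [sumM inM actM _] A3 B2 iP iw.
rewrite -(mkmx_emx (rhoT A B)) -(mkmx_emx (ract M A B)) !mkmxM.
apply: eq_mkmx => x y.
have d3 (z : 'I_6) : (hi z) \in iota 0 3 by rewrite mem_iota /= add0n ltn_divLR.
have d2 (z : 'I_6) : (lo z) \in iota 0 2 by rewrite mem_iota /= add0n ltn_mod.
have /allpairsP[[I J] [/= I3 J2 cdy]] := inM y.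
(* The entries of [rhoT] factor over V and W, so the sum over all torsion indices splits into a
   product and the two intertwining identities apply separately. *)
transitivity (av A (fun a b c => zr (P a b c I)) (hi x.1.1) (hi x.1.2) (hi x.2)
  * aw B (fun a b c => kr (w a b c J)) (lo x.1.1) (lo x.1.2) (lo x.2)).
  rewrite /av /aw -sum_Xt_split; apply: eq_bigr => z _.
  by rewrite rhoT_entry // cdy /tensk kr_scale /=; ring.
rewrite iP // iw //.
rewrite (eq_bigr (fun y' => kr (tensk P w (xcode x) (cd y')) *
   (prodn A (cd y').1 I * prodn B (cd y').2 J))); last by move=> y' _; rewrite actM cdy.
rewrite (sumM (fun s => kr (tensk P w (xcode x) s) * (prodn A s.1 I * prodn B s.2 J))).
rewrite sum_ycodes mulr_suml; apply: eq_bigr => s _; rewrite mulr_sumr; apply: eq_bigr => t _.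
by rewrite /tensk kr_scale /=; ring.
Qed.

Lemma addk_equivariant M cd k k' A B :
  rhoT A B *m @phimx M cd k = phimx cd k *m ract M A B ->
  rhoT A B *m phimx cd k' = phimx cd k' *m ract M A B ->
  rhoT A B *m phimx cd (addk k k') = phimx cd (addk k k') *m ract M A B.
Proof.
have -> : phimx cd (addk k k') = phimx cd k + phimx cd k'.
  by apply/matrixP => i l; rewrite !mxE /addk krD.
by move=> e e'; rewrite mulmxDr mulmxDl e e'.
Qed.

End Equivariance.

(** * Symmetric and harmonic tensors *)

Section SymmetricTensors.
Variable R : realType.
Local Notation zr := (zr R).

Lemma permtM n k (r s : 'S_k) (I : k.-tuple 'I_n) : permt r (permt s I) = permt (r * s)%g I.
Proof. by apply: eq_from_tnth => x; rewrite !tnth_mktuple permM. Qed.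

Lemma permt1 n k (I : k.-tuple 'I_n) : permt 1%g I = I.
Proof. by apply: eq_from_tnth => x; rewrite tnth_mktuple perm1. Qed.

Lemma permt_eq n k (s : 'S_k) (I J : k.-tuple 'I_n) : (permt s I == J) = (I == permt s^-1%g J).
Proof.
by apply/eqP/eqP => [<-|->]; rewrite permtM ?mulVg ?mulgV permt1.
Qed.

Lemma sub_symmxP n k (v : 'rV[R]_#|{: k.-tuple 'I_n}|) :
  reflect (forall (s : 'S_k) I, vx v (permt s I) = vx v I) (v <= symmx R n k)%MS.
Proof.
apply: (iffP submxP) => [[w ->] r J|vS].
  rewrite !vx_mulmx; apply: eq_bigr => I _; congr (_ * _).
  rewrite (reindex_inj (mulgI r)); apply: eq_bigr => s _ /=.
  by rewrite -permtM permt_eq permtM mulVg permt1.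
(* On a symmetric tensor the symmetrizer is multiplication by k!. *)
exists (#|'S_k|%:R^-1 *: v); rewrite -scalemxAl; apply/vxP => J.
have -> : vx (#|'S_k|%:R^-1 *: (v *m symmx R n k)) J = #|'S_k|%:R^-1 * vx (v *m symmx R n k) J.
  by rewrite /vx mxE.
rewrite vx_mulmx.
have -> : \sum_I vx v I * \sum_(s : 'S_k) (permt s I == J)%:R = \sum_(s : 'S_k) vx v J.
  under eq_bigr do rewrite mulr_sumr.
  rewrite exchange_big; apply: eq_bigr => s _ /=.
  rewrite (bigD1 (permt s^-1%g J)) //= permt_eq eqxx mulr1 big1 ?addr0 // => I /negPf IJ.
  by rewrite permt_eq IJ mulr0.
rewrite sumr_const -(mulr_natl (vx v J)) mulrA mulVf ?mul1r // pnatr_eq0 -lt0n.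
by rewrite card_Sn fact_gt0.
Qed.

(** Entries out of range are sent to 0 by [inord]; thus [fv] below is defined on all lists, and
    symmetry conditions can be stated for arbitrary natural numbers. *)
Definition tup n k (s : seq nat) : k.-tuple 'I_n.+1 := [tuple inord (nth 0%N s r) | r < k].

Lemma tup_vals n k (I : k.-tuple 'I_n.+1) : tup n k (vals I) = I.
Proof. by apply: eq_from_tnth => r; rewrite tnth_mktuple nth_vals inord_val. Qed.

Definition fv n k (v : 'rV[R]_#|{: k.-tuple 'I_n.+1}|) (s : seq nat) : R := vx v (tup n k s).

Lemma fvE n k (v : 'rV[R]_#|{: k.-tuple 'I_n.+1}|) s : fv v s = vx v (tup n k s).
Proof. by []. Qed.

Lemma fv_vals n k (v : 'rV[R]_#|{: k.-tuple 'I_n.+1}|) I : fv v (vals I) = vx v I.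
Proof. by rewrite /fv tup_vals. Qed.

Lemma fv_mulmx n k m (v : 'rV[R]_#|{: k.-tuple 'I_n.+1}|) (g : seq nat -> seq nat -> R)
    (J : m.-tuple 'I_n.+1) :
  vx (v *m mkmx (fun I J => g (vals I) (vals J))) J
  = \sum_(s <- codes n.+1 k) fv v s * g s (vals J).
Proof.
rewrite vx_mulmx -(sum_vals n.+1 k (fun s => fv v s * g s (vals J))).
by apply: eq_bigr => I _; rewrite fv_vals.
Qed.

Lemma vals_permt n k (s : 'S_k) (I : k.-tuple 'I_n) :
  vals (permt s I) = [seq nth 0%N (vals I) (s r) | r <- enum 'I_k].
Proof.
rewrite /vals /= -map_comp; apply: eq_map => r /=.
by rewrite (nth_vals I).
Qed.

Lemma permt_small n k (s : 'S_k) (I : k.-tuple 'I_n) : (k <= 1)%N -> permt s I = I.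
Proof.
move=> k1; apply: eq_from_tnth => r; rewrite tnth_mktuple; congr tnth.
have := leq_trans (ltn_ord (s r)) k1; have := leq_trans (ltn_ord r) k1.
by rewrite !ltnS !leqn0 => /eqP r0 /eqP sr0; apply: val_inj; rewrite /= r0 sr0.
Qed.

Lemma symmx_small n k (v : 'rV[R]_#|{: k.-tuple 'I_n}|) : (k <= 1)%N -> (v <= symmx R n k)%MS.
Proof. by move=> k1; apply/sub_symmxP => s I; rewrite permt_small. Qed.

(** The two adjacent transpositions generate the symmetric group; its six elements are run through
    by their values. *)
Lemma sym3_perm (g : nat -> nat -> nat -> R) (x : nat -> nat) (s : 'S_3) :
  (forall i j k, g j i k = g i j k) -> (forall i j k, g i k j = g i j k) ->
  g (x (s ord0)) (x (s (inord 1))) (x (s (inord 2))) = g (x 0%N) (x 1%N) (x 2%N).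
Proof.
move=> g12 g23.
have n (a b : 'I_3) : a != b -> (val (s a) != val (s b)) by rewrite val_eqE (inj_eq perm_inj).
have n01 : val (s ord0) != val (s (inord 1)) by apply: n; rewrite -val_eqE /= inordK.
have n02 : val (s ord0) != val (s (inord 2)) by apply: n; rewrite -val_eqE /= inordK.
have n12 : val (s (inord 1)) != val (s (inord 2)) by apply: n; rewrite -val_eqE /= !inordK.
move: n01 n02 n12 (ltn_ord (s ord0)) (ltn_ord (s (inord 1))) (ltn_ord (s (inord 2))) => /=.
case: (nat_of_ord (s ord0)) => [|[|[|a]]]; case: (nat_of_ord (s (inord 1))) => [|[|[|b]]];
case: (nat_of_ord (s (inord 2))) => [|[|[|c]]] //= _ _ _ _ _ _.
- by rewrite g23 g12.
- by rewrite g12 g23.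
- by rewrite g12 g23 g12.
Qed.

End SymmetricTensors.

Section Harmonic.
Variable R : realType.
Local Notation zr := (zr R).
Local Notation fv := (@fv R).
Local Notation io n i := (nat_of_ord (inord i : 'I_n.+1)).

Lemma enum3 : enum 'I_3 = [:: ord0; inord 1; inord 2].
Proof. by apply: (inj_map val_inj); rewrite val_enum_ord /= !inordK. Qed.

Lemma enum2 : enum 'I_2 = [:: ord0; inord 1].
Proof. by apply: (inj_map val_inj); rewrite val_enum_ord /= !inordK. Qed.

Lemma vals_tup3 n i j k : vals (tup n 3 [:: i; j; k]) = [:: io n i; io n j; io n k].
Proof. by rewrite /vals /tup /= enum3 /= (@inordK 2 1) // (@inordK 2 2). Qed.

Lemma vals_tup2 n i j : vals (tup n 2 [:: i; j]) = [:: io n i; io n j].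
Proof. by rewrite /vals /tup /= enum2 /= (@inordK 1 1). Qed.

Lemma permt_tperm3 n (I : 3.-tuple 'I_n.+1) (s : 'S_3) :
  permt s I = tup n 3 [:: nth 0%N (vals I) (s ord0); nth 0%N (vals I) (s (inord 1));
                          nth 0%N (vals I) (s (inord 2))].
Proof.
rewrite -[LHS](tup_vals); congr tup.
by rewrite vals_permt enum3.
Qed.

Lemma sub_symmx3P n (v : 'rV[R]_#|{: 3.-tuple 'I_n.+1}|) :
  (v <= symmx R n.+1 3)%MS <-> (forall i j k, fv v [:: j; i; k] = fv v [:: i; j; k])
    /\ (forall i j k, fv v [:: i; k; j] = fv v [:: i; j; k]).
Proof.
split=> [/sub_symmxP vS|[v12 v23]].
  split=> i j k.
    rewrite !fvE -(vS (tperm ord0 (inord 1)) (tup n 3 [:: i; j; k])); congr vx.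
    rewrite permt_tperm3 vals_tup3 tpermL tpermR tpermD -?val_eqE /= ?(@inordK 2 1) ?(@inordK 2 2) //=.
    by apply: eq_from_tnth => -[[|[|[|r]]] hr] //=; rewrite !tnth_mktuple /= inord_val.
  rewrite !fvE -(vS (tperm (inord 1) (inord 2)) (tup n 3 [:: i; j; k])); congr vx.
  rewrite permt_tperm3 vals_tup3 tpermL tpermR tpermD -?val_eqE /= ?(@inordK 2 1) ?(@inordK 2 2) //=.
  by apply: eq_from_tnth => -[[|[|[|r]]] hr] //=; rewrite !tnth_mktuple /= inord_val.
apply/sub_symmxP => s I; rewrite permt_tperm3 -[vx _ _]/(fv v _).
rewrite (sym3_perm (g := fun i j k => fv v [:: i; j; k]) (nth 0%N (vals I)) s v12 v23).
rewrite -[RHS]fv_vals; congr (fv v _).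
by apply: (@eq_from_nth _ 0%N); rewrite ?size_vals // => -[|[|[|]]].
Qed.

Lemma sub_symmx2P n (v : 'rV[R]_#|{: 2.-tuple 'I_n.+1}|) :
  (v <= symmx R n.+1 2)%MS <-> (forall i j, fv v [:: j; i] = fv v [:: i; j]).
Proof.
split=> [/sub_symmxP vS|v12].
  move=> i j; rewrite !fvE -(vS (tperm ord0 (inord 1)) (tup n 2 [:: i; j])); congr vx.
  rewrite -[RHS]tup_vals vals_permt enum2 vals_tup2 /= tpermL tpermR /= (@inordK 1 1) //=.
  by apply: eq_from_tnth => -[[|[|r]] hr] //=; rewrite !tnth_mktuple /= inord_val.
apply/sub_symmxP => s I; rewrite -fv_vals vals_permt enum2 /= -[RHS]fv_vals.
have vI : vals I = [:: nth 0%N (vals I) 0; nth 0%N (vals I) 1].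
  by apply: (@eq_from_nth _ 0%N); rewrite ?size_vals // => -[|[|]].
have n01 : val (s ord0) != val (s (inord 1)).
  by rewrite val_eqE (inj_eq perm_inj) -val_eqE /= inordK.
move: n01 (ltn_ord (s ord0)) (ltn_ord (s (inord 1))) => /=.
case: (nat_of_ord (s ord0)) => [|[|a]]; case: (nat_of_ord (s (inord 1))) => [|[|b]] //= _ _ _.
  by rewrite -vI.
by rewrite v12 -vI.
Qed.

Lemma vx_contr k (v : 'rV[R]_#|{: (k.+2).-tuple 'I_3}|) (J : k.-tuple 'I_3) :
  vx (v *m contr R 3 k) J = \sum_(a <- iota 0 3) fv v [:: a, a & vals J].
Proof.
pose g (s t : seq nat) : R :=
  (match s with a :: b :: u => (a == b) && (u == t) | _ => false end)%:R.
have -> : contr R 3 k = mkmx (fun I J => g (vals I) (vals J)).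
  apply: eq_mkmx => I L; case/tupleP: I => a I; case/tupleP: I => b I.
  by rewrite /g /vals /= val_eqE (inj_eq (inj_map val_inj)).
rewrite fv_mulmx sum_codesS; apply: eq_big_seq => a a3; rewrite sum_codesS.
rewrite (bigD1_seq a) //= [X in _ + X]big1 ?addr0 => [|b /negPf ba]; last first.
  by rewrite big1 // => u _; rewrite /g eq_sym ba mulr0.
rewrite -(sum_vals 3 k (fun u => fv v [:: a, a & u] * g [:: a, a & u] (vals J))).
rewrite (bigD1 J) //= /g !eqxx mulr1 big1 ?addr0 // => U /negPf UJ.
by rewrite (inj_eq (@vals_inj _ _)) UJ mulr0.
Qed.

Local Notation pmx n k p :=
  (mkmx (fun I J : k.-tuple 'I_n => zr (p (vals I) (vals J)))).

Lemma fv_pmx n k (v : 'rV[R]_#|{: k.-tuple 'I_n.+1}|) p J :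
  vx (v *m pmx n.+1 k p) J = \sum_(s <- codes n.+1 k) fv v s * zr (p s (vals J)).
Proof. exact: (fv_mulmx v (fun s t => zr (p s t))). Qed.

Lemma sub_by_scaling m (v : 'rV[R]_m) (M : 'M[R]_m) (c : R) :
  c != 0 -> v *m M = c *: v -> (v <= M)%MS.
Proof.
move=> c0 e; rewrite -[v]scale1r -(mulVf c0) -scalerA -e.
by rewrite scalemx_sub // submxMl.
Qed.

Lemma zr_nat_neq0 p : zr (Zpos p) != 0.
Proof. by apply: lt0r_neq0; apply: zr_gt0. Qed.

Lemma symmx0_proj n : (symmx R n.+1 0 == pmx n.+1 0 pA0)%MS.
Proof.
apply/andP; split; apply/rV_subP => v _; last exact: symmx_small.
apply: (@sub_by_scaling _ _ _ 1); rewrite ?oner_neq0 // scale1r; apply/vxP => J.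
by rewrite fv_pmx sum_codes0 -fv_vals (tuple0 J) mulr1.
Qed.

Lemma symmx1_proj n : (symmx R n.+1 1 == pmx n.+1 1 pA1)%MS.
Proof.
apply/andP; split; apply/rV_subP => v _; last exact: symmx_small.
apply: (@sub_by_scaling _ _ _ 1); rewrite ?oner_neq0 // scale1r; apply/vxP => J.
rewrite fv_pmx -fv_vals.
have /codesS[i [J' [-> i3]]] := vals_codes J; rewrite inE => /eqP ->.
rewrite sum_codesS -(sum_dl (fun i => fv v [:: i]) (iota_uniq 0 n.+1) i3).
by apply: eq_bigr => k _; rewrite sum_codes0.
Qed.

Lemma symz_swap12 f i j k : symz f [:: j; i; k] = symz f [:: i; j; k].
Proof. by rewrite /symz /=; lia. Qed.

Lemma symz_swap23 f i j k : symz f [:: i; k; j] = symz f [:: i; j; k].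
Proof. by rewrite /symz /=; lia. Qed.

Lemma fv_mul3 n (w : 'rV[R]_#|{: 3.-tuple 'I_n.+1}|) (p : seq nat -> seq nat -> Z) i j k :
  fv (w *m pmx n.+1 3 p) [:: i; j; k]
  = \sum_(s <- codes n.+1 3) fv w s * zr (p s [:: io n i; io n j; io n k]).
Proof. by rewrite fvE fv_pmx vals_tup3. Qed.

Lemma fv_mul2 n (w : 'rV[R]_#|{: 2.-tuple 'I_n.+1}|) (p : seq nat -> seq nat -> Z) i j :
  fv (w *m pmx n.+1 2 p) [:: i; j]
  = \sum_(s <- codes n.+1 2) fv w s * zr (p s [:: io n i; io n j]).
Proof. by rewrite fvE fv_pmx vals_tup2. Qed.

Lemma sum_dl_triple n (f : nat -> nat -> nat -> R) i j k :
  i \in iota 0 n -> j \in iota 0 n -> k \in iota 0 n ->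
  \sum_(a <- iota 0 n) \sum_(b <- iota 0 n) \sum_(c <- iota 0 n)
    f a b c * (zr (dl a i) * (zr (dl b j) * zr (dl c k))) = f i j k.
Proof.
move=> i3 j3 k3; rewrite -(sum_dl (fun a => f a j k) (iota_uniq 0 n) i3); apply: eq_bigr => a _.
rewrite -(sum_dl (fun b => f a b k) (iota_uniq 0 n) j3) mulr_suml; apply: eq_bigr => b _.
rewrite -(sum_dl (f a b) (iota_uniq 0 n) k3) !mulr_suml; apply: eq_bigr => c _.
by ring.
Qed.

Lemma sum_codes3 n (F : seq nat -> R) : \sum_(s <- codes n 3) F s =
  \sum_(a <- iota 0 n) \sum_(b <- iota 0 n) \sum_(c <- iota 0 n) F [:: a; b; c].
Proof.
rewrite sum_codesS; apply: eq_bigr => a _; rewrite sum_codesS; apply: eq_bigr => b _.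
by rewrite sum_codesS; apply: eq_bigr => c _; rewrite sum_codes0.
Qed.

Lemma symmx3_proj n : (symmx R n.+1 3 == pmx n.+1 3 pB3)%MS.
Proof.
apply/andP; split; apply/rV_subP => v.
  case/sub_symmx3P => v12 v23; apply: (@sub_by_scaling _ _ _ (zr 6%coq_Z)).
    exact: zr_nat_neq0.
  apply/vxP => J; rewrite fv_pmx sum_codes3.
  have -> : vx (zr 6%coq_Z *: v) J = zr 6%coq_Z * fv v (vals J).
    by rewrite fv_vals /vx mxE.
  have /codesS[i [J1 [-> i3 /codesS[j [J2 [-> j3 /codesS[k [J' [-> k3]]]]]]]]] := vals_codes J.
  rewrite inE => /eqP ->.
  pose T i j k := \sum_(a <- iota 0 n.+1) \sum_(b <- iota 0 n.+1) \sum_(c <- iota 0 n.+1)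
    fv v [:: a; b; c] * (zr (dl a i) * (zr (dl b j) * zr (dl c k))).
  have TE i' j' k' : i' \in iota 0 n.+1 -> j' \in iota 0 n.+1 -> k' \in iota 0 n.+1 ->
      T i' j' k' = fv v [:: i'; j'; k'].
    exact: (sum_dl_triple (fun a b c => fv v [:: a; b; c])).
  transitivity (T i j k + T i k j + T j i k + T j k i + T k i j + T k j i).
    rewrite /T -!big_split; apply: eq_bigr => a _; rewrite -!big_split; apply: eq_bigr => b _.
    rewrite -!big_split; apply: eq_bigr => c _ /=.
    by rewrite /pB3 /symz !zrD !zrM; ring.
  rewrite !TE // (v12 j k i) (v12 i k j) (v23 j i k) (v12 i j k) (v23 i j k) (_ : zr 6%coq_Z = 6%:R) //.
  by ring.
case/submxP => w ->; apply/sub_symmx3P; split=> i j k; rewrite !fv_mul3.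
  by apply: eq_bigr => s _; rewrite /pB3 symz_swap12.
by apply: eq_bigr => s _; rewrite /pB3 symz_swap23.
Qed.


(** On a symmetric traceless tensor the two permuted terms of [pA2] contribute 3 each and the trace
    term nothing, hence the factor 6. Conversely the columns of [pA2] are visibly symmetric, and
    their traces are checked by a finite table. *)
Lemma harm2_proj : (harm R 3 2 == pmx 3 2 pA2)%MS.
Proof.
apply/andP; split; apply/rV_subP => v.
  rewrite sub_capmx => /andP[/sub_symmx2P v12 /sub_kermxP vtr].
  apply: (@sub_by_scaling _ _ _ (zr 6%coq_Z)); first exact: zr_nat_neq0.
  have tr : \sum_(a <- iota 0 3) fv v [:: a; a] = 0.
    by rewrite -(vx_contr v [tuple]) vtr /vx mxE.
  apply/vxP => J; rewrite fv_pmx.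
  have -> : vx (zr 6%coq_Z *: v) J = zr 6%coq_Z * fv v (vals J).
    by rewrite fv_vals /vx mxE.
  have /codesS[i [J1 [-> i3 /codesS[j [J2 [-> j3]]]]]] := vals_codes J.
  rewrite inE => /eqP ->.
  pose f a b := fv v [:: a; b].
  have TE i' j' : i' \in iota 0 3 -> j' \in iota 0 3 ->
     \sum_(a <- iota 0 3) \sum_(b <- iota 0 3) f a b * (zr (dl a i') * zr (dl b j')) = f i' j'.
    move=> i'3 j'3; rewrite -(sum_dl3 (fun a => f a j') i'3); apply: eq_bigr => a _.
    rewrite -(sum_dl3 (f a) j'3) mulr_suml; apply: eq_bigr => b _; ring.
  have trE : \sum_(a <- iota 0 3) \sum_(b <- iota 0 3) f a b * zr (dl a b) = 0.
    rewrite -[RHS]tr; apply: eq_big_seq => a a3; exact: (sum_dl3' (f a)).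
  transitivity (zr 3%coq_Z * (\sum_(a <- iota 0 3) \sum_(b <- iota 0 3)
        f a b * (zr (dl a i) * zr (dl b j)))
      + zr 3%coq_Z * (\sum_(a <- iota 0 3) \sum_(b <- iota 0 3)
        f a b * (zr (dl a j) * zr (dl b i)))
      + - (zr 2%coq_Z * zr (dl i j))
        * (\sum_(a <- iota 0 3) \sum_(b <- iota 0 3) f a b * zr (dl a b))).
    rewrite !mulr_sumr -!big_split.
    rewrite sum_codesS; apply: eq_bigr => a _; rewrite sum_codesS !mulr_sumr -!big_split.
    apply: eq_bigr => b _; rewrite sum_codes0 [pA2 _ _]/(Z.sub _ _) zrB !(zrM, zrD) /f /=.
    ring.
  rewrite !TE // trE /f v12 (_ : zr 6%coq_Z = 6%:R) // (_ : zr 3%coq_Z = 3%:R) //.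
  by ring.
case/submxP => w ->; rewrite sub_capmx; apply/andP; split.
  apply/sub_symmx2P => i j; rewrite !fv_mul2; apply: eq_bigr => s _.
  by congr (_ * zr _); rewrite /pA2; cbn [nth]; rewrite (dlC (io 2 j) (io 2 i)); lia.
have chk : all (fun s => Z.eqb (pA2 s [:: 0; 0] + pA2 s [:: 1; 1] + pA2 s [:: 2; 2]) 0)%N (codes 3 2).
  by vm_compute.
apply/sub_kermxP/vxP => J; rewrite vx_contr (tuple0 J) [RHS]/vx mxE sum_iota3.
rewrite !fv_mul2 !inordK // -!big_split big_seq big1 // => s /(allP chk) /= /Z.eqb_spec e.
by rewrite -!mulrDr -!zrD e mulr0.
Qed.

(** Each of the six permuted terms of [pA3] multiplies a symmetric traceless tensor by 5, since its
    trace corrections vanish; hence the factor 30. *)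
Lemma harm3_proj : (harm R 3 3 == pmx 3 3 pA3)%MS.
Proof.
apply/andP; split; apply/rV_subP => v.
  rewrite sub_capmx => /andP[/sub_symmx3P [v12 v23] /sub_kermxP vtr].
  apply: (@sub_by_scaling _ _ _ (zr 30%coq_Z)); first exact: zr_nat_neq0.
  pose f a b c := fv v [:: a; b; c].
  have tr k : k \in iota 0 3 -> \sum_(a <- iota 0 3) f a a k = 0.
    rewrite mem_iota /= add0n => k3; have := vx_contr v [tuple (inord k : 'I_3)].
    by rewrite vtr /vx mxE /vals /= inordK // => <-.
  apply/vxP => J; rewrite fv_pmx sum_codes3.
  have -> : vx (zr 30%coq_Z *: v) J = zr 30%coq_Z * fv v (vals J).
    by rewrite fv_vals /vx mxE.
  have /codesS[i [J1 [-> i3 /codesS[j [J2 [-> j3 /codesS[k [J' [-> k3]]]]]]]]] := vals_codes J.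
  rewrite inE => /eqP ->.
  have f12 a b c : f b a c = f a b c by exact: v12.
  have f23 a b c : f a c b = f a b c by exact: v23.
  pose S (h : nat -> nat -> nat -> R) :=
    \sum_(a <- iota 0 3) \sum_(b <- iota 0 3) \sum_(c <- iota 0 3) h a b c.
  have trE z : z \in iota 0 3 -> S (fun a b c => f a b c * (zr (dl a b) * zr (dl c z))) = 0.
    move=> z3; rewrite -[RHS](tr z z3); apply: eq_big_seq => a a3.
    rewrite -(sum_dl3' (fun b => f a b z) a3); apply: eq_bigr => b _.
    rewrite -(sum_dl3 (f a b) z3) mulr_suml; apply: eq_bigr => c _; ring.
  (* Only the contraction of the first two slots is known to vanish; symmetry carries it to the
     other two pairs of slots. *)
  have trE2 z : z \in iota 0 3 -> S (fun a b c => f a b c * (zr (dl a c) * zr (dl b z))) = 0.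
    move=> z3; rewrite -[RHS](trE z z3); apply: eq_bigr => a _; rewrite exchange_big.
    by apply: eq_bigr => c _; apply: eq_bigr => b _; rewrite f23.
  have trE3 z : z \in iota 0 3 -> S (fun a b c => f a b c * (zr (dl b c) * zr (dl a z))) = 0.
    move=> z3; rewrite -[RHS](trE2 z z3) /S exchange_big; apply: eq_bigr => b _.
    by apply: eq_bigr => a _; apply: eq_bigr => c _; rewrite f12.
  pose T x y z := S (fun a b c => f a b c * zr (P3term a b c x y z)).
  have TE x y z : x \in iota 0 3 -> y \in iota 0 3 -> z \in iota 0 3 ->
      T x y z = zr 5%coq_Z * f x y z.
    move=> x3 y3 z3.
    transitivity (zr 5%coq_Z * S (fun a b c => f a b c * (zr (dl a x) * (zr (dl b y) * zr (dl c z))))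
      + (- zr (dl x y)) * S (fun a b c => f a b c * (zr (dl a b) * zr (dl c z)))
      + (- zr (dl x y)) * S (fun a b c => f a b c * (zr (dl a c) * zr (dl b z)))
      + (- zr (dl x y)) * S (fun a b c => f a b c * (zr (dl b c) * zr (dl a z)))); last first.
      by rewrite trE // trE2 // trE3 // /S sum_dl_triple //; ring.
    rewrite /T /S !mulr_sumr -!big_split; apply: eq_bigr => a _.
    rewrite !mulr_sumr -!big_split; apply: eq_bigr => b _.
    rewrite !mulr_sumr -!big_split; apply: eq_bigr => c _ /=.
    by rewrite /P3term zrB !(zrM, zrD); ring.
  transitivity (T i j k + T i k j + T j i k + T j k i + T k i j + T k j i).
    rewrite /T /S -!big_split; apply: eq_bigr => a _; rewrite -!big_split; apply: eq_bigr => b _.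
    rewrite -!big_split; apply: eq_bigr => c _ /=.
    by rewrite /pA3 /P3 !zrD /f; ring.
  rewrite !TE // (f12 j k i) (f12 i k j) (f23 j i k) (f12 i j k) (f23 i j k) (_ : zr 5%coq_Z = 5%:R) //.
  rewrite (_ : zr 30%coq_Z = 30%:R) // /f.
  by ring.
case/submxP => w ->; rewrite sub_capmx; apply/andP; split.
  by apply/sub_symmx3P; split=> i j k; rewrite !fv_mul3; apply: eq_bigr => s _;
    congr (_ * zr _); rewrite /pA3 /P3 /=; lia.
have chk : all (fun s => all (fun k => Z.eqb (pA3 s [:: 0; 0; k] + pA3 s [:: 1; 1; k]
    + pA3 s [:: 2; 2; k]) 0) (iota 0 3))%N (codes 3 3).
  by vm_compute.
apply/sub_kermxP/vxP => J; rewrite vx_contr [RHS]/vx mxE sum_iota3.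
have /codesS[k [J' [-> k3]]] := vals_codes J; rewrite inE => /eqP ->.
rewrite !fv_mul3 !inordK //; last by move: k3; rewrite mem_iota.
rewrite -!big_split big_seq big1 // => s /(allP chk) /allP /(_ k k3) /= /Z.eqb_spec e.
by rewrite -!mulrDr -!zrD e mulr0.
Qed.

End Harmonic.

(** * Summands of tensor type, and candidate sections *)

Section Leaves.
Variable R : realType.
Local Notation zr := (zr R).
Local Notation kr := (kr R).

Definition kron (X1 Y1 X2 Y2 : finType) (M1 : 'M[R]_(#|X1|, #|Y1|)) (M2 : 'M[R]_(#|X2|, #|Y2|)) :=
  mkmx (fun (x : (X1 * X2)%type) (y : (Y1 * Y2)%type) => emx M1 x.1 y.1 * emx M2 x.2 y.2).

Lemma emx_mulmx (X Y Z : finType) (M : 'M[R]_(#|X|, #|Y|)) (N : 'M[R]_(#|Y|, #|Z|)) x z :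
  emx (M *m N) x z = \sum_y emx M x y * emx N y z.
Proof. by rewrite -[M in LHS]mkmx_emx -[N in LHS]mkmx_emx mkmxM emx_mkmx. Qed.

Lemma kronM (X1 Y1 Z1 X2 Y2 Z2 : finType)
    (M1 : 'M[R]_(#|X1|, #|Y1|)) (N1 : 'M[R]_(#|Y1|, #|Z1|))
    (M2 : 'M[R]_(#|X2|, #|Y2|)) (N2 : 'M[R]_(#|Y2|, #|Z2|)) :
  kron (M1 *m N1) (M2 *m N2) = kron M1 M2 *m kron N1 N2.
Proof.
rewrite mkmxM; apply: eq_mkmx => -[x1 x2] [z1 z2] /=.
rewrite !emx_mulmx big_distrlr /= pair_bigA.
apply: eq_bigr => -[y1 y2] _ /=; ring.
Qed.

Lemma kron_sub (X1 X2 : finType) (M1 N1 : 'M[R]_#|X1|) (M2 N2 : 'M[R]_#|X2|) :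
  (M1 <= N1)%MS -> (M2 <= N2)%MS -> (kron M1 M2 <= kron N1 N2)%MS.
Proof. by case/submxP=> W1 -> /submxP[W2 ->]; rewrite kronM submxMl. Qed.

Lemma kron_eqmx (X1 X2 : finType) (M1 N1 : 'M[R]_#|X1|) (M2 N2 : 'M[R]_#|X2|) :
  (M1 == N1)%MS -> (M2 == N2)%MS -> (kron M1 M2 == kron N1 N2)%MS.
Proof. by move=> /andP[? ?] /andP[? ?]; apply/andP; split; apply: kron_sub. Qed.

Local Notation pmx n k p :=
  (mkmx (fun I J : k.-tuple 'I_n => zr (p (vals I) (vals J)))).

Definition cdA e (y : ridx (Amod R e)) : code := (vals (y : (e./2).-tuple 'I_3), [::]).
Definition cdB n (y : ridx (Bmod R n)) : code := ([::], vals (y : n.-tuple 'I_2)).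
Definition cdT e n (y : ridx (mtens (Amod R e) (Bmod R n))) : code :=
  (vals (y.1 : (e./2).-tuple 'I_3), vals (y.2 : n.-tuple 'I_2)).

Lemma leaf_Amod e p : (harm R 3 e./2 == pmx 3 (e./2) p)%MS ->
  is_leaf (@cdA e) e./2 0 p pA0.
Proof.
move=> hp; split=> [F|y|A B y' y|].
- rewrite sum_ycodes (sum_vals 3 e./2 (fun s => F (s, [::]))).
  by apply: eq_bigr => s _; rewrite sum_codes0.
- by apply/allpairsP; exists (vals y, [::]); split => //=; apply: vals_codes.
- by rewrite /= prodn_nil mulr1; exact: emx_tpow.
- have -> : projmx (@cdA e) p pA0 = pmx 3 (e./2) p.
    by apply: eq_mkmx => I J; rewrite /pA0 /= mulr1.
  exact: hp.
Qed.

Lemma leaf_Bmod n q : (symmx R 2 n == pmx 2 n q)%MS ->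
  is_leaf (@cdB n) 0 n pA0 q.
Proof.
move=> hp; split=> [F|y|A B y' y|].
- by rewrite sum_ycodes (sum_vals 2 n (fun s => F ([::], s))) sum_codes0.
- by apply/allpairsP; exists ([::], vals y); split => //=; apply: vals_codes.
- by rewrite /= prodn_nil mul1r; exact: emx_tpow.
- have -> : projmx (@cdB n) pA0 q = pmx 2 n q.
    by apply: eq_mkmx => I J; rewrite /pA0 /= mul1r.
  exact: hp.
Qed.

Lemma leaf_mtens e n p q : (harm R 3 e./2 == pmx 3 (e./2) p)%MS -> (symmx R 2 n == pmx 2 n q)%MS ->
  is_leaf (@cdT e n) e./2 n p q.
Proof.
move=> hp hq; split=> [F|y|A B y' y|].
- rewrite sum_ycodes -(sum_vals 3 e./2 (fun s => \sum_(t <- codes 2 n) F (s, t))).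
  rewrite -(pair_bigA _ (fun I J => F (vals I, vals J))) /=.
  by apply: eq_bigr => I _; rewrite (sum_vals 2 n (fun t => F (vals I, t))).
- by apply/allpairsP; exists (vals y.1, vals y.2); split => //=; apply: vals_codes.
- rewrite /= emx_mkmx; congr (_ * _); exact: emx_tpow.
- have := kron_eqmx hp hq.
  have <- : projmx (@cdT e n) p q
      = kron (pmx 3 (e./2) p) (pmx 2 n q).
    by apply: eq_mkmx => y y'; rewrite !emx_mkmx.
  exact.
Qed.

(** The transpose of the antisymmetrized kernel. By Schur's lemma it is the natural candidate for a
    section of [phimx], up to scale, and its rows are again torsion tensors. *)
Definition psimx (M : rmod R) (cd : ridx M -> code) (k : kernel) : 'M[R]_(#|ridx M|, #|Xt|) :=
  mkmx (fun y x => kr (anti k (xcode x) (cd y))).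

Lemma swapK : involutive swap.
Proof. by case=> [[a b] c]. Qed.

Lemma anti_swap k x y : kr (anti k (swap x) y) = - kr (anti k x y).
Proof. by rewrite /anti swapK !krB; ring. Qed.

Lemma vx_phimx M cd k v y : (v <= TorS R)%MS ->
  vx (v *m @phimx R M cd k) y = lform triples (tens v) (anti k ^~ (cd y)).
Proof.
move=> /TorSP vA; rewrite vx_mulmx.
under eq_bigr do rewrite -tens_xcode.
rewrite (sum_triples (fun x => kr (k x (cd y))) vA); apply: eq_bigr => x _.
by rewrite krB.
Qed.

Lemma psimx_sub M cd k : (@psimx M cd k <= TorS R)%MS.
Proof.
apply/row_subP => i; apply/TorSP => x; rewrite /tens /vx !mxE !enum_rankK -anti_swap.
by case: x => [[a b] c]; rewrite /xcode /swap.
Qed.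

Lemma psi_phi M cd j n p q k M' cd' j' n' p' q' k' P :
  is_leaf cd j n p q -> is_leaf cd' j' n' p' q' ->
  pairing_check P (ktable triples (ycodes j n) k) (ktable triples (ycodes j' n') k') ->
  @psimx M cd k *m @phimx R M' cd' k' = mkmx (fun y y' => kr (P (cd y) (cd' y'))).
Proof.
move=> [_ inM _ _] [_ inM' _ _] chk; rewrite mkmxM; apply: eq_mkmx => y y'.
rewrite -(pairing_checkP R chk (inM y) (inM' y')).
rewrite (sum_triples (fun x => kr (k' x (cd' y'))) (fun x => anti_swap k x (cd y))).
by apply: eq_bigr => x _; rewrite [X in _ = _ * X]krB.
Qed.

Lemma leaf_image M cd j n p q k c (v : 'rV[R]_#|Xt|) : @is_leaf R M cd j n p q ->
  image_check triples (ycodes j n) (pten p q 1%coq_Z) c k -> (v <= TorS R)%MS ->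
  v *m phimx cd k *m projmx cd p q = zr c *: (v *m phimx cd k).
Proof.
move=> [sumM inM _ _] chk vT; apply/vxP => y; rewrite vx_mulmx.
have -> : vx (zr c *: (v *m phimx cd k)) y = zr c * vx (v *m phimx cd k) y by rewrite /vx mxE.
rewrite vx_phimx // -(image_checkP chk _ (inM y)).
rewrite -(sumM (fun s => lform triples (tens v) (anti k ^~ s) * kr (pten p q 1%coq_Z s (cd y)))).
by apply: eq_bigr => y' _; rewrite vx_phimx // kr_int !zrM mul1r.
Qed.

End Leaves.

(** * Direct sums of equivariant surjections *)

Section DirectSums.
Variable R : realType.
Local Notation zr := (zr R).
Local Notation kr := (kr R).
Implicit Types X Y : finType.

Definition hcat m X Y (f : 'M[R]_(m, #|X|)) (g : 'M[R]_(m, #|Y|)) :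
    'M[R]_(m, #|((X + Y)%type : finType)|) :=
  \matrix_(i, j) match enum_val j with
                 | inl a => f i (enum_rank a) | inr b => g i (enum_rank b) end.

Definition vcat m X Y (f : 'M[R]_(#|X|, m)) (g : 'M[R]_(#|Y|, m)) :
    'M[R]_(#|((X + Y)%type : finType)|, m) :=
  \matrix_(i, j) match enum_val i with
                 | inl a => f (enum_rank a) j | inr b => g (enum_rank b) j end.

Definition bdiag X Y (M : 'M[R]_#|X|) (N : 'M[R]_#|Y|) :
    'M[R]_#|((X + Y)%type : finType)| := mkmx (sumf (emx M) (emx N)).

Lemma mul_hcat l m X Y (N : 'M[R]_(l, m)) (f : 'M_(m, #|X|)) (g : 'M_(m, #|Y|)) :
  N *m hcat f g = hcat (N *m f) (N *m g).
Proof.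
apply/matrixP => i j; rewrite !mxE; case E: (enum_val j) => [a|b]; rewrite mxE;
  by apply: eq_bigr => k _; rewrite mxE E.
Qed.

Lemma hcat_eq0 m X Y (f : 'M[R]_(m, #|X|)) (g : 'M_(m, #|Y|)) :
  hcat f g = 0 <-> f = 0 /\ g = 0.
Proof.
split=> [/matrixP e|[-> ->]]; last by apply/matrixP => i j; rewrite !mxE; case: enum_val => ?; rewrite mxE.
split; apply/matrixP => i j.
  by have := e i (enum_rank (inl (enum_val j))); rewrite !mxE enum_rankK enum_valK.
by have := e i (enum_rank (inr (enum_val j))); rewrite !mxE enum_rankK enum_valK.
Qed.

Lemma hcat_bdiag m X Y (f : 'M[R]_(m, #|X|)) (g : 'M_(m, #|Y|)) M N :
  hcat f g *m bdiag M N = hcat (f *m M) (g *m N).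
Proof.
apply/matrixP => i j; rewrite !mxE.
under eq_bigr do rewrite !mxE.
rewrite (sum_enum_val (fun k => match k with inl a => f i (enum_rank a) | inr b => g i (enum_rank b) end
   * sumf (emx M) (emx N) k (enum_val j))) big_sumType /=.
case: (enum_val j) => [a|b]; rewrite mxE.
  rewrite [X in _ + X]big1 ?addr0 => [|b _]; last by rewrite mulr0.
  rewrite -sum_enum_val; apply: eq_bigr => k _; by rewrite /emx enum_valK.
rewrite [X in X + _]big1 ?add0r => [|a _]; last by rewrite mulr0.
rewrite -sum_enum_val; apply: eq_bigr => k _; by rewrite /emx enum_valK.
Qed.

Lemma bdiag_hcat X Y (M : 'M[R]_#|X|) (N : 'M_#|Y|) :
  bdiag M N = vcat (hcat M 0) (hcat 0 N).
Proof.
apply/matrixP => i j; rewrite !mxE; case: (enum_val i) => x; rewrite mxE;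
  case: (enum_val j) => y; by rewrite ?mxE.
Qed.

Lemma mul_vcat l m X Y (f : 'M[R]_(#|X|, l)) (g : 'M_(#|Y|, l)) (N : 'M[R]_(l, m)) :
  vcat f g *m N = vcat (f *m N) (g *m N).
Proof.
apply/matrixP => i j; rewrite !mxE; case E: (enum_val i) => [a|b]; rewrite mxE;
  by apply: eq_bigr => k _; rewrite mxE E.
Qed.

Lemma vcat_sub m l X Y (f : 'M[R]_(#|X|, m)) (g : 'M_(#|Y|, m)) (N : 'M[R]_(l, m)) :
  (f <= N)%MS -> (g <= N)%MS -> (vcat f g <= N)%MS.
Proof.
move=> fN gN; apply/row_subP => i; case E: (enum_val i) => [a|b].
  have -> : row i (vcat f g) = row (enum_rank a) f by apply/rowP => j; rewrite !mxE E.
  by rewrite (submx_trans (row_sub _ _)).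
have -> : row i (vcat f g) = row (enum_rank b) g by apply/rowP => j; rewrite !mxE E.
by rewrite (submx_trans (row_sub _ _)).
Qed.

(** Surjectivity onto M is recorded through an explicit section [psi] into the torsion space. This
    makes it additive: once the cross terms [psi1 *m phi2] and [psi2 *m phi1] vanish, stacking the
    sections gives a section of the sum. *)
Definition goodmap (G : 'M[R]_3 -> 'M[R]_2 -> Prop) (M : rmod R)
    (phi : 'M[R]_(#|Xt|, #|ridx M|)) (psi : 'M[R]_(#|ridx M|, #|Xt|)) : Prop :=
  [/\ forall A B, G A B -> rhoT A B *m phi = phi *m ract M A B,
      forall v : 'rV[R]_#|Xt|, (v <= TorS R)%MS -> (v *m phi <= rsub M)%MS,
      (psi <= TorS R)%MS & rsub M *m (psi *m phi) = rsub M].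

Lemma good_msum G (M1 M2 : rmod R) phi1 psi1 phi2 psi2 :
  goodmap G (M := M1) phi1 psi1 -> goodmap G (M := M2) phi2 psi2 ->
  psi1 *m phi2 = 0 -> psi2 *m phi1 = 0 ->
  goodmap G (M := msum M1 M2) (hcat phi1 phi2) (vcat psi1 psi2).
Proof.
move=> [e1 i1 s1 r1] [e2 i2 s2 r2] z12 z21; split.
- move=> A B gAB; rewrite mul_hcat e1 // e2 //.
  by rewrite (hcat_bdiag _ _ (ract M1 A B) (ract M2 A B)).
- move=> v vT; rewrite mul_hcat.
  have /submxP[w1 ->] := i1 v vT; have /submxP[w2 ->] := i2 v vT.
  by rewrite -(hcat_bdiag _ _ (rsub M1) (rsub M2)) submxMl.
- exact: vcat_sub.
- rewrite -[rsub (msum M1 M2)]/(bdiag (rsub M1) (rsub M2)) mul_vcat !mul_hcat z12 z21.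
  by rewrite -bdiag_hcat {1}bdiag_hcat mul_vcat !hcat_bdiag !mul0mx r1 r2 bdiag_hcat.
Qed.

(** Here c1 is the factor by which the scaled projector P exceeds a projector, and c2 the Schur
    constant in [psi phi = c2 P]; on the row space of P the composite is then c1 c2, which the
    section divides out. *)
Lemma leaf_good G M cd j n p q k k' c1 c2 : @is_leaf R M cd j n p q ->
  (forall A B, G A B -> rhoT A B *m phimx cd k = phimx cd k *m ract M A B) ->
  image_check triples (ycodes j n) (pten p q 1%coq_Z) (Zpos c1) k ->
  pairing_check (pten p q (Zpos c2)) (ktable triples (ycodes j n) k') (ktable triples (ycodes j n) k) ->
  goodmap G (phimx cd k) ((zr (Zpos c1) * zr (Zpos c2))^-1 *: psimx cd k').
Proof.
move=> lf eqv img prd.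
have [_ _ _ /andP[sub1 sub2]] := lf.
have n1 := zr_nat_neq0 R c1; have n2 := zr_nat_neq0 R c2.
have pp : psimx cd k' *m phimx cd k = zr (Zpos c2) *: projmx cd p q.
  rewrite (psi_phi lf lf prd) mkmxZ; apply: eq_mkmx => y y'.
  by rewrite /pten kr_int !zrM.
(* That P^2 = c1 P needs no certificate of its own: the rows of psi are torsion tensors, so c2 P^2 =
   psi phi P = c1 psi phi = c1 c2 P. *)
have pr2 : projmx cd p q *m projmx cd p q = zr (Zpos c1) *: projmx cd p q.
  apply: (scalerI n2); rewrite scalerA mulrC -scalerA scalemxAl -pp.
  apply/row_matrixP => i; rewrite 2!row_mul linearZ /= row_mul.
  by rewrite (leaf_image lf img) // (submx_trans (row_sub _ _)) // psimx_sub.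
split => //.
- move=> v vT; apply: submx_trans sub2.
  have e := leaf_image lf img vT.
  by apply: (@submx_trans _ _ _ _ _ _ (zr (Zpos c1) *: (v *m phimx cd k)));
    [rewrite (eqmx_scale _ n1) | rewrite -e submxMl].
- by rewrite scalemx_sub // psimx_sub.
- rewrite -scalemxAl pp scalerA -scalemxAr.
  have /submxP[W ->] := sub1; rewrite -mulmxA pr2 -scalemxAr scalerA.
  by rewrite -mulrA [X in _ * X]mulrC mulVf ?mulf_neq0 // scale1r.
Qed.

Lemma good_qiso G (M : rmod R) phi psi r (N : 'M[R]_(r, #|Xt|)) : goodmap G (M := M) phi psi ->
  (forall v : 'rV[R]_#|Xt|, (v <= TorS R)%MS -> (v *m phi = 0 <-> (v <= N)%MS)) ->
  qiso (TorS R) N (@rhoT R) G M.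
Proof.
move=> [eqv img sec onto] ker; exists phi; split; last split.
- apply/andP; split.
    by apply/row_subP => i; rewrite row_mul img // row_sub.
  by rewrite -onto mulmxA submxMr // (submx_trans _ sec) // submxMl.
- by move=> v vT; apply/eqP/idP => /(ker v vT).
- by move=> A B gAB v vT; rewrite -mulmxA eqv // mulmxA.
Qed.

End DirectSums.

(** * Exterior derivatives *)

Section ExteriorDerivative.
Variable R : realType.
Local Notation zr := (zr R).
Local Notation kr := (kr R).

Lemma vals_rest k (J : k.-tuple 'I_6) (p q : 'I_k) :
  map val (rest J p q) = [seq nth 0%N (vals J) r | r <- iota 0 k & (r != p :> nat) && (r != q :> nat)].
Proof.
rewrite /rest -val_enum_ord filter_map -!map_comp /preim.
rewrite (eq_filter (a2 := fun r : 'I_k => (r != p :> nat) && (r != q :> nat)));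
  last by move=> r; rewrite /= !val_eqE.
by apply: eq_map => r /=; rewrite (nth_vals J).
Qed.

Definition coded (al : seq 'I_6 -> R) (alk : seq nat -> K) : Prop :=
  forall s, al s = kr (alk (map val s)).

Lemma mem_codesS n k i s : i \in iota 0 n -> s \in codes n k -> i :: s \in codes n k.+1.
Proof. by move=> i_n s_k; apply/allpairsP; exists (i, s). Qed.

Definition dterm (alk : seq nat -> K) (s : seq nat) (x : triple) (p q : nat) : R :=
  if (p < q)%N then
    (-1) ^+ (p + q)%N * ((nth 0%N s p == x.1.1) && (nth 0%N s q == x.1.2))%:R
    * kr (alk (x.2 :: [seq nth 0%N s r | r <- iota 0 (size s) & (r != p) && (r != q)]))
  else 0.

Lemma Lmat_entry k al alk (x : Xt) (J : k.+1.-tuple 'I_6) : coded al alk ->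
  emx (Lmat k al) x J
  = - \sum_(p <- iota 0 k.+1) \sum_(q <- iota 0 k.+1) dterm alk (vals J) (xcode x) p q.
Proof.
move=> alE; rewrite emx_mkmx; congr (- _).
rewrite -(sum_ord_nat k.+1 (fun p => \sum_(q <- iota 0 k.+1) dterm alk (vals J) (xcode x) p q)).
apply: eq_bigr => p _; rewrite -(sum_ord_nat k.+1 (dterm alk (vals J) (xcode x) p)).
rewrite big_mkcond; apply: eq_bigr => q _; rewrite /dterm; case: ifP => // pq.
by rewrite alE /= vals_rest size_vals !nth_vals !val_eqE.
Qed.

Lemma Lmat2E al alk : coded al alk ->
  Lmat 2 al = mkmx (fun x J => kr (L2 alk (xcode x) (vals J, [::]))).
Proof.
move=> alE; rewrite -[LHS]mkmx_emx; apply: eq_mkmx => -[[a b] c] J; rewrite (Lmat_entry _ _ alE) /dterm.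
case/tupleP: J => i J; case/tupleP: J => j J; case/tupleP: J => l J; rewrite (tuple0 J).
rewrite /L2 /xcode /= !big_cons !big_nil /= !val_eqE !krD.
by do 3 case: (_ && _); rewrite ?krN ?kr_int /=; ring.
Qed.

Lemma Lmat3E al alk : coded al alk ->
  Lmat 3 al = mkmx (fun x J => kr (L3 alk (xcode x) (vals J, [::]))).
Proof.
move=> alE; rewrite -[LHS]mkmx_emx; apply: eq_mkmx => -[[a b] c] J; rewrite (Lmat_entry _ _ alE) /dterm.
case/tupleP: J => i J; case/tupleP: J => j J; case/tupleP: J => l J; case/tupleP: J => m J.
rewrite (tuple0 J) /L3 /xcode /= !big_cons !big_nil /= !val_eqE !krD.
by do 6 case: (_ && _); rewrite ?krN ?kr_int /=; ring.
Qed.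

(** An alternating function is determined by its values on increasing indices: sort the smallest
    index to the front, then the rest. Repeated indices give zero because 2 is invertible. *)
Lemma alt3_zero (f : nat -> nat -> nat -> R) n :
  (forall a b c, f b a c = - f a b c) -> (forall a b c, f a c b = - f a b c) ->
  (forall a b c, (a < b < c)%N -> (c < n)%N -> f a b c = 0) ->
  forall a b c, (a < n)%N -> (b < n)%N -> (c < n)%N -> f a b c = 0.
Proof.
move=> f12 f23 f0.
have eq0 (x : R) : x = - x -> x = 0 by move=> e; lra.
have step1 a b c : (a < b)%N -> (a < c)%N -> (b < n)%N -> (c < n)%N -> f a b c = 0.
  move=> ab ac bn cn; case: (ltngtP b c) => bc.
  - by apply: f0; rewrite // ab.
  - by rewrite f23 f0 ?oppr0 // ac.
  - by rewrite bc; apply: eq0; rewrite -f23.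
have dup12 a c : f a a c = 0 by apply: eq0; exact: f12.
have dup13 a b : f a b a = 0 by rewrite f23 dup12 oppr0.
have min_first a b c : (a <= b)%N -> (a <= c)%N -> (b < n)%N -> (c < n)%N -> f a b c = 0.
  move=> + + bn cn; case: (ltngtP a b) => // [ab|<-] _; last by rewrite dup12.
  by case: (ltngtP a c) => // [ac|<-] _; [exact: step1 | rewrite dup13].
move=> a b c an bn cn; have [ab|/ltnW ba] := leqP a b.
  have [ac|/ltnW ca] := leqP a c; first exact: min_first.
  by rewrite f23 f12 opprK min_first // (leq_trans ca).
rewrite f12 [f b a c](_ : _ = 0) ?oppr0 //.
have [bc|/ltnW cb] := leqP b c; first exact: min_first.
by rewrite f23 f12 opprK min_first // (leq_trans cb).
Qed.

Lemma alt4_zero (f : nat -> nat -> nat -> nat -> R) n :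
  (forall a b c d, f b a c d = - f a b c d) -> (forall a b c d, f a c b d = - f a b c d) ->
  (forall a b c d, f a b d c = - f a b c d) ->
  (forall a b c d, (a < b)%N -> (b < c)%N -> (c < d)%N -> (d < n)%N -> f a b c d = 0) ->
  forall a b c d, (a < n)%N -> (b < n)%N -> (c < n)%N -> (d < n)%N -> f a b c d = 0.
Proof.
move=> f12 f23 f34 f0.
have eq0 (x : R) : x = - x -> x = 0 by move=> e; lra.
have step1 a : forall b c d, (a < b)%N -> (a < c)%N -> (a < d)%N ->
    (b < n)%N -> (c < n)%N -> (d < n)%N -> f a b c d = 0.
  (* With a fixed as the strict minimum, f restricted to larger indices and extended by zero is
     alternating in three variables, so the previous lemma applies. *)
  pose g b c d := if [&& a < b, a < c & a < d]%N then f a b c d else 0.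
  have g0 : forall b c d, (b < n)%N -> (c < n)%N -> (d < n)%N -> g b c d = 0.
    apply: alt3_zero => b c d; rewrite /g.
    - rewrite andbCA; case: ifP; rewrite ?oppr0 // => _; exact: f23.
    - rewrite [X in _ && X]andbC; case: ifP; rewrite ?oppr0 // => _; exact: f34.
    - move=> /andP[bc cd] dn; case: ifP => // /and3P[ab _ _]; exact: f0.
  move=> b c d ab ac ad bn cn dn; have := g0 b c d bn cn dn.
  by rewrite /g ab ac ad.
have dup12 a c d : f a a c d = 0 by apply: eq0; exact: f12.
have min_first a b c d : (a <= b)%N -> (a <= c)%N -> (a <= d)%N ->
    (a < n)%N -> (b < n)%N -> (c < n)%N -> (d < n)%N -> f a b c d = 0.
  move=> + + + an bn cn dn; case: (ltngtP a b) => // [ab|<-] _; last by rewrite dup12.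
  case: (ltngtP a c) => // [ac|<-] _; last by rewrite f23 dup12 oppr0.
  by case: (ltngtP a d) => // [ad|<-] _; [exact: step1 | rewrite f34 f23 opprK dup12].
move=> a b c d an bn cn dn.
have [ab|/ltnW ba] := leqP a b; have [cd|/ltnW dc] := leqP c d.
- have [ac|/ltnW ca] := leqP a c.
    by apply: min_first => //; apply: leq_trans cd.
  rewrite f23 f12 opprK; apply: min_first => //; exact: leq_trans ab.
- have [ad|/ltnW da] := leqP a d.
    by apply: min_first => //; apply: leq_trans dc.
  rewrite f34 f23 opprK f12; apply/eqP; rewrite oppr_eq0; apply/eqP.
  apply: min_first => //; exact: leq_trans ab.
- rewrite f12; apply/eqP; rewrite oppr_eq0; apply/eqP.
  have [bc|/ltnW cb] := leqP b c.
    by apply: min_first => //; apply: leq_trans cd.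
  rewrite f23 f12 opprK; apply: min_first => //; exact: leq_trans ba.
- rewrite f12; apply/eqP; rewrite oppr_eq0; apply/eqP.
  have [bd|/ltnW db] := leqP b d.
    by apply: min_first => //; apply: leq_trans dc.
  rewrite f34 f23 opprK f12; apply/eqP; rewrite oppr_eq0; apply/eqP.
  apply: min_first => //; exact: leq_trans ba.
Qed.

Section Alternation.
Variable t : triple -> R.
Hypothesis tA : forall x, t (swap x) = - t x.

Lemma sum_guard (i j : nat) (g : nat -> K) : (i < 6)%N -> (j < 6)%N ->
  \sum_(x : Xt) t (xcode x)
    * kr (if (i == (xcode x).1.1) && (j == (xcode x).1.2) then g (xcode x).2 else kint 0%coq_Z)
  = \sum_(c < 6) t (i, j, val c) * kr (g c).
Proof.
move=> i6 j6.
rewrite (sum_Xt (fun x => t x * kr (if (i == x.1.1) && (j == x.1.2) then g x.2 else kint 0%coq_Z))) /=.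
rewrite (bigD1 (Ordinal i6)) //= [X in _ + X]big1 ?addr0 => [|a]; last first.
  rewrite -val_eqE /= eq_sym => /negPf ai.
  by rewrite big1 // => b _; rewrite big1 // => c _; rewrite ai kr_int mulr0.
rewrite (bigD1 (Ordinal j6)) //= [X in _ + X]big1 ?addr0 => [|b]; last first.
  rewrite -val_eqE /= eq_sym => /negPf bj; rewrite big1 // => c _.
  by rewrite bj andbF kr_int mulr0.
by apply: eq_bigr => c _; rewrite !eqxx.
Qed.

(** This is al(Tor(e_i, e_j), e_k, e_l), one shuffle term of d al. *)
Definition pr3 (al : seq nat -> K) (i j k l : nat) : R :=
  \sum_(c < 6) t (i, j, val c) * kr (al [:: val c; k; l]).

Definition d3 (al : seq nat -> K) (i j k l : nat) : R :=
  \sum_(x : Xt) t (xcode x) * kr (L3 al (xcode x) ([:: i; j; k; l], [::])).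

Lemma d3E al i j k l : (i < 6)%N -> (j < 6)%N -> (k < 6)%N -> (l < 6)%N ->
  d3 al i j k l = pr3 al i j k l - pr3 al i k j l + pr3 al i l j k
                  + pr3 al j k i l - pr3 al j l i k + pr3 al k l i j.
Proof.
move=> i6 j6 k6 l6; rewrite /d3 /pr3.
rewrite -(sum_guard (fun c => al [:: c; k; l]) i6 j6) -(sum_guard (fun c => al [:: c; j; l]) i6 k6).
rewrite -(sum_guard (fun c => al [:: c; j; k]) i6 l6) -(sum_guard (fun c => al [:: c; i; l]) j6 k6).
rewrite -(sum_guard (fun c => al [:: c; i; k]) j6 l6) -(sum_guard (fun c => al [:: c; i; j]) k6 l6).
rewrite -!sumrN -!big_split; apply: eq_bigr => x _ /=.
rewrite !krD; do 6 (case: (_ && _)); rewrite ?krN ?kr_int; ring.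
Qed.

(** Each shuffle term is antisymmetric in its first pair because the torsion is, and in its last
    pair because the form is; so the six signed terms form an alternating function, and strictly
    increasing indices suffice. *)
Lemma d3_zero al : (forall a b c, kr (al [:: a; c; b]) = - kr (al [:: a; b; c])) ->
  (forall y, y \in increasing 4 -> lform triples t (anti (L3 al) ^~ y) = 0) ->
  forall i j k l, (i < 6)%N -> (j < 6)%N -> (k < 6)%N -> (l < 6)%N -> d3 al i j k l = 0.
Proof.
move=> alA inc.
have prA i j k l : pr3 al j i k l = - pr3 al i j k l.
  by rewrite /pr3 -sumrN; apply: eq_bigr => c _; rewrite -mulNr -tA.
have prB i j k l : pr3 al i j l k = - pr3 al i j k l.
  by rewrite /pr3 -sumrN; apply: eq_bigr => c _; rewrite alA mulrN.
pose f i j k l := pr3 al i j k l - pr3 al i k j l + pr3 al i l j k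
                  + pr3 al j k i l - pr3 al j l i k + pr3 al k l i j.
have f0 : forall i j k l, (i < 6)%N -> (j < 6)%N -> (k < 6)%N -> (l < 6)%N -> f i j k l = 0.
  apply: alt4_zero => a b c d; rewrite /f.
  - rewrite (prA a b) (prB c d a b); ring.
  - rewrite (prA b c a d) (prB a d b c); ring.
  - rewrite (prA c d a b) (prB a b c d); ring.
  move=> ab bc cd d6; have c6 := ltn_trans cd d6; have b6 := ltn_trans bc c6.
  have a6 := ltn_trans ab b6; rewrite -d3E //.
  rewrite -(inc ([:: a; b; c; d], [::])).
    rewrite /d3 (sum_triples (fun x => kr (L3 al x ([:: a; b; c; d], [::]))) tA).
    by apply: eq_bigr => x _; rewrite krB.
  apply/mapP; exists [:: a; b; c; d] => //; rewrite mem_filter; apply/andP; split.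
    by rewrite /= ab bc cd.
  by do 4 (apply: mem_codesS; first by rewrite mem_iota).
by move=> i j k l i6 j6 k6 l6; rewrite d3E //; apply: f0.
Qed.

Definition pr2 (al : seq nat -> K) (i j k : nat) : R :=
  \sum_(c < 6) t (i, j, val c) * kr (al [:: val c; k]).

Definition d2 (al : seq nat -> K) (i j k : nat) : R :=
  \sum_(x : Xt) t (xcode x) * kr (L2 al (xcode x) ([:: i; j; k], [::])).

Lemma d2E al i j k : (i < 6)%N -> (j < 6)%N -> (k < 6)%N ->
  d2 al i j k = pr2 al i j k - pr2 al i k j + pr2 al j k i.
Proof.
move=> i6 j6 k6; rewrite /d2 /pr2.
rewrite -(sum_guard (fun c => al [:: c; k]) i6 j6) -(sum_guard (fun c => al [:: c; j]) i6 k6).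
rewrite -(sum_guard (fun c => al [:: c; i]) j6 k6).
rewrite -!sumrN -!big_split; apply: eq_bigr => x _ /=.
rewrite !krD; do 3 (case: (_ && _)); rewrite ?krN ?kr_int; ring.
Qed.

Lemma d2_zero al :
  (forall y, y \in increasing 3 -> lform triples t (anti (L2 al) ^~ y) = 0) ->
  forall i j k, (i < 6)%N -> (j < 6)%N -> (k < 6)%N -> d2 al i j k = 0.
Proof.
move=> inc.
have prA i j k : pr2 al j i k = - pr2 al i j k.
  by rewrite /pr2 -sumrN; apply: eq_bigr => c _; rewrite -mulNr -tA.
pose f i j k := pr2 al i j k - pr2 al i k j + pr2 al j k i.
have f0 : forall i j k, (i < 6)%N -> (j < 6)%N -> (k < 6)%N -> f i j k = 0.
  apply: alt3_zero => a b c; rewrite /f.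
  - rewrite (prA a b); ring.
  - rewrite (prA b c a); ring.
  move=> /andP[ab bc] c6; have b6 := ltn_trans bc c6.
  have a6 := ltn_trans ab b6; rewrite -d2E //.
  rewrite -(inc ([:: a; b; c], [::])).
    rewrite /d2 (sum_triples (fun x => kr (L2 al x ([:: a; b; c], [::]))) tA).
    by apply: eq_bigr => x _; rewrite krB.
  apply/mapP; exists [:: a; b; c] => //; rewrite mem_filter; apply/andP; split.
    by rewrite /= ab bc.
  by do 3 (apply: mem_codesS; first by rewrite mem_iota).
by move=> i j k i6 j6 k6; rewrite d2E //; apply: f0.
Qed.

End Alternation.

Lemma increasing_codes k y : y \in increasing k -> exists J : k.-tuple 'I_6, y = (vals J, [::]).
Proof.
case/mapP=> s; rewrite mem_filter => /andP[_ sin] ->.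
suff [J ->] : exists J : k.-tuple 'I_6, s = vals J by exists J.
elim: k s sin => [|k IH] s; first by rewrite inE => /eqP ->; exists [tuple].
case/codesS=> i [s' [-> i6 /IH[J ->]]].
exists [tuple of (inord i : 'I_6) :: J]; rewrite /vals /= inordK //.
by move: i6; rewrite mem_iota.
Qed.

Lemma ker_Lmat3 al alk v : coded al alk ->
  (forall a b c, kr (alk [:: a; c; b]) = - kr (alk [:: a; b; c])) -> (v <= TorS R)%MS ->
  v *m Lmat 3 al = 0 <->
  (forall y, y \in increasing 4 -> lform triples (tens v) (anti (L3 alk) ^~ y) = 0).
Proof.
move=> alE alA /TorSP vA; rewrite (Lmat3E alE); split=> [v0 y /increasing_codes[J ->]|h].
  have := f_equal (fun w => vx w J) v0; rewrite vx_mulmx /vx mxE => <-.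
  rewrite (eq_bigr (fun x => tens v (xcode x) * kr (L3 alk (xcode x) (vals J, [::])))); last first.
    by move=> x _; rewrite tens_xcode.
  rewrite (sum_triples (fun x => kr (L3 alk x (vals J, [::]))) vA).
  by apply: eq_bigr => x _; rewrite krB.
apply/vxP => J; rewrite vx_mulmx [RHS]/vx mxE.
under eq_bigr do rewrite -tens_xcode.
have /codesS[i [J1 [-> i6 /codesS[j [J2 [-> j6 /codesS[k [J3 [-> k6
  /codesS[l [J4 [-> l6]]]]]]]]]]]] := vals_codes J.
rewrite inE => /eqP ->; move: i6 j6 k6 l6; rewrite !mem_iota /= !add0n.
exact: (d3_zero vA alA h).
Qed.

Lemma ker_Lmat2 al alk v : coded al alk -> (v <= TorS R)%MS ->
  v *m Lmat 2 al = 0 <->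
  (forall y, y \in increasing 3 -> lform triples (tens v) (anti (L2 alk) ^~ y) = 0).
Proof.
move=> alE /TorSP vA; rewrite (Lmat2E alE); split=> [v0 y /increasing_codes[J ->]|h].
  have := f_equal (fun w => vx w J) v0; rewrite vx_mulmx /vx mxE => <-.
  rewrite (eq_bigr (fun x => tens v (xcode x) * kr (L2 alk (xcode x) (vals J, [::])))); last first.
    by move=> x _; rewrite tens_xcode.
  rewrite (sum_triples (fun x => kr (L2 alk x (vals J, [::]))) vA).
  by apply: eq_bigr => x _; rewrite krB.
apply/vxP => J; rewrite vx_mulmx [RHS]/vx mxE.
under eq_bigr do rewrite -tens_xcode.
have /codesS[i [J1 [-> i6 /codesS[j [J2 [-> j6 /codesS[k [J3 [-> k6]]]]]]]]] := vals_codes J.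
rewrite inE => /eqP ->; move: i6 j6 k6; rewrite !mem_iota /= !add0n.
exact: (d2_zero vA h).
Qed.

End ExteriorDerivative.

(** * Coordinates of sigma, the eta_i and gamma_hat *)

Section Forms.
Variable R : realType.
Local Notation zr := (zr R).
Local Notation kr := (kr R).

Lemma kr_epk n (j : 'I_6) : ep R n j = kr (epk n j).
Proof. by rewrite /ep /epk kr_int zr_dl. Qed.

Lemma sigma_coded : coded (sigma R) sigmak.
Proof.
case=> [|a [|b [|c s]]]; rewrite /sigma /= ?addr0 ?kr_int //.
rewrite !kr_epk /epk !kr_int /= !(zrB, zrD, zrM) !zr_dl !eqSS; ring.
Qed.

Lemma wedge3_coded (f g h : 'I_6 -> R) (fk gk hk : nat -> K) :
  (forall j : 'I_6, f j = kr (fk j)) -> (forall j : 'I_6, g j = kr (gk j)) ->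
  (forall j : 'I_6, h j = kr (hk j)) -> coded (wedge3 f g h) (wedge3k fk gk hk).
Proof.
move=> fE gE hE; case=> [|a [|b [|c [|d s]]]]; rewrite /wedge3 /= ?kr_int //.
by rewrite det3 /mxn !mxE !inordK //= !fE !gE !hE !(krD, krM, krB); ring.
Qed.

Lemma ucs_coded (c s : K) i (j : 'I_6) : ucs (kr c) (kr s) i j = kr (ucsk c s i j).
Proof. by rewrite /ucs !kr_epk /ucsk krD !krM. Qed.

Lemma eta_coded (c s : K) : coded (eta_cs (kr c) (kr s)) (etak c s).
Proof. by apply: wedge3_coded => j; rewrite ucs_coded. Qed.

Lemma ep3_coded i j k : coded (wedge3 (ep R i) (ep R j) (ep R k)) (epk3 i j k).
Proof. by apply: wedge3_coded => l; rewrite kr_epk. Qed.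

Lemma gamma_hat_coded : coded (gamma_hat R) gammak.
Proof.
move=> s; rewrite /gamma_hat !ep3_coded /gammak /subf /E_ /addf.
by rewrite krB !krD.
Qed.

Definition Ef (k : nat) (s : seq 'I_6) : R := kr (E_ k (map val s)).

Lemma Ef_coded k : coded (Ef k) (E_ k).
Proof. by []. Qed.

Lemma gamma_hat_Ef s : gamma_hat R s = Ef 1 s - Ef 3 s.
Proof. by rewrite gamma_hat_coded /gammak /subf krB. Qed.

Lemma eta_Ef (c s : K) l : eta_cs (kr c) (kr s) l =
  kr c ^+ 3 * Ef 0 l + kr c ^+ 2 * kr s * Ef 1 l + kr c * kr s ^+ 2 * Ef 2 l + kr s ^+ 3 * Ef 3 l.
Proof.
rewrite eta_coded; case: l => [|x [|y [|z [|w l]]]];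
  rewrite /Ef /E_ /addf /epk3 /etak /wedge3k /= ?krD ?kr_int ?zr0; try ring.
rewrite !(krD, krM, krB); ring.
Qed.

(* Twice the cosine and sine of 0, 2 pi / 3 and - 2 pi / 3. *)
Definition cosk (i : nat) : K := if i is 0%N then kint 2%coq_Z else kint (-1)%coq_Z.
Definition sink (i : nat) : K :=
  match i with 0%N => kint 0%coq_Z | 1%N => (0, 1)%coq_Z | _ => (0, -1)%coq_Z end.

Lemma eta_half (c s : R) l : eta_cs (2^-1 * c) (2^-1 * s) l = 8^-1 * eta_cs c s l.
Proof.
case: l => [|x [|y [|z [|w l]]]]; rewrite /eta_cs /wedge3 ?mulr0 //.
rewrite !det3 /mxn !mxE !inordK //= /ucs.
have -> : 8^-1 = 2^-1 * 2^-1 * 2^-1 :> R by rewrite -!invfM -!natrM.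
ring.
Qed.

(** Doubling the cosine and sine clears denominators and brings the coefficients into Z[sqrt 3]; by
    trilinearity this costs a factor 8. *)
Lemma eta_scaled (i : 'I_3) l : eta_ R i l = 8^-1 * eta_cs (kr (cosk i)) (kr (sink i)) l.
Proof.
rewrite -eta_half; case: i => [[|[|[|i]]] hi] //; rewrite /eta_ /=; congr (eta_cs _ _ l);
  rewrite ?kr_int ?zr0 ?mulr0 //.
- by rewrite (_ : zr 2%coq_Z = 2%:R) // mulVf // pnatr_eq0.
- by rewrite (_ : zr (-1)%coq_Z = -1) // mulrN1 div1r.
- by rewrite /kr /= (_ : zr 1%coq_Z = 1) // zr0 add0r mul1r mulrC.
- by rewrite (_ : zr (-1)%coq_Z = -1) // mulrN1 div1r.
- by rewrite /kr /= (_ : zr (-1)%coq_Z = -1) // zr0 add0r mulN1r mulrN mulrC.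
Qed.

(** The derivative is linear in the form. Four terms are what an expansion in E_0, .., E_3 requires;
    shorter combinations are padded with zero coefficients. *)
Lemma Lmat_lin4 k (al : seq 'I_6 -> R) (be : nat -> seq 'I_6 -> R) (c : nat -> R) :
  (forall s, al s = c 0%N * be 0%N s + c 1%N * be 1%N s + c 2%N * be 2%N s + c 3%N * be 3%N s) ->
  Lmat k al = c 0%N *: Lmat k (be 0%N) + c 1%N *: Lmat k (be 1%N)
              + c 2%N *: Lmat k (be 2%N) + c 3%N *: Lmat k (be 3%N).
Proof.
move=> alE; apply/matrixP => i j; rewrite !mxE !mulrN -!opprD; congr (- _).
rewrite !mulr_sumr -!big_split; apply: eq_bigr => p _; rewrite !mulr_sumr -!big_split.
by apply: eq_bigr => q _; rewrite alE /=; ring.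
Qed.

Lemma wedge3k_alt f g h a b c :
  kr (wedge3k f g h [:: a; c; b]) = - kr (wedge3k f g h [:: a; b; c]).
Proof. by rewrite /wedge3k !(krD, krM, krB); ring. Qed.

Lemma E_alt k a b c : kr (E_ k [:: a; c; b]) = - kr (E_ k [:: a; b; c]).
Proof.
by case: k => [|[|[|k]]]; cbn [E_]; rewrite /addf /epk3 ?(krD, krM, krB); ring.
Qed.

Lemma gammak_alt a b c : kr (gammak [:: a; c; b]) = - kr (gammak [:: a; b; c]).
Proof. by rewrite /gammak /subf !krB !(E_alt _ a b c); ring. Qed.

Lemma etak_alt x y a b c : kr (etak x y [:: a; c; b]) = - kr (etak x y [:: a; b; c]).
Proof. exact: wedge3k_alt. Qed.

Lemma mul_Lmat_eta m (i : 'I_3) (v : 'M[R]_(m, #|Xt|)) :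
  v *m Lmat 3 (eta_ R i) = 8^-1 *: (v *m Lmat 3 (eta_cs (kr (cosk i)) (kr (sink i)))).
Proof.
rewrite scalemxAr; congr (_ *m _).
rewrite (@Lmat_lin4 3 (eta_ R i) (fun _ => eta_cs (kr (cosk i)) (kr (sink i)))
  (fun k => if k is 0%N then 8^-1 else 0)); last first.
  by move=> s; rewrite eta_scaled; ring.
by rewrite !scale0r !addr0.
Qed.

(** The first equation isolates x0. The sum of the next two then gives x2 = 0, and their difference
    gives x1 + 3 x3 = 0; the fourth equation x1 = x3, coming from gamma_hat, closes the system. *)
Lemma cubic_system m n (x0 x1 x2 x3 : 'M[R]_(m, n)) (r := Num.sqrt 3) :
  8^-1 *: (2 ^+ 3 *: x0 + (2 ^+ 2 * 0) *: x1 + (2 * 0 ^+ 2) *: x2 + 0 ^+ 3 *: x3) = 0 ->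
  8^-1 *: ((-1) ^+ 3 *: x0 + ((-1) ^+ 2 * r) *: x1 + (-1 * r ^+ 2) *: x2 + r ^+ 3 *: x3) = 0 ->
  8^-1 *: ((-1) ^+ 3 *: x0 + ((-1) ^+ 2 * - r) *: x1 + (-1 * (- r) ^+ 2) *: x2
           + (- r) ^+ 3 *: x3) = 0 ->
  x1 - x3 = 0 -> [/\ x0 = 0, x1 = 0, x2 = 0 & x3 = 0].
Proof.
have r0 : r != 0 by rewrite sqrtr_eq0 -ltNge ltr0n.
have r2 : r ^+ 2 = 3 by rewrite expr2 sqrt3M.
clearbody r; have r3 : r ^+ 3 = 3 * r by rewrite exprS r2 mulrC.
have nr2 : (- r) ^+ 2 = 3 by rewrite sqrrN.
have nr3 : (- r) ^+ 3 = - (3 * r) by rewrite exprNn r3 !exprS expr0; ring.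
rewrite nr3 nr2 r3 r2 => /matrixP e0 /matrixP e1 /matrixP e2 /matrixP g.
have key p q : [/\ x0 p q = 0, x1 p q = 0, x2 p q = 0 & x3 p q = 0].
  move: (e0 p q) (e1 p q) (e2 p q) (g p q); rewrite !mxE.
  move: (x0 p q) (x1 p q) (x2 p q) (x3 p q) => y0 y1 y2 y3 h0 h1 h2 h3.
  have k0 : 8 * y0 = 0 by rewrite -[RHS](mulr0 8) -[X in _ = _ * X]h0; field.
  have k1 : - y0 + r * y1 - 3 * y2 + 3 * (r * y3) = 0.
    by rewrite -[RHS](mulr0 8) -[X in _ = _ * X]h1; field.
  have k2 : - y0 - r * y1 - 3 * y2 - 3 * (r * y3) = 0.
    by rewrite -[RHS](mulr0 8) -[X in _ = _ * X]h2; field.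
  have z0 : y0 = 0 by lra.
  have z2 : y2 = 0 by lra.
  have z13 : y1 = y3 by lra.
  have : r * y3 = 0 by move: k1; rewrite z0 z2 z13; lra.
  move/eqP; rewrite mulf_eq0 (negPf r0) => /eqP z3.
  by rewrite z0 z2 z13 z3.
by split; apply/matrixP => p q; rewrite mxE; have [] := key p q.
Qed.

(* eta_0, eta_1, eta_2, gamma_hat and E_0, .., E_3 are two bases of the same space of forms. *)
Lemma ker_etas_gamma (v : 'rV[R]_#|Xt|) :
  (forall i : 'I_3, v *m Lmat 3 (eta_ R i) = 0) /\ v *m Lmat 3 (gamma_hat R) = 0 <->
  (forall k, (k < 4)%N -> v *m Lmat 3 (Ef k) = 0).
Proof.
have gE : Lmat 3 (gamma_hat R) = Lmat 3 (Ef 1) - Lmat 3 (Ef 3).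
  rewrite (@Lmat_lin4 3 _ Ef (fun k => nth 0 [:: 0; 1; 0; -1] k)) /=.
    by rewrite !scale0r add0r addr0 scale1r scaleN1r.
  by move=> s; rewrite gamma_hat_Ef; ring.
have eE i : v *m Lmat 3 (eta_ R i) = 8^-1 *: (kr (cosk i) ^+ 3 *: (v *m Lmat 3 (Ef 0))
    + (kr (cosk i) ^+ 2 * kr (sink i)) *: (v *m Lmat 3 (Ef 1))
    + (kr (cosk i) * kr (sink i) ^+ 2) *: (v *m Lmat 3 (Ef 2))
    + kr (sink i) ^+ 3 *: (v *m Lmat 3 (Ef 3))).
  rewrite mul_Lmat_eta; congr (_ *: _).
  rewrite (@Lmat_lin4 3 _ Ef (fun k => nth 0 [:: kr (cosk i) ^+ 3; kr (cosk i) ^+ 2 * kr (sink i);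
     kr (cosk i) * kr (sink i) ^+ 2; kr (sink i) ^+ 3] k)) /=.
    by rewrite !mulmxDr -!scalemxAr.
  by move=> s; rewrite eta_Ef.
split=> [[e g]|h]; last first.
  by split=> [i|]; rewrite ?eE ?gE ?mulmxBr !h // ?subrr // !scaler0 !addr0 scaler0.
have cos0 : kr (cosk 0) = 2 by rewrite kr_int.
have sin0 : kr (sink 0) = 0 by rewrite kr_int.
have cos1 : kr (cosk 1) = -1 by rewrite kr_int.
have cos2 : kr (cosk 2) = -1 by rewrite kr_int.
have sin1 : kr (sink 1) = Num.sqrt 3 by rewrite /kr /= (_ : zr 1%coq_Z = 1) // zr0 add0r mul1r.
have sin2 : kr (sink 2) = - Num.sqrt 3 by rewrite /kr /= (_ : zr (-1)%coq_Z = -1) // zr0 add0r mulN1r.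
move: (e ord0) (e (inord 1)) (e (inord 2)); rewrite !eE !inordK // [nat_of_ord ord0]/=.
rewrite cos0 cos1 ?cos2 sin0 sin1 sin2; rewrite gE mulmxBr in g.
move=> e0 e1 e2; have [x0 x1 x2 x3] := cubic_system e0 e1 e2 g.
by case=> [|[|[|[|k]]]].
Qed.

End Forms.

(** * The modules of the theorem *)

Definition tabw (l : seq Z) : wfun := fun p q r _ => kint (nth 0%coq_Z l (4 * p + 2 * q + r)).
(* [uk i] is the covector of eta_i on W (doubled) and [nk i] its rotation by a right angle. *)
Definition uk (i p : nat) : K := if p is 0%N then cosk i else sink i.
Definition nk (i p : nat) : K := if p is 0%N then kopp (sink i) else cosk i.
Definition k3 (f g h : nat -> K) : wfun := fun p q r _ => kmul (f p) (kmul (g q) (h r)).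
Definition wnnu i := k3 (nk i) (nk i) (uk i).
Definition wnuu i := k3 (nk i) (uk i) (uk i).
(* Dual to [wnnu i] and [wnuu i]: they pair to zero with [wnnu j] and [wnuu j] for j != i. *)
Definition wnnu_dual i : wfun := fun p q r y =>
  kadd (kscale (-3)%coq_Z (k3 (uk i) (uk i) (uk i) p q r y))
 (kadd (kscale 3%coq_Z (wnnu i p q r y)) (kscale (-2)%coq_Z (k3 (nk i) (uk i) (nk i) p q r y))).
Definition wnuu_dual i : wfun := fun p q r y =>
  kadd (kopp (k3 (nk i) (nk i) (nk i) p q r y))
 (kadd (kscale 2%coq_Z (wnuu i p q r y)) (k3 (uk i) (uk i) (nk i) p q r y)).

(** Put w = e_0 + i e_1 with conjugate w'. Then [wg] and [wg3] are the imaginary and real parts of w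
    (x) w (x) w, and [wg1] and [wg2] the real and imaginary parts of w (x) w' (x) w. *)
Definition wg := tabw [:: 0; 1; 1; 0; 1; 0; 0; -1]%coq_Z.
Definition wg1 := tabw [:: 1; 0; 0; 1; 0; -1; 1; 0]%coq_Z.
Definition wg2 := tabw [:: 0; 1; -1; 0; 1; 0; 0; 1]%coq_Z.
Definition wg3 := tabw [:: 1; 0; 0; -1; 0; -1; -1; 0]%coq_Z.

Definition ksa_ i := addk (tensk Pu (fixw qa [:: i])) (tensk Pv (fixw qb [:: i])).

(* The row (d, i, j) of [imdelta] is [anti kim], at the code [:: d; i; j]. *)
Definition kim : kernel := fun x y =>
  let: (a, b, c) := x in
  let d := nth 0%N y.1 0 in let i := nth 0%N y.1 1 in let j := nth 0%N y.1 2 in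
  kint ((dl a d) * ((dl (c %/ 2) i * dl (b %/ 2) j - dl (c %/ 2) j * dl (b %/ 2) i)
        * dl (c %% 2) (b %% 2)))%coq_Z.

Definition imcodes : seq code :=
  [seq ([:: d, p.1 & [:: p.2]], [::]) | d <- iota 0 6, p <- [seq (i, j) | i <- iota 0 3, j <- iota 0 3]].

(* The indices 0, 1, 2, 3 stand for the summands R, V, V, S^2_0 V of the module of d eta_i. *)
Definition eta_rank (m : nat) : nat := nth 0%N [:: 0; 1; 1; 2]%N m.
Definition eta_vfun (m : nat) : vfun := nth Pe [:: Pe; Pv; Pv; P2] m.
(** As eta_i is the product of the three copies of the covector u, d eta_i retains from u o Tor only
    two kinds of terms. Those with two factors n form the tensor square of V, that is R + V + S^2_0
    V; those with one n and one u survive only through their contraction, a further V. *)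
Definition eta_kernel (i m : nat) : kernel :=
  tensk (eta_vfun m) (fixw (if m == 2%N then wnuu i else wnnu i) [::]).
Definition eta_dual (i m : nat) : kernel :=
  tensk (eta_vfun m) (fixw (if m == 2%N then wnuu_dual i else wnnu_dual i) [::]).

(** One table serves two purposes: for i = i' it separates the summands of a single d eta_i, for
    distinct i and i' it makes the three derivatives independent. *)
Lemma eta_orthogonal : all (fun i => all (fun i' => all (fun m => all (fun m' =>
    ((i == i') && (m == m')) || pairing_check pzero
      (ktable triples (ycodes (eta_rank m) 0) (eta_dual i m))
      (ktable triples (ycodes (eta_rank m') 0) (eta_kernel i' m')))
  (iota 0 4)) (iota 0 4)) (iota 0 3)) (iota 0 3).
Proof. by vm_compute. Qed.

(** E_k is a sum of binomial(3, k) decomposable forms; the weights 1296 / binomial(3, k) produce the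
    SU(2)-invariant norm on the symmetric cube of W, which Schur's lemma requires. *)
Definition E_forms := forms 1296 (increasing 4) (L3 (E_ 0)) ++ forms 432 (increasing 4) (L3 (E_ 1))
  ++ forms 432 (increasing 4) (L3 (E_ 2)) ++ forms 1296 (increasing 4) (L3 (E_ 3)).
Definition etas_forms := forms 3 (ycodes 0 3) kB3 ++ forms 288 (ycodes 1 1) kea
  ++ forms 30 (ycodes 1 3) kA2B3 ++ forms 1 (ycodes 2 3) kA4B3.

(* Up to the factor 32400, [im_dual] applies the inverse of the Gram matrix of [imdelta]. *)
Definition im_twist (y : code) : code :=
  let d := nth 0%N y.1 0 in
  ([:: 2 * nth 0%N y.1 1 + d %% 2; d %/ 2; nth 0%N y.1 2]%N, [::]).
Definition im_dual (y : code) : triple -> K := fun x =>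
  kadd (kscale 4500 (anti kim x y)) (kscale 1800 (anti kim x (im_twist y))).
Definition im_pairs : seq ((triple -> K) * (triple -> K)) :=
  [seq (anti kim ^~ y, im_dual y) | y <- imcodes].

(** A map with constants c1 and c2 contributes its orthogonal projector with weight 32400 / (c1 c2).
    On the repeated module the pairings are 6 for [ksa], 21 for [kea] and -6 between them, so
    [kea + ksa] is the part of [kea] orthogonal to [ksa], of square 15. *)
Definition torsion_forms := forms 75 (ycodes 0 3) kB3 ++ forms 5400 (ycodes 1 1) ksa
  ++ forms 300 (ycodes 2 1) kA4B1 ++ forms 2160 (ycodes 1 1) (addk kea ksa)
  ++ forms 450 (ycodes 1 3) kA2B3 ++ forms 25 (ycodes 2 3) kA4B3 ++ forms 36 (ycodes 3 1) kA6B1.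

(* Resolution of the identity of Lambda^2 T^* (x) T by the isotypic components
   of its quotient by the image of delta and by that image. *)
Lemma torsion_complete : complete_check triples torsion_forms im_pairs 32400.
Proof. by vm_compute. Qed.

(** * From certificates to kernels and isomorphisms *)

Section Assembly.
Variable R : realType.
Local Notation zr := (zr R).
Local Notation kr := (kr R).

(** Test the summation clause of [is_leaf] on the indicator of y: if no coordinate had code y, the
    left side would be zero while the right side is positive. *)
Lemma leaf_surj M cd j n p q y : @is_leaf R M cd j n p q -> y \in ycodes j n -> exists z, cd z = y.
Proof.
case=> sumM _ _ _ yin.
case: (pickP (fun z => cd z == y)) => [z /eqP <-|none]; first by exists z.
have := sumM (fun s => (s == y)%:R); rewrite big1 => [|z _]; last by rewrite none.
rewrite (big_rem y) //= eqxx => /esym /eqP; rewrite paddr_eq0 ?ler01 ?oner_eq0 //.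
by apply: sumr_ge0 => s _; rewrite ler0n.
Qed.

Lemma leaf_zero M cd j n p q k v : @is_leaf R M cd j n p q -> (v <= TorS R)%MS ->
  v *m phimx cd k = 0 <-> (forall y, y \in ycodes j n -> lform triples (tens v) (anti k ^~ y) = 0).
Proof.
move=> lf vT; split=> [v0 y /(leaf_surj lf)[z <-]|h].
  by rewrite -vx_phimx // v0 /vx mxE.
by apply/vxP => y; rewrite vx_phimx // h ?[RHS]/vx ?mxE //; case: lf.
Qed.

Lemma forms_zero t w ys k : (forall z, List.In z (forms w ys k) -> lform triples t z.2 = 0 :> R)
  <-> (forall y, y \in ys -> lform triples t (anti k ^~ y) = 0).
Proof.
elim: ys => [|y ys IH] /=; first by split.
split=> [h z|h z [<-|zin]].
- rewrite inE => /orP[/eqP ->|zin]; first exact: (h (w, anti k ^~ y) (or_introl erefl)).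
  by apply: (proj1 IH) zin => z' z'in; apply: h; right.
- by apply: h; rewrite inE eqxx.
- by apply: (proj2 IH) zin => z' z'in; apply: h; rewrite inE z'in orbT.
Qed.

Lemma leaf_forms (w : Z) M cd j n p q k v : @is_leaf R M cd j n p q -> (v <= TorS R)%MS ->
  v *m phimx cd k = 0 <->
  (forall z, List.In z (forms w (ycodes j n) k) -> lform triples (tens v) z.2 = 0).
Proof. by move=> lf vT; rewrite (leaf_zero _ lf vT) forms_zero. Qed.

Lemma Lmat3_forms (w : Z) al alk v : coded (R := R) al alk ->
  (forall a b c, kr (alk [:: a; c; b]) = - kr (alk [:: a; b; c])) -> (v <= TorS R)%MS ->
  v *m Lmat 3 al = 0 <->
  (forall z, List.In z (forms w (increasing 4) (L3 alk)) -> lform triples (tens v) z.2 = 0).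
Proof. by move=> alE alA vT; rewrite (ker_Lmat3 alE alA vT) forms_zero. Qed.

Lemma Lmat2_forms (w : Z) al alk v : coded (R := R) al alk -> (v <= TorS R)%MS ->
  v *m Lmat 2 al = 0 <->
  (forall z, List.In z (forms w (increasing 3) (L2 alk)) -> lform triples (tens v) z.2 = 0).
Proof. by move=> alE vT; rewrite (ker_Lmat2 alE vT) forms_zero. Qed.

Lemma forms_cat t (l l' : seq (Z * (triple -> K))) :
  (forall z, List.In z (l ++ l') -> lform triples t z.2 = 0 :> R)
  <-> (forall z, List.In z l -> lform triples t z.2 = 0)
   /\ (forall z, List.In z l' -> lform triples t z.2 = 0).
Proof.
split=> [h|[h h'] z /List.in_app_iff[/h|/h'] //].
by split=> z zin; apply: h; apply/List.in_app_iff; [left|right].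
Qed.

Lemma leaf_orth M cd j n p q k M' cd' j' n' p' q' k' (c : R) :
  @is_leaf R M cd j n p q -> @is_leaf R M' cd' j' n' p' q' ->
  pairing_check pzero (ktable triples (ycodes j n) k) (ktable triples (ycodes j' n') k') ->
  (c *: psimx cd k) *m phimx cd' k' = 0.
Proof.
move=> lf lf' chk; rewrite -scalemxAl (psi_phi lf lf' chk).
by apply/matrixP => i l; rewrite !mxE kr_int zr0 mulr0.
Qed.

Lemma mul_hcat0 l m (X Y : finType) (N : 'M[R]_(l, m)) (f : 'M_(m, #|X|)) (g : 'M_(m, #|Y|)) :
  N *m f = 0 -> N *m g = 0 -> N *m hcat f g = 0.
Proof. by move=> e e'; rewrite mul_hcat; apply/hcat_eq0. Qed.

Lemma vcat_mul0 l m (X Y : finType) (f : 'M[R]_(#|X|, l)) (g : 'M_(#|Y|, l)) (N : 'M[R]_(l, m)) :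
  f *m N = 0 -> g *m N = 0 -> vcat f g *m N = 0.
Proof.
by move=> e e'; rewrite mul_vcat e e'; apply/matrixP => i j; rewrite !mxE; case: enum_val => x; rewrite mxE.
Qed.

Lemma mul_hcat_eq0 m (X Y : finType) (v : 'rV[R]_m) (f : 'M_(m, #|X|)) (g : 'M_(m, #|Y|)) :
  v *m hcat f g = 0 <-> v *m f = 0 /\ v *m g = 0.
Proof. by rewrite mul_hcat hcat_eq0. Qed.

Lemma SL2_1 : SL2 (1%:M : 'M[R]_2).
Proof. exact: det1. Qed.

Lemma good_SO3 M cd j p q P w y k' c1 c2 : @is_leaf R M cd j 0 p q ->
  (forall A : 'M[R]_3, SO3 A -> intw3 A j P) ->
  image_check triples (ycodes j 0) (pten p q 1%coq_Z) (Zpos c1) (tensk P (fixw w y)) ->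
  pairing_check (pten p q (Zpos c2)) (ktable triples (ycodes j 0) k')
    (ktable triples (ycodes j 0) (tensk P (fixw w y))) ->
  goodmap (@inSO3 R) (phimx cd (tensk P (fixw w y)))
    ((zr (Zpos c1) * zr (Zpos c2))^-1 *: psimx cd k').
Proof.
move=> lf iP img prd; apply: (leaf_good lf) img prd => A B [A3 ->].
apply: (tensk_equivariant lf) => //; [exact: SL2_1 | exact: iP | exact: intw_fixw].
Qed.

Lemma good_SO3_sa M cd p q i k' c1 c2 : @is_leaf R M cd 1 0 p q ->
  image_check triples (ycodes 1 0) (pten p q 1%coq_Z) (Zpos c1) (ksa_ i) ->
  pairing_check (pten p q (Zpos c2)) (ktable triples (ycodes 1 0) k')
    (ktable triples (ycodes 1 0) (ksa_ i)) ->
  goodmap (@inSO3 R) (phimx cd (ksa_ i)) ((zr (Zpos c1) * zr (Zpos c2))^-1 *: psimx cd k').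
Proof.
move=> lf img prd; apply: (leaf_good lf) img prd => A B [A3 ->].
apply: addk_equivariant; apply: (tensk_equivariant lf) => //;
  first [exact: SL2_1 | exact: intw_Pu | exact: intw_Pv | exact: intw_fixw].
Qed.

Lemma good_SL2 M cd j n p q P w k' c1 c2 : @is_leaf R M cd j n p q ->
  (forall A : 'M[R]_3, SO3 A -> intw3 A j P) -> (forall B : 'M[R]_2, SL2 B -> intw2 B n w) ->
  image_check triples (ycodes j n) (pten p q 1%coq_Z) (Zpos c1) (tensk P w) ->
  pairing_check (pten p q (Zpos c2)) (ktable triples (ycodes j n) k')
    (ktable triples (ycodes j n) (tensk P w)) ->
  goodmap (@inSO3SL2 R) (phimx cd (tensk P w))
    ((zr (Zpos c1) * zr (Zpos c2))^-1 *: psimx cd k').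
Proof.
move=> lf iP iw img prd; apply: (leaf_good lf) img prd => A B [A3 B2].
by apply: (tensk_equivariant lf) => //; [exact: iP | exact: iw].
Qed.

Let lA0 := leaf_Amod (e := 0) (symmx0_proj R 2).
Let lA2 := leaf_Amod (e := 2) (symmx1_proj R 2).
Let lA4 := leaf_Amod (e := 4) (harm2_proj R).
Let lB3 := leaf_Bmod (symmx3_proj R 1).
Let lA2B1 := leaf_mtens (e := 2) (symmx1_proj R 2) (symmx1_proj R 1).
Let lA4B1 := leaf_mtens (e := 4) (harm2_proj R) (symmx1_proj R 1).
Let lA2B3 := leaf_mtens (e := 2) (symmx1_proj R 2) (symmx3_proj R 1).
Let lA4B3 := leaf_mtens (e := 4) (harm2_proj R) (symmx3_proj R 1).
Let lA6B1 := leaf_mtens (e := 6) (harm3_proj R) (symmx1_proj R 1).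

(** The first constant is the scale of the projector (6 for A^4 and for B^3, 30 for A^6, multiplied
    for tensor products); the second is the pairing constant of the two kernels on a < b. *)
Local Notation psic c1 c2 cd k := ((zr (Zpos c1) * zr (Zpos c2))^-1 *: psimx cd k).
Local Notation cA e := (@cdA R e).
Local Notation cT e n := (@cdT R e n).

Ltac leaf := first [exact: lA0 | exact: lA2 | exact: lA4 | exact: lB3 | exact: lA2B1
  | exact: lA4B1 | exact: lA2B3 | exact: lA4B3 | exact: lA6B1].
Ltac orth := repeat first [apply: mul_hcat0 | apply: vcat_mul0];
  (apply: leaf_orth; [leaf | leaf | by vm_compute]).

(** * The module of d sigma *)

Definition sigma_phi := hcat (phimx (@cdB R 3) kB3)
  (hcat (phimx (cT 2 1) ksa) (phimx (cT 4 1) kA4B1)).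
Definition sigma_psi := vcat (psic 6 72 (@cdB R 3) kB3)
  (vcat (psic 1 6 (cT 2 1) ksa) (psic 6 18 (cT 4 1) kA4B1)).

Lemma good_B3 : goodmap (@inSO3SL2 R) (phimx (@cdB R 3) kB3) (psic 6 72 (@cdB R 3) kB3).
Proof. by apply: (good_SL2 lB3); [exact: intw_Pe | exact: intw_qs | vm_compute | vm_compute]. Qed.

Lemma good_sigma : goodmap (@inSO3SL2 R)
  (M := msum (Bmod R 3) (msum (mtens (Amod R 2) (Bmod R 1)) (mtens (Amod R 4) (Bmod R 1))))
  sigma_phi sigma_psi.
Proof.
apply: good_msum; first exact: good_B3; [apply: good_msum | orth | orth].
- apply: (leaf_good lA2B1); [|by vm_compute|by vm_compute] => A B [A3 B2].
  apply: addk_equivariant; apply: (tensk_equivariant lA2B1) => //;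
    first [exact: intw_Pu | exact: intw_Pv | exact: intw_qa | exact: intw_qb].
- by apply: (good_SL2 lA4B1); [exact: intw_P2 | exact: intw_qa | vm_compute | vm_compute].
- orth.
- orth.
Qed.

(** The certificate is 144 |d sigma|^2 = |phi_1|^2 + 72 |phi_2|^2 + 4 |phi_3|^2 on torsion tensors,
    for the three maps to B^3, A^2 (x) B^1 and A^4 (x) B^1. *)
Lemma ker_sigma (v : 'rV[R]_#|Xt|) : (v <= TorS R)%MS -> v *m sigma_phi = 0 <-> v *m Lmat 2 (sigma R) = 0.
Proof.
move=> vT; rewrite (Lmat2_forms 144 (sigma_coded R) vT) !mul_hcat_eq0.
rewrite (leaf_forms 1 _ lB3 vT) (leaf_forms 72 _ lA2B1 vT) (leaf_forms 4 _ lA4B1 vT) -!forms_cat.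
by symmetry; apply: sos_zeros; vm_compute.
Qed.

Lemma sigma_qiso : qiso (TorS R) (kermx (Lmat 2 (sigma R))) (@rhoT R) (@inSO3SL2 R)
  (msum (Bmod R 3) (msum (mtens (Amod R 2) (Bmod R 1)) (mtens (Amod R 4) (Bmod R 1)))).
Proof.
apply: (good_qiso good_sigma) => v vT; rewrite ker_sigma //.
by split=> [e|/sub_kermxP //]; apply/sub_kermxP.
Qed.

(** B^3 is four-dimensional, so it restricts to four trivial SO(3)-modules, one for each sorted
    index of a symmetric 3-tensor on W; a factor B^1 gives two copies, one for each frozen index. *)
Lemma sigma_SO3_qiso : qiso (TorS R) (kermx (Lmat 2 (sigma R))) (@rhoT R) (@inSO3 R)
  (msum (msum (Amod R 0) (msum (Amod R 0) (msum (Amod R 0) (Amod R 0))))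
        (msum (msum (Amod R 2) (Amod R 2)) (msum (Amod R 4) (Amod R 4)))).
Proof.
pose phiR y := phimx (cA 0) (tensk Pe (fixw qs y)).
pose phiV i := phimx (cA 2) (ksa_ i).
pose phiS i := phimx (cA 4) (tensk P2 (fixw qa [:: i])).
pose psiR c y := psic 1 c (cA 0) (tensk Pe (fixw qs y)).
pose psiV i := psic 1 6 (cA 2) (ksa_ i).
pose psiS i := psic 6 18 (cA 4) (tensk P2 (fixw qa [:: i])).
pose phi := hcat (hcat (phiR [:: 0; 0; 0]%N) (hcat (phiR [:: 0; 0; 1]%N)
    (hcat (phiR [:: 0; 1; 1]%N) (phiR [:: 1; 1; 1]%N))))
  (hcat (hcat (phiV 0%N) (phiV 1%N)) (hcat (phiS 0%N) (phiS 1%N))).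
pose psi := vcat (vcat (psiR 432%positive [:: 0; 0; 0]%N) (vcat (psiR 144%positive [:: 0; 0; 1]%N)
    (vcat (psiR 144%positive [:: 0; 1; 1]%N) (psiR 432%positive [:: 1; 1; 1]%N))))
  (vcat (vcat (psiV 0%N) (psiV 1%N)) (vcat (psiS 0%N) (psiS 1%N))).
have good : goodmap (@inSO3 R) (M := msum (msum (Amod R 0) (msum (Amod R 0) (msum (Amod R 0) (Amod R 0))))
        (msum (msum (Amod R 2) (Amod R 2)) (msum (Amod R 4) (Amod R 4)))) phi psi.
  rewrite /phi /psi /phiR /phiV /phiS /psiR /psiV /psiS.
  repeat first [ apply: (good_SO3 lA0) (intw_Pe (R := R)) _ _; by vm_compute
    | apply: (good_SO3 lA4) (intw_P2 (R := R)) _ _; by vm_compute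
    | apply: (good_SO3_sa lA2); by vm_compute | apply: good_msum | orth].
apply: (good_qiso good) => v vT.
rewrite -(rwP sub_kermxP) (Lmat2_forms 144 (sigma_coded R) vT) !mul_hcat_eq0.
(* The weights 1, 3, 3, 1 count the orderings of each sorted index; they recover the norm over all
   eight indices of B^3. *)
rewrite (leaf_forms 1 (tensk Pe (fixw qs [:: 0; 0; 0]%N)) lA0 vT).
rewrite (leaf_forms 3 (tensk Pe (fixw qs [:: 0; 0; 1]%N)) lA0 vT).
rewrite (leaf_forms 3 (tensk Pe (fixw qs [:: 0; 1; 1]%N)) lA0 vT).
rewrite (leaf_forms 1 (tensk Pe (fixw qs [:: 1; 1; 1]%N)) lA0 vT).
rewrite !(leaf_forms 72 _ lA2 vT) !(leaf_forms 4 _ lA4 vT) -!forms_cat.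
by symmetry; apply: sos_zeros; vm_compute.
Qed.

(** * The module of d gamma_hat *)

Lemma gamma_hat_qiso : qiso (TorS R) (kermx (Lmat 3 (gamma_hat R))) (@rhoT R) (@inSO3 R)
  (msum (Amod R 0) (msum (msum (Amod R 2) (msum (Amod R 2) (Amod R 2))) (Amod R 4))).
Proof.
pose phiV w := phimx (cA 2) (tensk Pv (fixw w [::])).
pose psiV c w := psic 1 c (cA 2) (tensk Pv (fixw w [::])).
pose phi := hcat (phimx (cA 0) (tensk Pe (fixw wg [::])))
  (hcat (hcat (phiV wg1) (hcat (phiV wg2) (phiV wg3))) (phimx (cA 4) (tensk P2 (fixw wg [::])))).
pose psi := vcat (psic 1 48 (cA 0) (tensk Pe (fixw wg [::])))
  (vcat (vcat (psiV 12%positive wg1) (vcat (psiV 12%positive wg2) (psiV 8%positive wg3)))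
        (psic 6 24 (cA 4) (tensk P2 (fixw wg [::])))).
have good : goodmap (@inSO3 R)
    (M := msum (Amod R 0) (msum (msum (Amod R 2) (msum (Amod R 2) (Amod R 2))) (Amod R 4))) phi psi.
  rewrite /phi /psi /phiV /psiV.
  repeat first [ apply: (good_SO3 lA0) (intw_Pe (R := R)) _ _; by vm_compute
    | apply: (good_SO3 lA2) (intw_Pv (R := R)) _ _; by vm_compute
    | apply: (good_SO3 lA4) (intw_P2 (R := R)) _ _; by vm_compute | apply: good_msum | orth].
apply: (good_qiso good) => v vT.
rewrite -(rwP sub_kermxP) (Lmat3_forms 36 (gamma_hat_coded R) (@gammak_alt R) vT) !mul_hcat_eq0.
(* The certificate writes 36 |d gamma_hat|^2 as the sum of squares with weight 3 on R, 18 on each V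
   and 1 on S^2_0 V. *)
rewrite (leaf_forms 3 _ lA0 vT) !(leaf_forms 18 _ lA2 vT) (leaf_forms 1 _ lA4 vT) -!forms_cat.
by symmetry; apply: sos_zeros; vm_compute.
Qed.

(** * The joint module of the d eta_i and d gamma_hat *)

Definition etas_phi := hcat (phimx (@cdB R 3) kB3) (hcat (phimx (cT 2 1) kea)
  (hcat (phimx (cT 2 3) kA2B3) (phimx (cT 4 3) kA4B3))).
Definition etas_psi := vcat (psic 6 72 (@cdB R 3) kB3) (vcat (psic 1 21 (cT 2 1) kea)
  (vcat (psic 6 12 (cT 2 3) kA2B3) (psic 36 36 (cT 4 3) kA4B3))).

Lemma good_etas : goodmap (@inSO3SL2 R)
  (M := msum (Bmod R 3) (msum (mtens (Amod R 2) (Bmod R 1))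
          (msum (mtens (Amod R 2) (Bmod R 3)) (mtens (Amod R 4) (Bmod R 3))))) etas_phi etas_psi.
Proof.
apply: good_msum; first exact: good_B3; [apply: good_msum | orth | orth].
- by apply: (good_SL2 lA2B1); [exact: intw_Pv | exact: intw_qe | vm_compute | vm_compute].
- apply: good_msum; [| | orth | orth].
    by apply: (good_SL2 lA2B3); [exact: intw_Pv | exact: intw_qs | vm_compute | vm_compute].
  by apply: (good_SL2 lA4B3); [exact: intw_P2 | exact: intw_qs | vm_compute | vm_compute].
- orth.
- orth.
Qed.

Lemma ker_etas (v : 'rV[R]_#|Xt|) : (v <= TorS R)%MS ->
  v *m etas_phi = 0 <-> (forall k, (k < 4)%N -> v *m Lmat 3 (Ef R k) = 0).
Proof.
move=> vT; transitivity (v *m Lmat 3 (Ef R 0) = 0 /\ v *m Lmat 3 (Ef R 1) = 0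
    /\ v *m Lmat 3 (Ef R 2) = 0 /\ v *m Lmat 3 (Ef R 3) = 0); last first.
  by split=> [[h0 [h1 [h2 h3]]] [|[|[|[|k]]]] //|h]; do !split; apply: h.
rewrite (Lmat3_forms 1296 (Ef_coded R 0) (@E_alt R 0) vT).
rewrite (Lmat3_forms 432 (Ef_coded R 1) (@E_alt R 1) vT).
rewrite (Lmat3_forms 432 (Ef_coded R 2) (@E_alt R 2) vT).
rewrite (Lmat3_forms 1296 (Ef_coded R 3) (@E_alt R 3) vT) !mul_hcat_eq0.
rewrite (leaf_forms 3 _ lB3 vT) (leaf_forms 288 _ lA2B1 vT) (leaf_forms 30 _ lA2B3 vT).
rewrite (leaf_forms 1 _ lA4B3 vT).
have : sos_check triples (E_forms ++ [seq (Z.opp w.1, w.2) | w <- etas_forms]) by vm_compute.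
move/(@sos_zeros R _ _ _ (tens v)) => /(_ isT isT); rewrite /E_forms /etas_forms.
rewrite !forms_cat => e; symmetry; exact: e.
Qed.

Lemma row_mx_ker m n1 n2 (v : 'rV[R]_m) (L : 'M_(m, n1)) (N : 'M_(m, n2)) :
  v *m row_mx L N = 0 <-> v *m L = 0 /\ v *m N = 0.
Proof.
rewrite mul_mx_row; split=> [/eqP|[-> ->]]; last by rewrite row_mx0.
by rewrite row_mx_eq0 => /andP[/eqP -> /eqP ->].
Qed.

Lemma ker_etas_row (v : 'rV[R]_#|Xt|) : (v <= TorS R)%MS ->
  v *m etas_phi = 0 <->
  v *m row_mx (Lmat 3 (eta_ R ord0)) (row_mx (Lmat 3 (eta_ R (inord 1)))
    (row_mx (Lmat 3 (eta_ R (inord 2))) (Lmat 3 (gamma_hat R)))) = 0.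
Proof.
move=> vT; rewrite ker_etas // -ker_etas_gamma !row_mx_ker; split=> [[h g]|[h0 [h1 [h2 g]]]].
  by do !split.
split=> // i.
have : i \in [:: ord0; inord 1; inord 2] by rewrite -enum3 mem_enum.
by rewrite !inE => /or3P[]/eqP->.
Qed.

Lemma etas_qiso : qiso (TorS R) (kermx (row_mx (Lmat 3 (eta_ R ord0))
    (row_mx (Lmat 3 (eta_ R (inord 1))) (row_mx (Lmat 3 (eta_ R (inord 2))) (Lmat 3 (gamma_hat R))))))
  (@rhoT R) (@inSO3SL2 R)
  (msum (Bmod R 3) (msum (mtens (Amod R 2) (Bmod R 1))
          (msum (mtens (Amod R 2) (Bmod R 3)) (mtens (Amod R 4) (Bmod R 3))))).
Proof.
by apply: (good_qiso good_etas) => v vT; rewrite -(rwP sub_kermxP) ker_etas_row.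
Qed.

(** * The module of each d eta_i, and the directness of their sum *)

Definition eta_phi i := hcat (phimx (cA 0) (eta_kernel i 0))
  (hcat (hcat (phimx (cA 2) (eta_kernel i 1)) (phimx (cA 2) (eta_kernel i 2)))
        (phimx (cA 4) (eta_kernel i 3))).
Definition eta_psi i := vcat (psic 1 2304 (cA 0) (eta_dual i 0))
  (vcat (vcat (psic 1 384 (cA 2) (eta_dual i 1)) (psic 1 384 (cA 2) (eta_dual i 2)))
        (psic 6 1152 (cA 4) (eta_dual i 3))).

Lemma eta_orth i i' m m' : i \in iota 0 3 -> i' \in iota 0 3 -> m \in iota 0 4 -> m' \in iota 0 4 ->
  (i != i') || (m != m') -> pairing_check pzero
    (ktable triples (ycodes (eta_rank m) 0) (eta_dual i m))
    (ktable triples (ycodes (eta_rank m') 0) (eta_kernel i' m')).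
Proof.
move=> i3 i'3 m4 m'4 ne.
move/allP: eta_orthogonal => /(_ i i3) /allP /(_ i' i'3) /allP /(_ m m4) /allP /(_ m' m'4).
by rewrite -(negbK (_ && _)) negb_and ne.
Qed.

Lemma good_eta i : i \in iota 0 3 -> goodmap (@inSO3 R)
  (M := msum (Amod R 0) (msum (msum (Amod R 2) (Amod R 2)) (Amod R 4))) (eta_phi i) (eta_psi i).
Proof.
move=> i3; apply: good_msum; [|apply: good_msum; [apply: good_msum| | |] | |].
- apply: (good_SO3 lA0) (intw_Pe (R := R)) _ _; move: i3; rewrite !inE;
    by case/or3P=> /eqP ->; vm_compute.
- apply: (good_SO3 lA2) (intw_Pv (R := R)) _ _; move: i3; rewrite !inE;
    by case/or3P=> /eqP ->; vm_compute.
- apply: (good_SO3 lA2) (intw_Pv (R := R)) _ _; move: i3; rewrite !inE;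
    by case/or3P=> /eqP ->; vm_compute.
- by apply: (leaf_orth _ lA2 lA2); apply: (@eta_orth i i 1 2); rewrite ?orbT.
- by apply: (leaf_orth _ lA2 lA2); apply: (@eta_orth i i 2 1); rewrite ?orbT.
- apply: (good_SO3 lA4) (intw_P2 (R := R)) _ _; move: i3; rewrite !inE;
    by case/or3P=> /eqP ->; vm_compute.
- apply: vcat_mul0.
    by apply: (leaf_orth _ lA2 lA4); apply: (@eta_orth i i 1 3); rewrite ?orbT.
  by apply: (leaf_orth _ lA2 lA4); apply: (@eta_orth i i 2 3); rewrite ?orbT.
- apply: mul_hcat0.
    by apply: (leaf_orth _ lA4 lA2); apply: (@eta_orth i i 3 1); rewrite ?orbT.
  by apply: (leaf_orth _ lA4 lA2); apply: (@eta_orth i i 3 2); rewrite ?orbT.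
- apply: mul_hcat0; [apply: mul_hcat0|].
  + by apply: (leaf_orth _ lA0 lA2); apply: (@eta_orth i i 0 1); rewrite ?orbT.
  + by apply: (leaf_orth _ lA0 lA2); apply: (@eta_orth i i 0 2); rewrite ?orbT.
  + by apply: (leaf_orth _ lA0 lA4); apply: (@eta_orth i i 0 3); rewrite ?orbT.
- apply: vcat_mul0; [apply: vcat_mul0|].
  + by apply: (leaf_orth _ lA2 lA0); apply: (@eta_orth i i 1 0); rewrite ?orbT.
  + by apply: (leaf_orth _ lA2 lA0); apply: (@eta_orth i i 2 0); rewrite ?orbT.
  + by apply: (leaf_orth _ lA4 lA0); apply: (@eta_orth i i 3 0); rewrite ?orbT.
Qed.

(** The section for one eta_i produces torsion invisible to the other two; this is the whole content
    of the direct sum. *)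
Lemma eta_cross i i' : i \in iota 0 3 -> i' \in iota 0 3 -> i != i' -> eta_psi i *m eta_phi i' = 0.
Proof.
move=> i3 i'3 ne.
have e m m' : m \in iota 0 4 -> m' \in iota 0 4 -> pairing_check pzero
    (ktable triples (ycodes (eta_rank m) 0) (eta_dual i m))
    (ktable triples (ycodes (eta_rank m') 0) (eta_kernel i' m')).
  by move=> m4 m'4; apply: eta_orth; rewrite ?ne.
repeat first [apply: mul_hcat0 | apply: vcat_mul0];
  (apply: leaf_orth; [leaf | leaf |]);
  match goal with |- is_true (pairing_check _ (ktable _ _ (eta_dual _ ?m)) (ktable _ _ (eta_kernel _ ?m'))) =>
    exact: (e m m' isT isT) end.
Qed.

Definition eta_forms i := forms 3 (ycodes 0 0) (eta_kernel i 0)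
  ++ (forms 18 (ycodes 1 0) (eta_kernel i 1) ++ forms 36 (ycodes 1 0) (eta_kernel i 2))
  ++ forms 1 (ycodes 2 0) (eta_kernel i 3).

Lemma ker_eta (i : 'I_3) (v : 'rV[R]_#|Xt|) : (v <= TorS R)%MS ->
  v *m eta_phi i = 0 <-> v *m Lmat 3 (eta_ R i) = 0.
Proof.
move=> vT; rewrite mul_Lmat_eta.
have -> : 8^-1 *: (v *m Lmat 3 (eta_cs (kr (cosk i)) (kr (sink i)))) = 0
    <-> v *m Lmat 3 (eta_cs (kr (cosk i)) (kr (sink i))) = 0.
  split=> [/eqP|->]; last exact: scaler0.
  by rewrite scaler_eq0 invr_eq0 pnatr_eq0 /= => /eqP.
rewrite (Lmat3_forms 36 (eta_coded R _ _) (@etak_alt R _ _) vT) !mul_hcat_eq0.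
rewrite (leaf_forms 3 _ lA0 vT) (leaf_forms 18 (eta_kernel i 1) lA2 vT).
rewrite (leaf_forms 36 (eta_kernel i 2) lA2 vT) (leaf_forms 1 _ lA4 vT).
have : sos_check triples (forms 36 (increasing 4) (L3 (etak (cosk i) (sink i)))
    ++ [seq (Z.opp w.1, w.2) | w <- eta_forms i]).
  by case: i => -[|[|[|i]]] // _; vm_compute.
move/(@sos_zeros R _ _ _ (tens v)) => /(_ isT isT); rewrite /eta_forms.
rewrite !forms_cat => e; symmetry; exact: e.
Qed.

Lemma ord_iota (i : 'I_3) : val i \in iota 0 3.
Proof. by rewrite mem_iota add0n ltn_ord. Qed.

Lemma eta_qiso (i : 'I_3) : qiso (TorS R) (kermx (Lmat 3 (eta_ R i))) (@rhoT R) (@inSO3 R)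
  (msum (Amod R 0) (msum (msum (Amod R 2) (Amod R 2)) (Amod R 4))).
Proof.
apply: (good_qiso (good_eta (ord_iota i))) => v vT.
by rewrite -(rwP sub_kermxP) ker_eta.
Qed.

(** If each v can be replaced by some w with the same L-value and zero N-value, then v - w has the
    same N-value and zero L-value. The image of the joint map therefore contains both factors
    separately and has the row space of a block diagonal matrix. *)
Lemma rank_row_direct m n p q (T : 'M[R]_(m, n)) (L : 'M[R]_(n, p)) (N : 'M[R]_(n, q)) :
  (forall v : 'rV_n, (v <= T)%MS -> exists2 w : 'rV_n, (w <= T)%MS & w *m L = v *m L /\ w *m N = 0) ->
  \rank (T *m row_mx L N) = (\rank (T *m L) + \rank (T *m N))%N.
Proof.
move=> dir; rewrite -rank_diag_block_mx.
have split (v : 'rV_n) : (v <= T)%MS -> (row_mx (v *m L) 0 <= T *m row_mx L N)%MS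
    /\ (row_mx 0 (v *m N) <= T *m row_mx L N)%MS.
  move=> vT; have [w wT [wL wN]] := dir v vT.
  have e1 : row_mx (v *m L) 0 = w *m row_mx L N by rewrite mul_mx_row wL wN.
  have e2 : row_mx 0 (v *m N) = (v - w) *m row_mx L N.
    by rewrite mul_mx_row !mulmxBl wL wN subrr subr0.
  by rewrite e1 e2 !submxMr // addmx_sub // eqmx_opp.
apply/eqP; rewrite eqn_leq; apply/andP; split; apply: mxrankS.
  rewrite mul_mx_row; have -> : row_mx (T *m L) (T *m N) = row_mx 1%:M 1%:M *m block_mx (T *m L) 0 0 (T *m N).
    by rewrite mul_row_block !mul1mx addr0 add0r.
  exact: submxMl.
rewrite block_mxEv col_mx_sub; apply/andP; split; apply/row_subP => i;
  rewrite row_row_mx row_mul row0 ?row_mul; by have [] := split _ (row_sub i T).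
Qed.

(** The witness is the projection v phi_i psi_i: [psi_i] is a section of [phi_i], so d eta_i is
    unchanged, while [eta_cross] kills the other derivatives. *)
Lemma eta_project (i : 'I_3) (v : 'rV[R]_#|Xt|) : (v <= TorS R)%MS ->
  exists2 w : 'rV_#|Xt|, (w <= TorS R)%MS & w *m Lmat 3 (eta_ R i) = v *m Lmat 3 (eta_ R i)
    /\ forall j : 'I_3, i != j -> w *m Lmat 3 (eta_ R j) = 0.
Proof.
move=> vT; have [_ img sec onto] := good_eta (ord_iota i).
have wT : (v *m eta_phi i *m eta_psi i <= TorS R)%MS by rewrite (submx_trans _ sec) // submxMl.
exists (v *m eta_phi i *m eta_psi i) => //; split=> [|j ij].
  apply/eqP; rewrite -subr_eq0 -mulmxBl; apply/eqP/(ker_eta i).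
    by rewrite addmx_sub // eqmx_opp.
  rewrite mulmxBl; have /submxP[x ->] := img v vT.
  by rewrite -!mulmxA onto subrr.
by apply/(ker_eta j) => //; rewrite -mulmxA eta_cross ?mulmx0 ?ord_iota.
Qed.

Lemma etas_rank : let Le := fun i : 'I_3 => Lmat 3 (eta_ R i) in
  \rank (TorS R *m row_mx (Le ord0) (row_mx (Le (inord 1)) (Le (inord 2))))
  = (\rank (TorS R *m Le ord0) + \rank (TorS R *m Le (inord 1)) + \rank (TorS R *m Le (inord 2)))%N.
Proof.
move=> Le; rewrite -addnA !rank_row_direct // => v /eta_project vP.
  have [w wT [wL wN]] := vP (inord 1); exists w => //; split=> //.
  by apply: wN; rewrite -val_eqE /= !inordK.
have [w wT [wL wN]] := vP ord0; exists w => //; split=> //.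
by apply/row_mx_ker; split; apply: wN; rewrite -val_eqE /= !inordK.
Qed.

(** * The image of T^* (x) so(3) and the undetermined component *)

Definition cdY (y : Yd) : code := ([:: val y.1.1; val y.1.2; val y.2], [::]).

Lemma imdeltaE : imdelta R = mkmx (fun (y : Yd) (x : Xt) => kr (anti kim (xcode x) (cdY y))).
Proof.
apply: eq_mkmx => -[[d i] j] [[a b] c]; rewrite krB.
have e (a' b' : 'I_6) : kr (kim (val a', val b', val c) (cdY (d, i, j)))
    = (a' == d)%:R * g6 (delta_mx i j - delta_mx j i) 1%:M c b'.
  rewrite /kim kr_int !(zrM, zrB) !zr_dl !mxE -!val_eqE /= !inordK ?ltn_mod //;
    try by rewrite ltn_divLR.
  by rewrite -!natrM !mulnb.
by rewrite /xcode /swap /= !e.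
Qed.

Lemma cdY_imcodes y : cdY y \in imcodes.
Proof.
case: y => [[d i] j]; apply/allpairsP; exists (val d, (val i, val j)).
split=> //; first by rewrite mem_iota add0n ltn_ord.
by apply/allpairsP; exists (val i, val j); rewrite !mem_iota !add0n !ltn_ord.
Qed.

Lemma sum_Yd (F : code -> R) : \sum_(y : Yd) F (cdY y) = \sum_(s <- imcodes) F s.
Proof.
transitivity (\sum_(d < 6) \sum_(i < 3) \sum_(j < 3) F ([:: val d; val i; val j], [::])).
  by rewrite pair_bigA /= pair_bigA /=; apply: eq_bigr => -[[d i] j].
rewrite /imcodes big_allpairs_dep.
rewrite (sum_ord_nat 6 (fun d => \sum_(i < 3) \sum_(j < 3) F ([:: d; val i; val j], [::]))).
apply: eq_bigr => d _; rewrite big_allpairs_dep.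
rewrite (sum_ord_nat 3 (fun i => \sum_(j < 3) F ([:: d; i; val j], [::]))).
by apply: eq_bigr => i _; rewrite (sum_ord_nat 3 (fun j => F ([:: d; i; j], [::]))).
Qed.

Lemma imdelta_phi6 : imdelta R *m phimx (cT 6 1) kA6B1 = 0.
Proof.
have chk : pairing_check pzero (ktable triples imcodes kim) (ktable triples (ycodes 3 1) kA6B1).
  by vm_compute.
rewrite imdeltaE mkmxM; apply/matrixP => i j; rewrite !mxE.
have [_ inM _ _] := lA6B1; set y := enum_val i; set z := enum_val j.
rewrite (sum_triples (fun x => kr (kA6B1 x (cdT z))) (fun x => anti_swap R kim x (cdY y))).
transitivity (kr (pzero (cdY y) (cdT z))); last exact: kr_int.
rewrite -(pairing_checkP R chk (cdY_imcodes y) (inM z)).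
by apply: eq_bigr => x _; rewrite [X in _ = _ * X]krB.
Qed.

Lemma lform_decomposition t :
  (forall z, List.In z torsion_forms -> lform triples t z.2 = 0 :> R) ->
  forall x, x \in triples ->
  zr 32400%coq_Z * t x = \sum_(u <- im_pairs) lform triples t u.2 * kr (u.1 x).
Proof. exact: (complete_checkP (isT : uniq triples) torsion_complete). Qed.

(** When all seven isotypic maps vanish on v, the resolution of the identity writes 32400 v as a
    combination of the rows of [imdelta], with coefficients given by the dual forms [im_dual]. *)
Lemma ker_imdelta (v : 'rV[R]_#|Xt|) : (v <= TorS R)%MS ->
  v *m sigma_phi = 0 -> v *m etas_phi = 0 -> v *m phimx (cT 6 1) kA6B1 = 0 ->
  (v <= imdelta R)%MS.
Proof.
move=> vT /mul_hcat_eq0[hB3 /mul_hcat_eq0[hsa hA4B1]].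
move=> /mul_hcat_eq0[_ /mul_hcat_eq0[hea /mul_hcat_eq0[hA2B3 hA4B3]]] h6.
(* The resolution uses the orthogonalized copy [kea + ksa], so the vanishing of [kea] is transferred
   to it. *)
have heb : v *m phimx (cT 2 1) (addk kea ksa) = 0.
  have -> : phimx (cT 2 1) (addk kea ksa) = phimx (cT 2 1) kea + phimx (cT 2 1) ksa.
    by apply/matrixP => i l; rewrite !mxE /addk krD.
  by rewrite mulmxDr hea hsa addr0.
have forms0 : forall z, List.In z torsion_forms -> lform triples (tens v) z.2 = 0.
  rewrite /torsion_forms !forms_cat.
  move/(leaf_forms 75 _ lB3 vT): hB3 => hB3; move/(leaf_forms 5400 _ lA2B1 vT): hsa => hsa.
  move/(leaf_forms 300 _ lA4B1 vT): hA4B1 => hA4B1; move/(leaf_forms 2160 _ lA2B1 vT): heb => heb.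
  move/(leaf_forms 450 _ lA2B3 vT): hA2B3 => hA2B3; move/(leaf_forms 25 _ lA4B3 vT): hA4B3 => hA4B3.
  move/(leaf_forms 36 _ lA6B1 vT): h6 => h6.
  exact: (conj hB3 (conj hsa (conj hA4B1 (conj heb (conj hA2B3 (conj hA4B3 h6)))))).
have dec := lform_decomposition forms0.
have n0 : zr 32400%coq_Z != 0 by apply: zr_nat_neq0.
pose w : 'rV[R]_#|Yd| := \row_i lform triples (tens v) (im_dual (cdY (enum_val i))).
suff e : zr 32400%coq_Z *: v = w *m imdelta R.
  by rewrite -(scale1r v) -(mulVf n0) -scalerA e scalemx_sub // submxMl.
(* The certificate yields the identity for a < b only; the defect G is antisymmetric, as the tensor
   and the rows of [imdelta] are, and hence vanishes everywhere. *)
pose G x := zr 32400%coq_Z * tens v x - \sum_(u <- im_pairs) lform triples (tens v) u.2 * kr (u.1 x).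
have G0 x : x \in triples -> G x = 0 by move=> xin; rewrite /G dec // subrr.
have GA x : G (swap x) = - G x.
  rewrite /G (elimT (TorSP v) vT) /im_pairs !big_map /=.
  rewrite (eq_bigr (fun y => - (lform triples (tens v) (im_dual y) * kr (anti kim x y)))).
    by rewrite sumrN; ring.
  by move=> y _; rewrite anti_swap mulrN.
apply/vxP => x; have -> : vx (zr 32400%coq_Z *: v) x = zr 32400%coq_Z * tens v (xcode x).
  by rewrite tens_xcode /vx mxE.
have -> : vx (w *m imdelta R) x = \sum_(u <- im_pairs) lform triples (tens v) u.2 * kr (u.1 (xcode x)).
  rewrite imdeltaE vx_mulmx /im_pairs big_map -sum_Yd; apply: eq_bigr => y _ /=.
  by rewrite {1}/vx mxE enum_rankK.
apply/eqP; rewrite -subr_eq0 -/(G (xcode x)); apply/eqP.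
have mem (a b c : 'I_6) : (a < b)%N -> (val a, val b, val c) \in triples.
  move=> ab; apply/allpairsP; exists ((val a, val b), val c); split=> //; last by rewrite mem_iota add0n ltn_ord.
  rewrite mem_filter; apply/andP; split=> //.
  by apply/allpairsP; exists (val a, val b); rewrite !mem_iota !add0n !ltn_ord.
case: x => [[a b] c]; rewrite /xcode /=; case: (ltngtP a b) => ab.
- by apply: G0; apply: mem.
- by rewrite -[LHS]opprK -GA G0 ?oppr0 //; apply: mem.
- by have := GA (val a, val b, val c); rewrite /swap /= ab => e; lra.
Qed.

Lemma undetermined_qiso :
  qiso (TorS R :&: kermx (row_mx (Lmat 2 (sigma R)) (row_mx (Lmat 3 (eta_ R ord0))
    (row_mx (Lmat 3 (eta_ R (inord 1))) (row_mx (Lmat 3 (eta_ R (inord 2))) (Lmat 3 (gamma_hat R)))))))%MS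
  (imdelta R) (@rhoT R) (@inSO3SL2 R) (mtens (Amod R 6) (Bmod R 1)).
Proof.
have good : goodmap (@inSO3SL2 R) (phimx (cT 6 1) kA6B1) (psic 30 30 (cT 6 1) kA6B1).
  by apply: (good_SL2 lA6B1); [exact: intw_P3 | exact: intw_qa | vm_compute | vm_compute].
set L := row_mx (Lmat 2 _) _; have [eqv img sec onto] := good.
have kerL (v : 'rV[R]_#|Xt|) : (v <= TorS R)%MS ->
    v *m L = 0 <-> v *m sigma_phi = 0 /\ v *m etas_phi = 0.
  by move=> vT; rewrite row_mx_ker -ker_sigma // -ker_etas_row.
(* Orthogonality to the other summands puts the section of A^6 (x) B^1 inside the common kernel, so
   the map is still onto when restricted to that kernel. *)
have psiL : psic 30 30 (cT 6 1) kA6B1 *m L = 0.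
  apply/row_matrixP => i; rewrite row_mul row0.
  have rT := submx_trans (row_sub i _) sec.
  by apply/(kerL _ rT); split; rewrite -row_mul (_ : _ *m _ = 0) ?row0 //; orth.
exists (phimx (cT 6 1) kA6B1); split; last split.
- apply/andP; split.
    apply/row_subP => i; rewrite row_mul img // (submx_trans (row_sub _ _)) //.
    exact: capmxSl.
  rewrite -onto mulmxA submxMr // (submx_trans (submxMl _ _)) // sub_capmx sec /=.
  exact/sub_kermxP.
- move=> v; rewrite sub_capmx => /andP[vT /sub_kermxP vL]; apply/eqP/idP => [v0|].
    by have [vs ve] := proj1 (kerL v vT) vL; apply: ker_imdelta.
  by case/submxP=> x ->; rewrite -mulmxA imdelta_phi6 mulmx0.
- by move=> A B gAB v vT; rewrite -mulmxA eqv // mulmxA.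
Qed.

End Assembly.

Theorem theorem2p3 (R : realType) :
  let T := TorS R in
  let rho := @rhoT R in
  let Ls := Lmat 2 (sigma R) in
  let Le := fun i : 'I_3 => Lmat 3 (eta_ R i) in
  let Lg := Lmat 3 (gamma_hat R) in
  let mR := Amod R 0 in
  let mV := Amod R 2 in
  let mS := Amod R 4 in
  (* (1) d sigma: 4R + 2V + 2S^2_0 V, resp. B^3 + A^2 (x) B^1 + A^4 (x) B^1 *)
  (qiso T (kermx Ls) rho (@inSO3 R)
     (msum (msum mR (msum mR (msum mR mR))) (msum (msum mV mV) (msum mS mS)))
   /\ qiso T (kermx Ls) rho (@inSO3SL2 R)
     (msum (Bmod R 3) (msum (mtens (Amod R 2) (Bmod R 1)) (mtens (Amod R 4) (Bmod R 1)))))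
  (* (2) d eta_i: R + 2V + S^2_0 V, and the three are in direct sum *)
  /\ ((forall i : 'I_3,
         qiso T (kermx (Le i)) rho (@inSO3 R) (msum mR (msum (msum mV mV) mS)))
      /\ \rank (T *m row_mx (Le ord0) (row_mx (Le (inord 1)) (Le (inord 2))))
         = (\rank (T *m Le ord0) + \rank (T *m Le (inord 1)) + \rank (T *m Le (inord 2)))%N)
  (* (3) d gamma_hat: R + 3V + S^2_0 V *)
  /\ qiso T (kermx Lg) rho (@inSO3 R) (msum mR (msum (msum mV (msum mV mV)) mS))
  (* (4) d eta_0, d eta_1, d eta_2, d gamma_hat together:
         B^3 + A^2 (x) B^1 + A^2 (x) B^3 + A^4 (x) B^3 *)
  /\ qiso T (kermx (row_mx (Le ord0) (row_mx (Le (inord 1)) (row_mx (Le (inord 2)) Lg)))) rho (@inSO3SL2 R)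
       (msum (Bmod R 3) (msum (mtens (Amod R 2) (Bmod R 1))
          (msum (mtens (Amod R 2) (Bmod R 3)) (mtens (Amod R 4) (Bmod R 3)))))
  (* in particular: the intrinsic torsion not determined by d sigma, d eta_i,
     d gamma_hat (common kernel, modulo the image of T^* (x) so(3)) is A^6 (x) B^1 *)
  /\ qiso (T :&: kermx (row_mx Ls (row_mx (Le ord0) (row_mx (Le (inord 1)) (row_mx (Le (inord 2)) Lg)))))%MS
       (imdelta R) rho (@inSO3SL2 R) (mtens (Amod R 6) (Bmod R 1)).
Proof.
move=> T rho Ls Le Lg mR mV mS.
split; first by split; [exact: sigma_SO3_qiso | exact: sigma_qiso].
split; first by split; [exact: eta_qiso | exact: etas_rank].
split; first exact: gamma_hat_qiso.
by split; [exact: etas_qiso | exact: undetermined_qiso].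
Qed.
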